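(* Let $p\ge7$ be a prime, $l\ge1$, and let $V$ be a proper, non-degenerate open subset of $(0,1)$. Suppose every boundary point of $V$ has the form $\frac{s}{p^l}$ for some integer $s$, and that the greatest common divisor of all such $s$ is not divisible by $p$. Then $\chi_V\in\mathcal{C}$ if and only if $$V=(\tfrac1{p^l},\tfrac2{p^l})\cup(\tfrac3{p^l},\tfrac4{p^l})\cup\cdots\cup(\tfrac{p^l-2}{p^l},\tfrac{p^l-1}{p^l})\quad\text{or}\quad V=(0,\tfrac1{p^l})\cup(\tfrac2{p^l},\tfrac3{p^l})\cup\cdots\cup(\tfrac{p^l-1}{p^l},1).$$
   Context: An open set $V\subseteq(0,1)$ is non-degenerate if $(0,1)\setminus V$ has no isolated points. $\chi_V$ is the characteristic function of $V$. $L^2=L^2(0,1)$; each $\varphi\in L^2$ is identified with its odd $2$-periodic extension to $\mathbb{R}$. $\mathcal{C}$ is the set of $\varphi\in L^2$ such that the span of $\{\varphi(kx):k\in\mathbb{N}\}$ is dense in $L^2$. *)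

(* Defs.v *)
From HB Require Import structures.
From mathcomp Require Import all_boot all_order all_algebra.
From mathcomp Require Import all_classical all_reals all_analysis.
Set Implicit Arguments. Unset Strict Implicit. Unset Printing Implicit Defensive.
Import Order.TTheory GRing.Theory Num.Theory numFieldNormedType.Exports.
Local Open Scope classical_set_scope.
Local Open Scope ring_scope.

Section Defs.
Context {R : realType}.

Definition I01 : set R := `]0, 1[%classic.

Definition boundary (V : set R) : set R := closure V `\` interior V.

Definition nondegenerateV (V : set R) : Prop :=
  forall x, ~ isolated (I01 `\` V) x.

(* odd 2-periodic extension of phi (only the values of phi on (0,1) are used;
   the extension is set to 0 on the null set of integers) *)
Definition oddext (phi : R -> R) (x : R) : R :=
  let y := x - 2 * (Num.floor (x / 2))%:~R in
  if (0 < y) && (y < 1) then phi y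
  else if (1 < y) then - phi (2 - y) else 0.

Definition L2 (g : R -> R) : Prop :=
  measurable_fun I01 g /\
  (\int[@lebesgue_measure R]_(x in I01) ((g x) ^+ 2)%:E < +oo)%E.

Definition inC (phi : R -> R) : Prop :=
  L2 phi /\
  forall g, L2 g -> forall eps : R, 0 < eps ->
    exists (n : nat) (c : nat -> R),
      (\int[@lebesgue_measure R]_(x in I01)
         ((g x - \sum_(1 <= k < n.+1) c k * oddext phi (k%:R * x)) ^+ 2)%:E
       < eps%:E)%E.

Definition Vodd (q : nat) : set R :=
  [set x | exists2 j : nat, (j < (q - 1) %/ 2)%N &
     (2 * j + 1)%:R / q%:R < x /\ x < (2 * j + 2)%:R / q%:R].

Definition Veven (q : nat) : set R :=
  [set x | exists2 j : nat, (j < (q + 1) %/ 2)%N &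
     (2 * j)%:R / q%:R < x /\ x < (2 * j + 1)%:R / q%:R].

End Defs.

(* Main.v *)
(* A function phi = chi_V is a step function on the grid 1/q, q = p^l, and its
   sine coefficients are f n / n with f real, even and 2q-periodic.  In these
   coefficients the dilations phi(kx) become shifts of a Dirichlet series, so
   phi in C says that 1 is an l^2-limit of products of F(s) = sum f(n) n^{-1-s}
   with Dirichlet polynomials.

   Necessity.  Evaluate such a limit against completely multiplicative weights
   supported on finitely many primes r, of size at most 1/(2r): the resulting
   functionals of f never vanish.  For a residue class b whose primes have a
   divergent sum of reciprocals, let the weight be z/(2r) on many primes of b;
   this gives a polynomial in z without zeros in the disc, growing at most like
   the exponential of Z = sum 1/r, and averaging the logarithm of its modulus
   against 1 +- cos 2 theta bounds its second log-coefficient by O(Z).  The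
   quadratic term in Z must vanish, which forces f(b n) = t f(n) with t = 1 or
   t = -1.  Such classes generate all units mod 2q (a sieve replaces Dirichlet's
   theorem).  By Fourier inversion the jumps e(k) of chi_V at k/q satisfy
   e(a k) = t(a) e(k) for all units a; as nonzero jumps alternate in sign,
   comparing a few values of t leaves only V_odd and V_even.

   Sufficiency.  For these two sets F is, up to a constant, (1 + eps T_q) applied
   to sum_{n odd} n^{-1-s}, where T_q is the shift n -> q n; sieving out the
   primes and taking Fejer means of the powers of -eps T_q approximates 1. *)
Require Import Defs.
From HB Require Import structures.
From mathcomp Require Import all_boot all_order all_algebra.
From mathcomp Require Import all_classical all_reals all_analysis.
From mathcomp Require Import measurable_realfun complex cyclic.
From mathcomp Require Import ring lra zify.
Set Implicit Arguments. Unset Strict Implicit. Unset Printing Implicit Defensive.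
Import Order.TTheory GRing.Theory Num.Theory numFieldNormedType.Exports.
Local Open Scope classical_set_scope.
Local Open Scope ring_scope.

(** * A second-coefficient bound for polynomials without zeros in the disc *)

(** The obstacle in the necessity part is to turn the non-vanishing of functionals into exact
    identities for f. If P has no zeros in the closed disc, an upper bound for log |P| alone
    controls the low coefficients of log P. The second one is used because along one class b it
    carries Z^2 times U(b)^2 - U(1) U(b^2), U being f summed against the other weights, while log
    |P| grows only like Z. To stay within polynomials, each Euler factor, the sum of y^i h(g r^i),
    is multiplied by 1 - y^M with M a period of r^i, and circle averages become averages over N-th
    roots of unity with N tending to infinity. The cumulant identity holds for every choice of
    further weights, so coefficients in these weights may be compared one prime at a time; the real
    ratio t is a root of unity by periodicity, hence a sign. In the sufficiency part 1 + eps T_q has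
    no bounded inverse: T_q is an isometry of l^2 and its powers do not decay. The Fejer means
    converge only on the vector at hand, whose images under the powers of T_q have disjoint
    supports. *)

Section ComplexModulus.
Context {R : realType}.
Implicit Types (x y z : R[i]) (t : R).

(** Working with the squared modulus avoids square roots; a bound on [ln (modsq _)] is twice a bound
    on the logarithm of the modulus. *)
Definition modsq z : R := complex.Re z ^+ 2 + complex.Im z ^+ 2.

Lemma modsq_ge0 z : 0 <= modsq z.
Proof. by rewrite addr_ge0 ?sqr_ge0. Qed.

Lemma modsqM x y : modsq (x * y) = modsq x * modsq y.
Proof. by case: x => a b; case: y => c d; rewrite /modsq /=; ring. Qed.

Lemma modsq1 : modsq 1 = 1.
Proof. by rewrite /modsq /= expr1n expr0n addr0. Qed.

Lemma modsq_eq0 z : (modsq z == 0) = (z == 0).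
Proof.
case: z => a b; rewrite /modsq paddr_eq0 ?sqr_ge0 //= !sqrf_eq0.
by rewrite eq_complex.
Qed.

Lemma modsq_gt0 z : (0 < modsq z) = (z != 0).
Proof. by rewrite lt_def modsq_ge0 andbT modsq_eq0. Qed.

Lemma modsqX z n : modsq (z ^+ n) = modsq z ^+ n.
Proof. by elim: n => [|n IH]; rewrite ?expr0 ?modsq1 // !exprS modsqM IH. Qed.

Lemma modsqV z : modsq z^-1 = (modsq z)^-1.
Proof.
have [->|z0] := eqVneq z 0.
  by rewrite invr0 /modsq /= !expr0n addr0 invr0.
have n0 : modsq z != 0 by rewrite modsq_eq0.
by apply: (mulfI n0); rewrite -modsqM !divff ?modsq1.
Qed.

Lemma modsqR t : modsq (t%:C)%C = t ^+ 2.
Proof. by rewrite /modsq /= expr0n addr0. Qed.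

Lemma modsq_prod (I : Type) (s : seq I) (F : I -> R[i]) :
  modsq (\prod_(i <- s) F i) = \prod_(i <- s) modsq (F i).
Proof. by elim/big_rec2: _ => [|i y x _ <-]; rewrite ?modsq1 ?modsqM. Qed.

Lemma normc_sqr z : Normc.normc z ^+ 2 = modsq z.
Proof. by case: z => a b; rewrite /= sqr_sqrtr // addr_ge0 ?sqr_ge0. Qed.

Lemma normc_ge0 z : 0 <= Normc.normc z.
Proof. by case: z => a b; rewrite /= sqrtr_ge0. Qed.

Lemma normcD x y : Normc.normc (x + y) <= Normc.normc x + Normc.normc y.
Proof. exact: (@le_normcD R x y). Qed.

Lemma normc_opp z : Normc.normc (- z) = Normc.normc z.
Proof. exact: (@normcN R z). Qed.

Lemma normcX z n : Normc.normc (z ^+ n) = Normc.normc z ^+ n.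
Proof.
by elim: n => [|n IH]; rewrite ?expr0 ?Normc.normc1 // !exprS Normc.normcM IH.
Qed.

Lemma normcR t : Normc.normc (t%:C)%C = `|t|.
Proof. by rewrite /= expr0n addr0 sqrtr_sqr. Qed.

Lemma normc_sum (I : Type) (s : seq I) (P : pred I) (F : I -> R[i]) :
  Normc.normc (\sum_(i <- s | P i) F i) <= \sum_(i <- s | P i) Normc.normc (F i).
Proof.
elim/big_rec2: _ => [|i y x _ IH]; first by rewrite Normc.normc0.
by apply: le_trans (normcD _ _) _; rewrite lerD2l.
Qed.

Lemma normc_Re z : `|complex.Re z| <= Normc.normc z.
Proof.
case: z => a b /=; rewrite -sqrtr_sqr ler_wsqrtr //.
by rewrite lerDl sqr_ge0.
Qed.

Lemma modsq_le1 z : (modsq z <= 1) = (Normc.normc z <= 1).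
Proof. by rewrite -normc_sqr expr_le1 // normc_ge0. Qed.

Lemma modsq_lt1 z : (modsq z < 1) = (Normc.normc z < 1).
Proof. by rewrite -normc_sqr expr_lt1 // normc_ge0. Qed.

Lemma ReD x y : complex.Re (x + y) = complex.Re x + complex.Re y.
Proof. by case: x => a b; case: y. Qed.

Lemma Re_sum (I : Type) (s : seq I) (P : pred I) (F : I -> R[i]) :
  complex.Re (\sum_(i <- s | P i) F i) = \sum_(i <- s | P i) complex.Re (F i).
Proof. by elim/big_rec2: _ => [|i y x _ <-]; rewrite ?ReD. Qed.

Lemma ReRM t z : complex.Re ((t%:C)%C * z) = t * complex.Re z.
Proof. by case: z => a b /=; rewrite mul0r subr0. Qed.

End ComplexModulus.

(** * Averages over roots of unity *)

Section RootsOfUnity.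
Context {R : realType}.
Implicit Types (x z u : R[i]) (t s : R) (n N : nat).

Definition expi t : R[i] := (cos t +i* sin t)%C.

Lemma expiD t s : expi (t + s) = expi t * expi s.
Proof.
by apply/eqP; rewrite eq_complex /= cosD sinD (addrC (_ * cos s)) eqxx /= addrC.
Qed.

Lemma expi0 : expi 0 = 1.
Proof. by rewrite /expi cos0 sin0. Qed.

Lemma expiMn t n : expi (t *+ n) = expi t ^+ n.
Proof. by elim: n => [|n IH]; rewrite ?expi0 // mulrS expiD IH exprS. Qed.

Lemma modsq_expi t : modsq (expi t) = 1.
Proof. by rewrite /modsq /= cos2Dsin2. Qed.

Definition uroot N : R[i] := expi (2 * pi / N%:R).

Lemma uroot_expN N : (0 < N)%N -> uroot N ^+ N = 1.
Proof.
move=> N0; rewrite -expiMn -(mulr_natr (2 * pi / _) N) divfK ?pnatr_eq0 -?lt0n //.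
by rewrite /expi mulr_natl cos2pi sin2pi.
Qed.

Lemma uroot_neq1 N j : (0 < j < N)%N -> uroot N ^+ j != 1.
Proof.
move=> /andP[j0 jN]; rewrite -expiMn; apply/eqP => -[].
set a := (2 * pi / N%:R) *+ j => ca _.
have Ea : a = (pi * j%:R / N%:R) *+ 2.
  by rewrite /a -(mulr_natr (2 * pi / _) j) -[RHS]mulr_natl; ring.
move: ca; rewrite Ea cos_mulr2n cos2sin2 => ca.
have : sin (pi * j%:R / N%:R : R) ^+ 2 = 0 by rewrite mulr2n in ca; lra.
move/eqP; rewrite sqrf_eq0 => /eqP s0.
have N0 : (0 : R) < N%:R by rewrite ltr0n; apply: leq_trans jN.
suff : 0 < sin (pi * j%:R / N%:R : R) by rewrite s0 ltxx.
apply: sin_gt0_pi; rewrite divr_gt0 ?mulr_gt0 ?pi_gt0 ?ltr0n ?(ltn_trans j0 jN) //=.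
by rewrite ltr_pdivrMr // ltr_pM2l ?pi_gt0 // ltr_nat.
Qed.

Lemma sum_uroot N j : (0 < N)%N ->
  \sum_(k < N) uroot N ^+ (j * k) = if (N %| j)%N then N%:R else 0.
Proof.
move=> N0; case: ifPn => [/dvdnP[m ->]|Nj].
  under eq_bigr do rewrite mulnAC mulnC exprM uroot_expN // expr1n.
  by rewrite sumr_const card_ord.
have j1 : uroot N ^+ j != 1.
  rewrite (divn_eq j N) exprD mulnC exprM uroot_expN // expr1n mul1r.
  by apply: uroot_neq1; rewrite ltn_mod N0 lt0n andbT.
have := subrX1 (uroot N ^+ j) N.
rewrite -exprM mulnC exprM uroot_expN // expr1n subrr => /esym/eqP.
rewrite mulf_eq0 subr_eq0 (negPf j1) /= => /eqP E.
by rewrite -[RHS]E; apply: eq_bigr => k _; rewrite exprM.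
Qed.

End RootsOfUnity.

Section LogAverage.
Context {R : realType}.
Implicit Types (x z u : R[i]) (t s : R) (n N : nat).

(* the nonnegative kernel 1 + s cos(2 theta) at the k-th N-th root of unity *)
Definition kernel2 s N k : R := 1 + s * complex.Re (uroot N ^+ (2 * k)).

Lemma modsq_uroot N k : modsq (@uroot R N ^+ k) = 1.
Proof. by rewrite modsqX modsq_expi expr1n. Qed.

Lemma kernel2_ge0 s N k : `|s| <= 1 -> 0 <= kernel2 s N k.
Proof.
move=> s1; rewrite /kernel2 addrC -lerBlDr sub0r.
have := normc_Re (@uroot R N ^+ (2 * k)).
have : Normc.normc (@uroot R N ^+ (2 * k)) <= 1.
  by rewrite -modsq_le1 modsq_uroot.
move=> h1 h2; have h3 := le_trans h2 h1.
have : `|s * complex.Re (uroot N ^+ (2 * k))| <= 1.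
  by rewrite normrM -[leRHS]mulr1 ler_pM.
by rewrite ler_norml => /andP[].
Qed.

Lemma sum_kernel2 s N : (2 < N)%N -> \sum_(k < N) kernel2 s N k = N%:R.
Proof.
move=> N2; rewrite big_split /= sumr_const card_ord -mulr_sumr -Re_sum.
rewrite sum_uroot ?(ltn_trans _ N2) //.
by rewrite gtnNdvd //= mulr0 addr0.
Qed.

(** The real part is half the sum of the root and its conjugate; [N - 2] stands for the exponent -2,
    so that all exponents stay natural numbers. *)
Lemma kernel2E s N k : (2 <= N)%N -> ((kernel2 s N k)%:C)%C =
  1 + ((s / 2)%:C)%C * (uroot N ^+ (2 * k) + uroot N ^+ ((N - 2) * k)).
Proof.
move=> N2.
have -> : @uroot R N ^+ ((N - 2) * k) = (uroot N ^+ (2 * k))^*%C.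
  have h : uroot N ^+ (2 * k) * uroot N ^+ ((N - 2) * k) = 1 :> R[i].
    by rewrite -exprD -mulnDl subnKC // exprM uroot_expN ?expr1n //; lia.
  have h' : uroot N ^+ (2 * k) * (uroot N ^+ (2 * k))^*%C = 1 :> R[i].
    have := modsq_uroot N (2 * k); case: (_ ^+ _) => a b; rewrite /modsq /= => E.
    by apply/eqP; rewrite eq_complex /= -E; apply/andP; split; apply/eqP; ring.
  have n0 : uroot N ^+ (2 * k) != 0 :> R[i].
    by rewrite -modsq_eq0 modsq_uroot oner_eq0.
  by apply: (mulfI n0); rewrite h h'.
rewrite /kernel2; case: (_ ^+ _) => a b /=.
by apply/eqP; rewrite eq_complex /=; apply/andP; split; apply/eqP; field.
Qed.

Lemma sum_pick_exp x N j m : (0 < N)%N -> (m < N)%N ->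
  (forall i, (i < N)%N -> (N %| i + j)%N = (i == m)) ->
  \sum_(i < N) x ^+ i * (\sum_(k < N) uroot N ^+ ((i + j) * k)) = N%:R * x ^+ m.
Proof.
move=> N0 mN H; rewrite (bigD1 (Ordinal mN)) //= sum_uroot // H // eqxx.
rewrite big1 ?addr0 1?mulrC // => i im.
rewrite sum_uroot // H //; case: ifP => [/eqP e|_]; last by rewrite mulr0.
by case/eqP: im; apply: val_inj.
Qed.

(** For an N-th root of unity u, the quotient u / (1 - x u) is a finite geometric sum over
    [1 - x ^+ N]. The harmonics 0, 2 and -2 of the kernel select from it the powers x^(N-1), x^(N-3)
    and x; the first two are aliasing terms, small for large [N]. *)
Lemma sum_kernel2_geom s x N : (4 < N)%N -> modsq x < 1 ->
  \sum_(k < N) ((kernel2 s N k)%:C)%C * (uroot N ^+ k / (1 - x * uroot N ^+ k))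
  = N%:R / (1 - x ^+ N) *
    (x ^+ N.-1 + ((s / 2)%:C)%C * (x ^+ (N - 3) + x)).
Proof.
move=> N4 x1; have N0 : (0 < N)%N by lia.
have xN : 1 - x ^+ N != 0.
  rewrite subr_eq0 eq_sym; apply/eqP => /(congr1 modsq).
  rewrite modsqX modsq1 => /eqP.
  by rewrite pexpr_eq1 ?modsq_ge0 // => /eqP; lra.
have step k : uroot N ^+ k / (1 - x * uroot N ^+ k) =
    (1 - x ^+ N)^-1 * \sum_(i < N) x ^+ i * uroot N ^+ ((i + 1) * k).
  have d0 : 1 - x * uroot N ^+ k != 0.
    rewrite subr_eq0 eq_sym; apply/eqP => /(congr1 modsq).
    by rewrite modsqM modsq_uroot mulr1 modsq1; lra.
  have := subrX1 (x * uroot N ^+ k) N.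
  rewrite exprMn -exprM (mulnC k) exprM uroot_expN // expr1n mulr1 => E.
  apply: (mulIf d0); rewrite mulrVK ?unitfE //.
  apply: (mulfI xN); rewrite [RHS]mulrA [X in _ = X * _]mulrA divff // mul1r.
  have -> : (1 - x ^+ N) * uroot N ^+ k = uroot N ^+ k * - (x ^+ N - 1) by ring.
  rewrite E mulr_suml mulr_sumr -sumrN mulr_sumr.
  apply: eq_bigr => i _; rewrite exprMn -exprM mulnDl mul1n exprD.
  by rewrite (mulnC k); ring.
have N2 : (2 <= N)%N by lia.
under eq_bigr => k _ do rewrite step kernel2E //.
transitivity ((1 - x ^+ N)^-1 *
  (\sum_(i < N) x ^+ i * (\sum_(k < N) uroot N ^+ ((i + 1) * k)) +
   ((s / 2)%:C)%C * (\sum_(i < N) x ^+ i * (\sum_(k < N) uroot N ^+ ((i + 3) * k)) +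
    \sum_(i < N) x ^+ i * (\sum_(k < N) uroot N ^+ ((i + N.-1) * k))))).
  rewrite -big_split /= mulr_sumr -big_split /= mulr_sumr.
  under [RHS]eq_bigr => i _.
    rewrite -mulrDr -big_split /= mulrCA -mulrDr mulr_sumr -big_split /=.
    rewrite mulr_sumr mulr_sumr. over.
  rewrite exchange_big /=; apply: eq_bigr => k _.
  rewrite mulrCA mulr_sumr mulr_sumr; apply: eq_bigr => i _.
  have -> : ((i + 3) * k = (i + 1) * k + 2 * k)%N by lia.
  have -> : ((i + N.-1) * k = (i + 1) * k + (N - 2) * k)%N.
    by rewrite -mulnDl; congr (_ * _)%N; lia.
  by rewrite !exprD; ring.
rewrite (@sum_pick_exp x N 1 N.-1) //; first last.
- move=> i iN; apply/idP/eqP => [|->]; last by rewrite addn1 prednK.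
  by move/dvdn_leq; lia.
- by lia.
rewrite (@sum_pick_exp x N 3 (N - 3)) //; first last.
- move=> i iN; apply/idP/eqP => [/dvdnP[m E]|->]; last by rewrite subnK //; lia.
  have : (m < 2)%N by rewrite -(ltn_pmul2r N0) -E; lia.
  by case: m E => [|[|]] //; lia.
- by lia.
rewrite (@sum_pick_exp x N N.-1 1) //; first last.
  move=> i iN; apply/idP/eqP => [/dvdnP[m E]|->]; last by rewrite add1n prednK.
    have : (m < 2)%N by rewrite -(ltn_pmul2r N0) -E; lia.
  by case: m E => [|[|]] //; lia.
by rewrite expr1; ring.
Qed.

End LogAverage.

Section LogAverage2.
Context {R : realType}.
Implicit Types (x z u : R[i]) (t s : R) (n N : nat).

Lemma modsq_1sub t u :
  modsq (1 - (t%:C)%C * u) = 1 - 2 * t * complex.Re u + t ^+ 2 * modsq u.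
Proof. by case: u => a b; rewrite /modsq /=; ring. Qed.

Lemma modsq_1sub_gt0 t u : 0 <= t <= 1 -> modsq u < 1 ->
  0 < 1 - 2 * t * complex.Re u + t ^+ 2 * modsq u.
Proof.
move=> /andP[t0 t1] u1; rewrite -modsq_1sub modsq_gt0 subr_eq0.
apply/eqP => /(congr1 modsq); rewrite modsq1 modsqM modsqR => E.
have : t ^+ 2 * modsq u <= modsq u.
  by rewrite ler_piMl ?modsq_ge0 // expr_le1.
by rewrite -E; lra.
Qed.

Lemma is_derive_ln_quad a b t : 0 < 1 - 2 * t * a + t ^+ 2 * b ->
  is_derive t (1 : R) (fun x : R => ln (1 - 2 * x * a + x ^+ 2 * b))
    ((- 2 * a + 2 * t * b) / (1 - 2 * t * a + t ^+ 2 * b)).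
Proof.
move=> H.
have h1 : is_derive t (1 : R) (fun x : R => 1 - 2 * x * a + x ^+ 2 * b)
    (- 2 * a + 2 * t * b).
  by apply: is_derive_eq; rewrite /GRing.scale /=; ring.
have h2 := is_derive1_ln H.
have h := @is_derive1_comp _ (@ln R) (fun x : R => 1 - 2 * x * a + x ^+ 2 * b)
  _ _ _ h2 h1.
by rewrite mulrC; exact: h.
Qed.

Lemma Re_div_1sub t u : 0 <= t <= 1 -> modsq u < 1 ->
  (- 2 * complex.Re u + 2 * t * modsq u) /
    (1 - 2 * t * complex.Re u + t ^+ 2 * modsq u) =
  - 2 * complex.Re (u / (1 - (t%:C)%C * u)).
Proof.
move=> t01 u1; have := modsq_1sub_gt0 t01 u1.
rewrite -modsq_1sub => H.
have d0 : 1 - (t%:C)%C * u != 0 by rewrite -modsq_gt0.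
have -> : u / (1 - (t%:C)%C * u) =
  (((modsq (1 - (t%:C)%C * u))^-1)%:C)%C * (u * (1 - (t%:C)%C * u)^*%C).
  apply: (mulIf d0); rewrite mulrVK ?unitfE // -!mulrA.
  have -> : u * ((1 - (t%:C)%C * u)^*%C * (1 - (t%:C)%C * u)) =
    u * ((modsq (1 - (t%:C)%C * u))%:C)%C.
    congr (_ * _); case: (1 - _) => a b; rewrite /modsq.
    by apply/eqP; rewrite eq_complex /=; apply/andP; split; apply/eqP; ring.
  by rewrite mulrCA -rmorphM /= mulVf ?mulr1 // gt_eqF.
rewrite ReRM mulrC mulrCA; congr (_ * _).
by case: u {H d0 u1} => a b; rewrite /modsq /=; ring.
Qed.

(* Only the harmonics 0 and +-2 of the kernel survive, up to aliasing. *)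
Lemma log_average s z N : `|s| <= 1 -> modsq z < 1 -> (4 < N)%N ->
  `| N%:R^-1 * \sum_(k < N) kernel2 s N k * ln (modsq (1 - z * uroot N ^+ k))
     + s * complex.Re (z ^+ 2) / 2 | <= 4 * Normc.normc z ^+ (N - 3) / (1 - Normc.normc z).
Proof.
move=> s1 z1 N4; set rho := Normc.normc z.
have e1 : (N - 3 <= N.-1)%N by lia.
have e2 : (N - 3 <= N.+1)%N by lia.
have e3 : (0 < N)%N by lia.
have rho0 : 0 <= rho by exact: normc_ge0.
have rho1 : rho < 1 by rewrite -modsq_lt1.
pose u k := z * uroot N ^+ k.
have u1 k : modsq (u k) < 1 by rewrite modsqM modsq_uroot mulr1.
(* Interpolation along the segment from 0 to [z]: [F 0] is 0, [F 1] is the quantity to bound, and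
   the mean value theorem leaves a bound on [dF]. *)
pose F t := N%:R^-1 * (\sum_(k < N) kernel2 s N k *
   ln (1 - 2 * t * complex.Re (u k) + t ^+ 2 * modsq (u k)))
   + t ^+ 2 * (s * complex.Re (z ^+ 2) / 2).
pose dF t := N%:R^-1 * (\sum_(k < N) kernel2 s N k *
   ((- 2 * complex.Re (u k) + 2 * t * modsq (u k)) /
    (1 - 2 * t * complex.Re (u k) + t ^+ 2 * modsq (u k))))
   + 2 * t * (s * complex.Re (z ^+ 2) / 2).
have FE : N%:R^-1 * (\sum_(k < N) kernel2 s N k * ln (modsq (1 - z * uroot N ^+ k)))
     + s * complex.Re (z ^+ 2) / 2 = F 1 - F 0.
  rewrite /F expr1n mul1r expr0n /= !mul0r addr0.
  rewrite [X in _ - _ * X]big1 ?mulr0 ?subr0.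
    congr (_ * _ + _); apply: eq_bigr => k _; congr (_ * ln _).
    have -> : 1 - z * uroot N ^+ k = 1 - ((1 : R)%:C)%C * u k by rewrite mul1r.
    by rewrite modsq_1sub expr1n mul1r.
  by move=> k _; rewrite !mul0r subr0 addr0 ln1 mulr0.
have derF t : 0 <= t <= 1 -> is_derive t 1 F (dF t).
  move=> t01; rewrite /F /dF.
  have h k : is_derive t (1 : R) (fun x : R => kernel2 s N k *
   ln (1 - 2 * x * complex.Re (u k) + x ^+ 2 * modsq (u k)))
    (kernel2 s N k *
   ((- 2 * complex.Re (u k) + 2 * t * modsq (u k)) /
    (1 - 2 * t * complex.Re (u k) + t ^+ 2 * modsq (u k)))).
    have := is_derive_ln_quad (modsq_1sub_gt0 t01 (u1 k)) => h.
    by apply: is_derive_eq; rewrite /GRing.scale.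
  have hs : is_derive t (1 : R) (fun x : R => \sum_(k < N) kernel2 s N k *
   ln (1 - 2 * x * complex.Re (u k) + x ^+ 2 * modsq (u k)))
    (\sum_(k < N) (kernel2 s N k *
   ((- 2 * complex.Re (u k) + 2 * t * modsq (u k)) /
    (1 - 2 * t * complex.Re (u k) + t ^+ 2 * modsq (u k))))).
    have hh := @is_derive_sum R R R N (fun (k : 'I_N) (x : R) => kernel2 s N k *
      ln (1 - 2 * x * complex.Re (u k) + x ^+ 2 * modsq (u k))) t 1 _ (fun k => h k).
    suff -> : (fun x : R => \sum_(k < N) kernel2 s N k *
      ln (1 - 2 * x * complex.Re (u k) + x ^+ 2 * modsq (u k))) =
      \sum_(k < N) (fun x : R => kernel2 s N k *
      ln (1 - 2 * x * complex.Re (u k) + x ^+ 2 * modsq (u k))) by exact: hh.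
    by apply/funext => x; rewrite fct_sumE.
  by apply: is_derive_eq; rewrite /GRing.scale /=; ring.
have contF : {within `[0, 1], continuous F}.
  apply: derivable_within_continuous => t; rewrite in_itv /= => t01.
  by have := derF t t01; case.
rewrite FE.
have [||c c01 ->] := @MVT_segment R F dF 0 1 ler01.
- by move=> t; rewrite in_itv /= => /andP[t0 t1]; apply: derF; rewrite !ltW.
- exact: contF.
rewrite subr0 mulr1.
move: c01; rewrite in_itv /= => c01.
set x := (c%:C)%C * z.
have x1 : modsq x < 1.
  have /andP[c0 c1] := c01.
  rewrite modsqM modsqR (le_lt_trans _ z1) // ler_piMl ?modsq_ge0 //.
  by rewrite expr_le1.
have N0 : (N%:R : R) != 0 by rewrite pnatr_eq0; lia.
have sumE : dF c = - 2 * complex.Re (z * (x ^+ N.-1 + ((s / 2)%:C)%C * (x ^+ (N - 3) + x))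
    / (1 - x ^+ N)) + c * (s * complex.Re (z ^+ 2)).
  rewrite /dF; congr (_ + _); last by field.
  under eq_bigr => k _ do rewrite Re_div_1sub // mulrCA.
  rewrite -mulr_sumr mulrCA; congr (_ * _).
  under eq_bigr => k _ do rewrite -ReRM.
  rewrite -Re_sum.
  under eq_bigr => k _ do rewrite /u [((c%:C)%C * _)]mulrA -/x -mulrA mulrCA.
  rewrite -mulr_sumr sum_kernel2_geom // -ReRM.
  congr (complex.Re _).
  have NN : ((N%:R^-1)%:C)%C * N%:R = 1 :> R[i].
    have -> : (N%:R : R[i]) = ((N%:R : R)%:C)%C by rewrite rmorph_nat.
    by rewrite -rmorphM /= mulVf.
  by rewrite -[RHS]mul1r -[X in _ = X * _]NN; ring.
have xN : 1 - x ^+ N != 0.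
  rewrite subr_eq0 eq_sym; apply/eqP => /(congr1 modsq).
  rewrite modsqX modsq1 => /eqP.
  by rewrite pexpr_eq1 ?modsq_ge0 ?lt_eqF.
(* Write x / (1 - x^N) as x + x^(N+1) / (1 - x^N): the isolated x cancels the derivative of the
   correction term exactly, and only powers with exponent at least N - 3 remain. *)
have -> : dF c = - 2 * complex.Re (z * (x ^+ N.-1 + ((s / 2)%:C)%C * (x ^+ (N - 3) + x ^+ N.+1))
    / (1 - x ^+ N)).
  rewrite sumE.
  have -> : z * (x ^+ N.-1 + ((s / 2)%:C)%C * (x ^+ (N - 3) + x)) / (1 - x ^+ N) =
   z * (x ^+ N.-1 + ((s / 2)%:C)%C * (x ^+ (N - 3) + x ^+ N.+1)) / (1 - x ^+ N)
    + (((s / 2) * c)%:C)%C * z ^+ 2.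
    apply: (mulIf xN); rewrite mulrDl !mulrVK ?unitfE // exprS rmorphM /=.
    by rewrite /x; ring.
  by rewrite ReD ReRM; field.
rewrite normrM normrN (ger0_norm (_ : 0 <= 2)) //.
have xr : Normc.normc x <= rho.
  have /andP[c0 c1] := c01.
  by rewrite Normc.normcM normcR ger0_norm // ler_piMl.
have xp m : (N - 3 <= m)%N -> Normc.normc (x ^+ m) <= rho ^+ (N - 3).
  move=> hm; rewrite normcX; apply: (@le_trans _ _ (rho ^+ m)).
    by rewrite lerXn2r ?nnegrE ?normc_ge0.
  by rewrite ler_wiXn2l // ltW.
have half y : Normc.normc (((s / 2)%:C)%C * y) <= Normc.normc y / 2.
  rewrite Normc.normcM normcR normrM (ger0_norm (_ : 0 <= 2^-1)) ?invr_ge0 //.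
  rewrite mulrC; apply: ler_wpM2l; first exact: normc_ge0.
  by rewrite ler_piMl ?invr_ge0.
have -> : 4 * rho ^+ (N - 3) / (1 - rho) = 2 * (2 * rho ^+ (N - 3) / (1 - rho)) by ring.
apply: ler_wpM2l => //; apply: le_trans (normc_Re _) _.
rewrite Normc.normcM; apply: ler_pM; rewrite ?normc_ge0 //.
  rewrite Normc.normcM; apply: le_trans (_ : 1 * (2 * rho ^+ (N - 3)) <= _); last by rewrite mul1r.
  apply: ler_pM; rewrite ?normc_ge0 //; first exact: ltW.
  apply: le_trans (normcD _ _) _.
  have h1 := xp N.-1 e1; have h2 := xp (N - 3)%N (leqnn _).
  have h3 := xp N.+1 e2.
  have h4 := half (x ^+ (N - 3) + x ^+ N.+1).
  have h5 := normcD (x ^+ (N - 3)) (x ^+ N.+1).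
  have -> : 2 * rho ^+ (N - 3) = rho ^+ (N - 3) + (rho ^+ (N - 3) + rho ^+ (N - 3)) / 2 by field.
  apply: lerD => //; apply: le_trans h4 _; rewrite ler_pM2r ?invr_gt0 //.
  by apply: le_trans h5 _; apply: lerD.
rewrite Normc.normcV lef_pV2 ?posrE ?subr_gt0 //; last first.
  by rewrite lt_def normc_ge0 andbT; apply: contra xN => /eqP/Normc.eq0_normc ->.
have : Normc.normc (1 : R[i]) <= Normc.normc (1 - x ^+ N) + Normc.normc (x ^+ N).
  by apply: le_trans (normcD _ _); rewrite subrK.
rewrite Normc.normc1 => h.
have : Normc.normc (x ^+ N) <= rho.
  rewrite normcX; apply: (@le_trans _ _ (rho ^+ N)).
    by rewrite lerXn2r ?nnegrE ?normc_ge0.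
  by apply: ler_iXnr => //; exact: ltW.
move=> h'; rewrite lerBlDr; apply: le_trans h _.
by rewrite lerD2l.
Qed.

End LogAverage2.

Lemma coefM1 (A : comNzRingType) (p q : {poly A}) :
  (p * q)`_1 = p`_0 * q`_1 + p`_1 * q`_0.
Proof. by rewrite coefM big_ord_recl big_ord1. Qed.

Lemma coefM2 (A : comNzRingType) (p q : {poly A}) :
  (p * q)`_2 = p`_0 * q`_2 + p`_1 * q`_1 + p`_2 * q`_0.
Proof. by rewrite coefM !big_ord_recl big_ord0 addr0 addrA. Qed.

(** * Second logarithmic coefficient of a zero-free polynomial *)

Section ZeroFree.
Context {R : realType}.
Local Notation C := R[i].

(* second power sum of the inverse roots when p`_0 = 1 *)
Definition psum2 (p : {poly C}) : C := p`_1 ^+ 2 - 2 * p`_0 * p`_2.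

(** Divided by the square of the constant coefficient, [psum2] is -2 times the coefficient of z^2 in
    the logarithm, which is additive over products. *)
Lemma psum2M (p q : {poly C}) :
  psum2 (p * q) = p`_0 ^+ 2 * psum2 q + q`_0 ^+ 2 * psum2 p.
Proof. by rewrite /psum2 coef0M coefM1 coefM2; ring. Qed.

Lemma psum2_prod (s : seq C) : let e := \prod_(a <- s) (1 - a%:P * 'X) in
  e`_0 = 1 /\ psum2 e = \sum_(a <- s) a ^+ 2.
Proof.
elim: s => [|a s [IH0 IH2]] /=.
  by rewrite !big_nil /psum2 !coef1 expr0n /= mulr0 subr0.
rewrite !big_cons psum2M coef0M IH0 IH2.
rewrite /psum2 !coefB !coef1 !coefCM !coefX /=.
by split; ring.
Qed.

Lemma zero_free_factor (p : {poly C}) :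
  (forall z, modsq z <= 1 -> p.[z] != 0) ->
  exists2 s : seq C, (forall a, a \in s -> modsq a < 1) &
    p = p`_0 *: \prod_(a <- s) (1 - a%:P * 'X).
Proof.
move=> H; have [r Dp] := closed_field_poly_normal p.
have p0 : p != 0.
  by apply/eqP => p0; have := H 0; rewrite p0 horner0 eqxx /modsq /= expr0n addr0 ler01 => /(_ isT).
have r1 z : z \in r -> 1 < modsq z.
  move=> zr; rewrite ltNge; apply/negP => /H; apply/negP; rewrite negbK.
  by rewrite Dp hornerZ (rootP _) ?mulr0 // root_prod_XsubC.
exists [seq a^-1 | a <- r].
  move=> _ /mapP[z zr ->]; rewrite modsqV invf_lt1; first exact: r1.
  by apply: lt_trans (r1 z zr).
have E : p = (lead_coef p * \prod_(z <- r) - z) *: \prod_(a <- r) (1 - (a^-1)%:P * 'X).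
  rewrite -scalerA [LHS]Dp; congr (_ *: _).
  have : forall z, z \in r -> z != 0.
    by move=> z /r1 z1; rewrite -modsq_gt0 (lt_trans _ z1).
  elim: r {Dp r1} => [|z r IH] h; first by rewrite !big_nil scale1r.
  rewrite !big_cons IH; last by move=> y yr; apply: h; rewrite inE yr orbT.
  rewrite -!mul_polyC !polyCM.
  have z0 : z != 0 by apply: h; rewrite inE eqxx.
  have -> : 'X - z%:P = (- z)%:P * (1 - (z^-1)%:P * 'X).
    by rewrite mulrBr mulr1 mulrA -polyCM mulNr divff // !polyCN polyC1 mulN1r opprK addrC.
  by rewrite !mulrA; congr (_ * _); rewrite -!mulrA; congr (_ * _); rewrite mulrC.
have e0 : p`_0 = lead_coef p * \prod_(z <- r) - z.
  rewrite [in LHS]E coefZ; have := (psum2_prod [seq a^-1 | a <- r]).1.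
  by rewrite big_map => ->; rewrite mulr1.
by rewrite big_map e0; exact: E.
Qed.

(** Lets the number of sample points tend to infinity: the aliasing errors of all inverse roots
    together are dominated by one geometric sequence. *)
Lemma is_cvg_le0 (a b c r : R) : 0 <= r < 1 ->
  (forall N, (4 < N)%N -> a <= b + c * r ^+ (N - 3)) -> a <= b.
Proof.
move=> /andP[r0 r1] H; apply/ler_addgt0Pr => e e0.
have : (fun n => c * r ^+ n) @ \oo --> (0 : R).
  by rewrite -(mulr0 c); apply: cvgMr; apply: cvg_expr; rewrite ger0_norm.
move/cvgrPdist_lt => /(_ e e0) [n0 _ /(_ (n0 + 2)%N)] /=.
rewrite leq_addr => /(_ isT); rewrite sub0r normrN => h.
have := H (n0 + 5)%N; rewrite (_ : n0 + 5 - 3 = n0 + 2)%N; last by lia.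
move=> /(_ ltac:(lia)) h2; apply: le_trans h2 _.
by rewrite lerD2l; apply: le_trans (ltW h); exact: ler_norm.
Qed.

(** Normalize the constant coefficient to 1. On the circle the logarithm is at most that of the
    maximum, and its mean against a nonnegative kernel of mean 1 inherits this bound. Split over the
    inverse roots, the same mean is, up to aliasing, -s / 2 times the real part of the sum of their
    squares. *)
Lemma zero_free_psum2_sign (s : R) (p : {poly C}) (M : R) : `|s| <= 1 ->
  (forall z, modsq z <= 1 -> p.[z] != 0) ->
  (forall z, modsq z = 1 -> modsq p.[z] <= M) ->
  - s * complex.Re (psum2 p / p`_0 ^+ 2) <= 2 * ln (M / modsq p`_0).
Proof.
move=> s1 H HM; have [r r1 Dp] := zero_free_factor H.
have p00 : p`_0 != 0.
  by rewrite -horner_coef0 H // /modsq /= expr0n addr0 ler01.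
set E := \prod_(a <- r) (1 - a%:P * 'X) in Dp.
have [E0 E2] : E`_0 = 1 /\ psum2 E = \sum_(a <- r) a ^+ 2 by exact: psum2_prod.
have -> : psum2 p / p`_0 ^+ 2 = \sum_(a <- r) a ^+ 2.
  rewrite -E2 {1}Dp /psum2 !coefZ E0.
  by field.
pose c := \sum_(a <- r) 4 / (1 - Normc.normc a).
pose rho := \big[Num.max/0]_(a <- r) Normc.normc a.
have rho_ge a : a \in r -> Normc.normc a <= rho.
  by move=> ar; apply: (@le_bigmax_seq _ _ _ _ _ a).
have rho01 : 0 <= rho < 1.
  rewrite /rho; apply/andP; split.
    by elim/big_rec: _ => // a x ar x0; rewrite le_max x0 orbT.
  rewrite big_seq; elim/big_rec: _ => // a x ar x0.
  by rewrite gt_max x0 andbT -modsq_lt1 r1.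
suff: - s * complex.Re (\sum_(a <- r) a ^+ 2) / 2 <= ln (M / modsq p`_0) by lra.
apply: (is_cvg_le0 (c := c) rho01) => N N4.
have N0 : 0 < (N%:R : R) by rewrite ltr0n; lia.
have mE z : modsq z = 1 -> 0 < modsq E.[z] <= M / modsq p`_0.
  move=> z1; have := HM z z1; have := H z; rewrite z1 lexx => /(_ isT).
  rewrite -modsq_gt0 Dp hornerZ modsqM coefZ E0 mulr1.
  rewrite pmulr_rgt0 ?modsq_gt0 // => -> h.
  by rewrite ler_pdivlMr ?modsq_gt0 // mulrC.
have up : N%:R^-1 * (\sum_(k < N) kernel2 s N k * ln (modsq E.[uroot N ^+ k]))
   <= ln (M / modsq p`_0).
  rewrite mulrC ler_pdivrMr //.
  apply: (@le_trans _ _ (\sum_(k < N) kernel2 s N k * ln (M / modsq p`_0))).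
    apply: ler_sum => k _; apply: ler_wpM2l; first exact: kernel2_ge0.
    have /andP[h1 h2] := mE _ (modsq_uroot N k).
    by rewrite ler_ln ?posrE // (lt_le_trans h1).
  by rewrite -mulr_suml sum_kernel2 1?mulrC //; lia.
have lnE k : ln (modsq E.[uroot N ^+ k]) =
    \sum_(a <- r) ln (modsq (1 - a * uroot N ^+ k)).
  rewrite /E horner_prod modsq_prod.
  have : forall a, a \in r -> 0 < modsq (1 - a * uroot N ^+ k).
    move=> a ar; rewrite modsq_gt0 subr_eq0; apply/eqP => /(congr1 modsq).
    by rewrite modsqM modsq_uroot modsq1 mulr1 => h; have := r1 a ar; rewrite -h ltxx.
  elim: r {r1 Dp E E0 E2 c rho rho_ge rho01 mE up} => [|a r IH] h.
    by rewrite !big_nil ln1.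
  rewrite !big_cons !hornerE.
  have hr : forall b, b \in r -> 0 < modsq (1 - b * uroot N ^+ k).
    by move=> b br; apply: h; rewrite inE br orbT.
  rewrite lnM ?posrE ?IH //; first by apply: h; rewrite inE eqxx.
  rewrite big_seq; elim/big_ind: _ => [//|x y x0 y0|b br]; first by rewrite mulr_gt0.
  by rewrite !hornerE hr.
have sw : N%:R^-1 * (\sum_(k < N) kernel2 s N k * ln (modsq E.[uroot N ^+ k])) =
  \sum_(a <- r) N%:R^-1 * \sum_(k < N) kernel2 s N k * ln (modsq (1 - a * uroot N ^+ k)).
  rewrite -mulr_sumr exchange_big /=; congr (_ * _); apply: eq_bigr => k _.
  by rewrite lnE mulr_sumr.
rewrite sw in up.
rewrite -lerBlDr; apply: le_trans up.
rewrite Re_sum mulr_sumr mulr_suml /c mulr_suml -sumrB.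
rewrite big_seq [leRHS]big_seq; apply: ler_sum => a ar.
have := log_average s1 (r1 a ar) N4; rewrite ler_norml => /andP[h _].
have h2 : 4 * Normc.normc a ^+ (N - 3) / (1 - Normc.normc a) <=
   4 / (1 - Normc.normc a) * rho ^+ (N - 3).
  rewrite mulrAC; apply: ler_wpM2l.
    by rewrite divr_ge0 // subr_ge0 ltW // -modsq_lt1 r1.
  by rewrite lerXn2r ?nnegrE ?normc_ge0 ?rho_ge //; case/andP: rho01.
have -> : - s * complex.Re (a ^+ 2) / 2 = - (s * complex.Re (a ^+ 2) / 2) by ring.
lra.
Qed.

Theorem zero_free_psum2 (p : {poly C}) (M : R) :
  (forall z, modsq z <= 1 -> p.[z] != 0) ->
  (forall z, modsq z = 1 -> modsq p.[z] <= M) ->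
  `|complex.Re (psum2 p / p`_0 ^+ 2)| <= 2 * ln (M / modsq p`_0).
Proof.
move=> H HM; rewrite ler_norml lerNl.
have h1 := zero_free_psum2_sign (s := 1) _ H HM.
have h2 := zero_free_psum2_sign (s := -1) _ H HM.
rewrite normrN normr1 in h2; rewrite normr1 in h1.
have := h1 (lexx _); have := h2 (lexx _); lra.
Qed.

End ZeroFree.

(** * Residue classes with divergent sums of reciprocals of primes *)

Lemma bounded_ndseq_tail (R : realType) (S : nat -> R) (A : R) :
  (forall m n, (m <= n)%N -> S m <= S n) -> (forall n, S n <= A) ->
  forall e, 0 < e -> exists y, forall x, S x <= S y + e.
Proof.
move=> Snd SA e e0.
have hs : has_sup (range S).
  by split; [exists (S 0%N), 0%N|exists A => _ [n _ <-]].
have [_ [y _ <-] hy] := sup_adherent e0 hs.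
exists y => x; have : S x <= sup (range S).
  by apply: ub_le_sup; [case: hs|exists x].
by lra.
Qed.

Section PrimeClasses.
Context {R : realType}.

Definition recip_sum (P : pred nat) (x : nat) : R :=
  \sum_(r < x | prime r && P r) r%:R^-1.

Definition recip_bounded (P : pred nat) := exists A, forall x, recip_sum P x <= A.

Lemma recip_sum_nd P m n : (m <= n)%N -> recip_sum P m <= recip_sum P n.
Proof.
move=> mn; rewrite /recip_sum.
rewrite (big_ord_widen_cond n (fun r => prime r && P r) (fun r => r%:R^-1)) //.
rewrite [leRHS](bigID (fun r : 'I_n => (r < m)%N)) /=.
by rewrite lerDl sumr_ge0 // => i _; rewrite invr_ge0.
Qed.

Lemma recip_sum_tail P e y : (forall x, recip_sum P x <= recip_sum P y + e) ->
  forall x, \sum_(r < x | prime r && P r && (y <= r)%N) r%:R^-1 <= e.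
Proof.
move=> H x; have := H (maxn x y); rewrite addrC -lerBlDr; apply: le_trans.
rewrite lerBrDl.
rewrite /recip_sum [leRHS](bigID (fun r : 'I__ => (y <= r)%N)) /= addrC.
rewrite (big_ord_widen_cond (maxn x y) (fun r => prime r && P r)
  (fun r => r%:R^-1)) ?leq_maxr //.
rewrite (big_ord_widen_cond (maxn x y) (fun r => prime r && P r && (y <= r)%N)
  (fun r => r%:R^-1)) ?leq_maxl //.
apply: lerD; rewrite big_mkcond [leRHS]big_mkcond /=; apply: ler_sum => r _.
  case: ifP => [/andP[-> h]|_]; first by rewrite -ltnNge h.
  by case: ifP => // _; rewrite invr_ge0.
by case: ifP => [/andP[-> _] //|_]; case: ifP => // _; rewrite invr_ge0.
Qed.

Lemma card_ord_ltn X z : (\sum_(r < X | (r < z)%N) 1 <= minn X z)%N.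
Proof.
elim: X => [|X IH]; first by rewrite big_ord0.
rewrite big_mkcond big_ord_recr /= -big_mkcond /=.
move: IH; set t := (\sum_(r < X | _) 1)%N; clearbody t; case: ifP => h; lia.
Qed.

(** As [r] is coprime to the common difference, distinct multiples of [r] in the progression have
    indices at least [r] apart, so j %/ r separates them. *)
Lemma count_dvdn_arith r D n0 J : prime r -> coprime r D ->
  (#|[pred j : 'I_J | (r %| n0 + j * D)%N]| <= (J %/ r).+1)%N.
Proof.
move=> pr crD; have r0 := prime_gt0 pr.
have lt j : (j < J)%N -> (j %/ r < (J %/ r).+1)%N.
  by move=> jJ; rewrite ltnS leq_div2r // ltnW.
pose f (j : 'I_J) : 'I_(J %/ r).+1 := Ordinal (lt j (ltn_ord j)).
rewrite -[X in (_ <= X)%N]card_ord -(card_in_imset (f := f)) ?max_card //.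
move=> i j; rewrite !inE => ri rj /(congr1 val) /= fij; apply: val_inj => /=.
have cong : (i * D = j * D %[mod r])%N.
  apply/eqP; rewrite -(eqn_modDl n0); apply/eqP.
  by move: ri rj; rewrite /dvdn => /eqP -> /eqP ->.
have : (i = j %[mod r])%N.
  apply/eqP; move/eqP: cong.
  wlog ij : i j {fij ri rj} / (i <= j)%N.
    by move=> W; case: (leqP i j) => [/W//|/ltnW/W W' h]; rewrite eq_sym W' // eq_sym.
  rewrite eq_sym (eqn_mod_dvd _ (leq_mul ij (leqnn D))) -mulnBl Gauss_dvdl //.
  by rewrite eq_sym (eqn_mod_dvd _ ij).
by move=> m; rewrite (divn_eq i r) (divn_eq j r) m fij.
Qed.

Lemma mul_closed_primes (G : pred nat) n : G 1%N ->
  (forall m k, G m -> G k -> G (m * k)%N) ->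
  (forall r, prime r -> (r %| n)%N -> G r) -> (0 < n)%N -> G n.
Proof.
move=> G1 GM; elim/ltn_ind: n => n IH H n0.
have [n1|n1] := leqP n 1; first by have -> : n = 1%N by lia.
have pn := pdiv_prime n1; have dn := pdiv_dvd n.
rewrite -(divnK dn); apply: GM; last exact: H.
apply: IH => [|r pr rd|].
- by rewrite ltn_Pdiv // prime_gt1.
- by apply: H => //; apply: dvdn_trans rd (dvdn_div dn).
- by rewrite divn_gt0 ?pdiv_gt0 // dvdn_leq.
Qed.

(* If the classes outside [G] had summable reciprocals, then almost no integer
   [n] with [n = a mod Q], [n = 1] modulo the small primes outside [G], would
   have a prime factor outside [G]; but each of them needs one. *)
Lemma prime_classes_generate Q (G : pred nat) : (1 < Q)%N ->
  G 1%N -> (forall m k, G m -> G k -> G (m * k)%N) ->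
  (forall n, G (n %% Q)%N = G n) ->
  (forall b, coprime b Q -> ~ recip_bounded (fun r => r == b %[mod Q])%N -> G b) ->
  forall a, coprime a Q -> G a.
Proof.
case: Q => // Q Q1 G1 GM GQ H a aQ; apply/negPn/negP => Ga.
pose E r := coprime r Q.+1 && ~~ G r.
have [A EA] : exists A, forall x, recip_sum E x <= A.
  have : forall b : 'I_Q.+1, exists A, forall x, coprime b Q.+1 && ~~ G b ->
      recip_sum (fun r => r == b %[mod Q.+1])%N x <= A.
    move=> b; case: (boolP (coprime b Q.+1 && ~~ G b)) => [/andP[cb Gb]|_]; last by exists 0.
    have : recip_bounded (fun r => r == b %[mod Q.+1])%N.
      by apply: contrapT => /(H b cb); apply/negP.
    by move=> [A HA]; exists A.
  move=> /choice[A HA]; exists (\sum_(b < Q.+1 | coprime b Q.+1 && ~~ G b) A b) => x.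
  rewrite /recip_sum.
  rewrite (partition_big (fun r : 'I_x => inord (r %% Q.+1) : 'I_Q.+1)
     (fun b : 'I_Q.+1 => coprime b Q.+1 && ~~ G b)) /=; last first.
    move=> r /andP[_ /andP[h1 h2]].
    by rewrite inordK ?ltn_mod // coprime_modl h1 GQ.
  apply: ler_sum => b hb; apply: le_trans (HA b x hb).
  rewrite /recip_sum big_mkcond [leRHS]big_mkcond /=; apply: ler_sum => r _.
  case: ifP => [/andP[/andP[-> _] /eqP <-]|_] /=.
    by rewrite inordK ?ltn_mod // modn_mod eqxx.
  by case: ifP.
have [y ytail] := bounded_ndseq_tail (@recip_sum_nd E) EA (e := 1 / 4) ltac:(lra).
(* [M] collects the primes of [E] below [y]. An integer congruent to 1 modulo [M] avoids all of
   them, so the prime factor in [E] that its class outside [G] forces is at least [y]. *)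
pose M := (\prod_(r < y | prime r && E r) r)%N.
have M0 : (0 < M)%N by apply: prodn_cond_gt0 => r /andP[/prime_gt0].
have cQM : coprime Q.+1 M.
  rewrite coprime_sym /M; elim/big_rec: _ => [|r x /andP[_ /andP[h _]] hx].
    by rewrite coprime1n.
  by rewrite coprimeMl h hx.
pose n0 := chinese Q.+1 M a 1.
pose D := (Q.+1 * M)%N.
have D0 : (0 < D)%N by rewrite muln_gt0 M0.
(* A second threshold bounds the number of primes of [E] below [X]: at most [z] of them are below
   [z], and the others number at most [X] times their reciprocal sum, that is X / (8 D), about J /
   8. *)
have [z ztail] := bounded_ndseq_tail (@recip_sum_nd E) EA
  (e := 1 / (8 * D%:R)) ltac:(by rewrite divr_gt0 ?mulr_gt0 ?ltr0n).
(* With this choice the final count reads J <= J / 4 + z + J / 8 + (n0 + 1) / (8 D), whereas 5 J / 8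
   exceeds z + n0 + 1. *)
pose K := (z + n0 + 1)%N.
pose J := (2 * K + 1)%N.
pose X := (n0 + J * D + 1)%N.
have cover (j : 'I_J) : exists2 r : 'I_X, prime r && E r && (y <= r)%N &
    (r %| n0 + j * D)%N.
  set n := (n0 + j * D)%N.
  have nQ : (n = a %[mod Q.+1])%N.
    by rewrite /n /D mulnCA -modnDmr modnMr addn0 chinese_modl.
  have nM : (n = 1 %[mod M])%N.
    by rewrite /n /D mulnA -modnDmr modnMl addn0 chinese_modr.
  have cn : coprime n Q.+1 by rewrite -coprime_modl nQ coprime_modl.
  have n_gt0 : (0 < n)%N.
    by move: cn Q1; case: (n) => //; rewrite /coprime gcd0n => /eqP ->.
  apply: contrapT => hn; move: Ga; rewrite -GQ -nQ GQ; apply/negP; rewrite negbK.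
  apply: (mul_closed_primes _ _ _ n_gt0) => // r pr rn.
  apply: contrapT => /negP Gr; apply: hn.
  have rX : (r < X)%N.
    apply: leq_ltn_trans (dvdn_leq n_gt0 rn) _.
    by rewrite /X /n addn1 ltnS leq_add2l leq_mul2r ltnW ?orbT.
  have Er : E r by rewrite /E Gr andbT (coprime_dvdl rn).
  exists (Ordinal rX) => //=; rewrite pr Er /= leqNgt; apply/negP => ry.
  have rM : (r %| M)%N.
    by rewrite /M (bigD1 (Ordinal ry)) /= ?pr ?Er // dvdn_mulr.
  have : (n %% r = 1 %% r)%N by rewrite -(modn_dvdm n rM) nM modn_dvdm.
  move/eqP: rn => -> /esym/eqP; rewrite -/(r %| 1)%N dvdn1 => /eqP r1.
  by rewrite r1 in pr.
pose T (r : 'I_X) := prime r && E r && (y <= r)%N.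
(* Double counting: each of the [J] terms has a divisor among the primes of [E] from [y] on, and
   such a prime divides at most J %/ r + 1 terms. *)
have leJ : (J <= \sum_(r < X | T r) (J %/ r).+1)%N.
  apply: (@leq_trans (\sum_(r < X | T r) #|[pred j : 'I_J | (r %| n0 + j * D)%N]|)); last first.
    apply: leq_sum => r /andP[/andP[pr /andP[cr Gr]] yr]; apply: count_dvdn_arith => //.
    rewrite coprimeMr cr /= /M.
    elim/big_rec: _ => [|i m /andP[pi _] cm]; first exact: coprimen1.
    rewrite coprimeMr cm andbT prime_coprime //; apply/negP.
    rewrite dvdn_prime2 // => /eqP ri; have := ltn_ord i.
    by rewrite -ri ltnNge yr.
  rewrite -[X in (X <= _)%N](card_ord J) -sum1_card.
  under [leqRHS]eq_bigr do rewrite -sum1_card big_mkcond.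
  rewrite exchange_big /=; apply: leq_sum => j _.
  have [r Tr rj] := cover j.
  by rewrite (bigD1 r) //= inE rj.
have : (J%:R : R) <= J%:R / 4 + (z%:R + X%:R / (8 * D%:R)).
  apply: (@le_trans _ _ (\sum_(r < X | T r) (J%:R * r%:R^-1 + 1))).
    move: leJ; rewrite -(ler_nat R) => /le_trans; apply.
    rewrite natr_sum; apply: ler_sum => r /andP[/andP[pr _] _].
    rewrite -natr1 lerD2r ler_pdivlMr ?ltr0n ?prime_gt0 //.
    by rewrite -natrM ler_nat leq_divM.
  rewrite big_split /= -mulr_sumr; apply: lerD.
    apply: ler_wpM2l; first exact: ler0n.
    have -> : 4^-1 = 1 / 4 :> R by rewrite mul1r.
    exact: recip_sum_tail.
  apply: (@le_trans _ _ (z%:R + X%:R * \sum_(r < X | prime r && E r && (z <= r)%N) r%:R^-1)).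
    rewrite (bigID (fun r : 'I_X => (r < z)%N)) /=; apply: lerD.
      rewrite sumr_const ler_nat -sum1_card.
      apply: leq_trans (leq_trans (card_ord_ltn X z) (geq_minr X z)).
      rewrite big_mkcond [leqRHS]big_mkcond /=; apply: leq_sum => r _.
      by rewrite unfold_in /=; case: (r < z)%N; rewrite ?andbF //; case: ifP.
    rewrite mulr_sumr big_mkcond [leRHS]big_mkcond /=; apply: ler_sum => r _.
    case: ifP => [/andP[/andP[/andP[pr ->] _]]|_]; last first.
      by case: ifP => // _; rewrite divr_ge0.
    rewrite -leqNgt => h; rewrite pr h /= ler_pdivlMr ?ltr0n ?prime_gt0 //.
    by rewrite mul1r ler_nat ltnW.
  rewrite lerD2l; apply: ler_wpM2l => //.
  by rewrite -[leRHS]mul1r; exact: recip_sum_tail.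
have D1 : 1 <= (D%:R : R) by rewrite ler1n.
have -> : (X%:R : R) / (8 * D%:R) = J%:R / 8 + (n0%:R + 1) / (8 * D%:R).
  rewrite /X (natrD _ (n0 + J * D)) (natrD _ n0) (natrM _ J); field.
  by rewrite pnatr_eq0 -lt0n.
have : (n0%:R + 1) / (8 * D%:R) <= (n0%:R + 1 : R).
  rewrite ler_pdivrMr ?mulr_gt0 ?ltr0n // ler_peMr ?addr_ge0 //.
  by lra.
have -> : (J%:R : R) = 2 * (z%:R + n0%:R + 1) + 1.
  by rewrite /J /K !(natrD, natrM).
have := ler0n R z; have := ler0n R n0.
by lra.
Qed.

End PrimeClasses.

(** * Completely multiplicative weights *)

Lemma sum_multiples (A : nmodType) (H : nat -> A) r N : (0 < r)%N ->
  \sum_(1 <= n < N.+1 | (r %| n)%N) H n = \sum_(1 <= m < (N %/ r).+1) H (r * m)%N.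
Proof.
move=> r0; elim: N => [|N IH]; first by rewrite div0n !big_geq.
rewrite big_mkcond big_nat_recr //= -big_mkcond IH divnS //.
case: (boolP (r %| N.+1)%N) => [rN|_]; last by rewrite add0n addr0.
rewrite add1n [RHS]big_nat_recr //=; congr (_ + H _).
by rewrite -[in LHS](divnK rN) divnS // rN add1n mulnC.
Qed.

Definition good_primes (A : Type) (s : seq (nat * A)) :=
  all (fun p => prime p.1) s && uniq (map fst s).

Lemma good_primes_cons (A : Type) r (y : A) s : good_primes ((r, y) :: s) =
  [&& prime r, r \notin map fst s & good_primes s].
Proof.
rewrite /good_primes /=; case: (prime r) => //=.
by rewrite andbCA.
Qed.

Section CompletelyMultiplicative.
Variable A : comNzRingType.
Implicit Types (s : seq (nat * A)) (x y : A).

(* the completely multiplicative function with value x at r for (r, x) in s and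
   value 0 at the other primes *)
Fixpoint cmult s (n : nat) : A :=
  if s is (r, x) :: s' then x ^+ logn r n * cmult s' (partn n (negn r)) else (n == 1%N)%:R.

Lemma cmult1 s : cmult s 1 = 1.
Proof. by elim: s => [|[r x] s IH] //=; rewrite logn1 partn1 IH mulr1. Qed.

Lemma cmultM s m n : (0 < m)%N -> (0 < n)%N ->
  cmult s (m * n) = cmult s m * cmult s n.
Proof.
elim: s m n => [|[r x] s IH] m n m0 n0 /=.
  by rewrite muln_eq1; case: eqP => _; case: eqP => _; rewrite ?mulr1 ?mulr0.
by rewrite lognM // exprD partnM // IH ?part_gt0 //; ring.
Qed.

Lemma cmult_eq0 s r n : good_primes s -> prime r -> r \notin map fst s ->
  (0 < n)%N -> (r %| n)%N -> cmult s n = 0.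
Proof.
move=> gs pr; elim: s n gs => [|[q x] s IH] n /=.
  move=> _ _ n0 rn; case: eqP => // n1; move: rn; rewrite n1 dvdn1 => /eqP r1.
  by rewrite r1 in pr.
rewrite good_primes_cons => /and3P[pq qs gs]; rewrite inE negb_or => /andP[rq rs] n0 rn.
rewrite IH ?mulr0 ?part_gt0 //.
have c : coprime r (partn n q).
  by rewrite p_part coprimeXr // prime_coprime // dvdn_prime2.
by move: rn; rewrite -{1}(partnC q n0) Gauss_dvdr.
Qed.

(** Peels off the Euler factor at [r]: non-multiples of [r] do not see its weight, and n = r m
    contributes [x] times the weight of m. The cutoff drops to N %/ r, which drives the inductions
    below. *)
Lemma cmult_split s r x (G : nat -> A) N : good_primes ((r, x) :: s) ->
  \sum_(1 <= n < N.+1) G n * cmult ((r, x) :: s) n =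
  \sum_(1 <= n < N.+1) G n * cmult s n +
  x * \sum_(1 <= m < (N %/ r).+1) G (r * m)%N * cmult ((r, x) :: s) m.
Proof.
rewrite good_primes_cons => /and3P[pr rs gs]; have r0 := prime_gt0 pr.
have -> : x * \sum_(1 <= m < (N %/ r).+1) G (r * m)%N * cmult ((r, x) :: s) m =
    \sum_(1 <= n < N.+1 | (r %| n)%N) x * (G n * cmult ((r, x) :: s) (n %/ r)%N).
  rewrite sum_multiples // mulr_sumr; apply: eq_bigr => m _.
  by rewrite mulKn.
rewrite [X in _ = _ + X]big_mkcond -big_split /=.
apply: eq_big_nat => n /andP[n0 _].
case: (boolP (r %| n)%N) => [rn|rn]; last first.
  have l0 : logn r n = 0%N by apply/eqP; rewrite lognE (negPf rn) !andbF.
  rewrite l0 expr0 mul1r addr0; congr (_ * cmult _ _).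
  by rewrite -[RHS](partnC r n0) p_part l0 mul1n.
rewrite (cmult_eq0 gs pr rs n0 rn) mulr0 add0r.
have m0 : (0 < n %/ r)%N by rewrite divn_gt0 // dvdn_leq.
have lE : logn r n = (logn r (n %/ r)).+1.
  by rewrite -{1}(divnK rn) lognM // (logn_prime _ pr) eqxx addn1.
have pE : partn n (negn r) = partn (n %/ r) (negn r).
  rewrite -{1}(divnK rn) partnM // [X in (_ * X)%N](_ : _ = 1%N) ?muln1 //.
  by apply/eqP; rewrite partn_eq1 // pnatE // !inE eqxx.
by rewrite /= lE pE exprS; ring.
Qed.

End CompletelyMultiplicative.

Section CmultBound.
Context {R : realType}.

Lemma cmult_ge0 (s : seq (nat * R)) n :
  all (fun p => 0 <= p.2) s -> 0 <= cmult s n.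
Proof.
elim: s n => [|[r x] s IH] n //= /andP[x0 h].
by rewrite mulr_ge0 ?exprn_ge0 ?IH.
Qed.

(** The Euler factor 1 / (1 - x) is at most 2 for x between 0 and 1 / 2. *)
Lemma cmult_sum_le (s : seq (nat * R)) N : good_primes s ->
  all (fun p => 0 <= p.2 <= 1 / 2) s ->
  \sum_(1 <= n < N.+1) cmult s n <= 2 ^+ size s.
Proof.
elim: s N => [|[r x] s IH] N gs.
  move=> _; rewrite expr0; case: N => [|N]; first by rewrite big_geq.
  by rewrite big_ltn //= big1_seq ?addr0 // => i /andP[_]; rewrite mem_index_iota; case: i => [|[|i]].
move=> /= /andP[/andP[x0 x1] hs].
have E := cmult_split (fun _ => 1) N gs; cbv beta in E.
rewrite -!mulr_sumr !mul1r in E.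
move: gs; rewrite good_primes_cons => /and3P[pr rs gs].
have pos n : 0 <= cmult ((r, x) :: s) n.
  apply: cmult_ge0 => /=; rewrite x0 /=.
  by apply: sub_all hs => p /andP[].
have mono : \sum_(1 <= m < (N %/ r).+1) cmult ((r, x) :: s) m <=
   \sum_(1 <= n < N.+1) cmult ((r, x) :: s) n.
  rewrite [leRHS](big_cat_nat (n := (N %/ r).+1)) //= ?ltnS ?leq_div //.
  by rewrite lerDl; apply: sumr_ge0 => i _; exact: pos.
have := IH N gs hs.
rewrite exprS => h; rewrite /= in E mono *.
set a := \sum_(1 <= n < N.+1) _ in E mono h *.
set b := \sum_(1 <= n < _.+1) _ in E mono h *.
set c := \sum_(1 <= n < _.+1) _ in E mono h *.
have a0 : 0 <= a by apply: sumr_ge0 => i _; exact: pos.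
have : x * c <= 1 / 2 * a.
  apply: (@le_trans _ _ (x * a)); first by apply: ler_wpM2l.
  by apply: ler_wpM2r.
lra.
Qed.

Lemma normc_cmult (s : seq (nat * R[i])) n :
  Normc.normc (cmult s n) = cmult [seq (p.1, Normc.normc p.2) | p <- s] n.
Proof.
elim: s n => [|[r x] s IH] n /=; last by rewrite Normc.normcM normcX IH.
by case: eqP => _; rewrite ?Normc.normc1 ?Normc.normc0.
Qed.

Lemma good_primes_map (A B : Type) (f : nat * A -> B) (s : seq (nat * A)) :
  good_primes [seq (p.1, f p) | p <- s] = good_primes s.
Proof. by rewrite /good_primes all_map -map_comp. Qed.

End CmultBound.

(** The r-part of [Q] divides r^Q, and Euler's theorem applies to the part prime to [r]. The factor
    3 makes the period exceed 2, so that a factor 1 - y^M leaves the coefficients of degree at most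
    2 untouched in [coef_slice]. *)
Lemma prime_pow_period Q r : (0 < Q)%N -> prime r ->
  (r ^ (Q + 3 * totient Q) = r ^ Q %[mod Q])%N.
Proof.
move=> Q0 pr.
have le : (r ^ Q <= r ^ (Q + 3 * totient Q))%N.
  by rewrite leq_exp2l ?leq_addr // prime_gt1.
apply/eqP; rewrite (eqn_mod_dvd _ le) expnD -{2}[(r ^ Q)%N]muln1 -mulnBr.
rewrite -{1}(partnC r Q0) dvdn_mul //.
  rewrite p_part dvdn_exp2l // ltnW //.
  by rewrite (leq_trans (ltn_expl _ (prime_gt1 pr))) // dvdn_leq // pfactor_dvdnn.
have c : coprime r (partn Q (negn r)).
  rewrite prime_coprime //; apply/negP => h.
  have := part_pnat (negn r) Q; move/(pnat_dvd h); rewrite pnatE // !inE.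
  by rewrite eqxx.
have /dvdnP[k ->] : (totient (partn Q (negn r)) %| 3 * totient Q)%N.
  by rewrite dvdn_mull // -{2}(partnC r Q0) totient_coprime ?dvdn_mull // coprime_partC.
rewrite -eqn_mod_dvd ?expn_gt0 ?prime_gt0 //.
by rewrite mulnC expnM -modnXm Euler_exp_totient // modnXm exp1n.
Qed.

Section GeometricOperator.
Variables (A : comNzRingType) (Q : nat).
Implicit Types (s : seq (nat * A)) (x y : A) (h : nat -> A) (g : nat).

Let L := Q.
Let M := (3 * totient Q)%N.

(* (1 - y^M) sum_i y^i h(g r^i), a finite sum because r^i mod Q has preperiod
   L and period M *)
Definition geom r y h g : A :=
  \sum_(i < L + M) y ^+ i * h (g * r ^ i)%N - \sum_(i < L) y ^+ (M + i) * h (g * r ^ i)%N.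

Definition periodic_mod (B : Type) (h : nat -> B) := forall n, h (n %% Q)%N = h n.

Lemma periodic_modP (B : Type) (h : nat -> B) m n : periodic_mod h ->
  (m = n %[mod Q])%N -> h m = h n.
Proof. by move=> H mn; rewrite -H mn H. Qed.

Lemma periodic_modMl (B : Type) (h : nat -> B) g m n : periodic_mod h ->
  (m = n %[mod Q])%N -> h (g * m)%N = h (g * n)%N.
Proof. by move=> H mn; apply: periodic_modP => //; rewrite -modnMmr mn modnMmr. Qed.

Lemma geom_periodic r y h : periodic_mod h -> periodic_mod (geom r y h).
Proof.
move=> H n; rewrite /geom; congr (_ - _); apply: eq_bigr => i _;
  by rewrite -(H (n * _)%N) -(H (_ %% _ * _)%N) modnMml.
Qed.

(** With S the shift from [g] to [g * r], [geom] is (1 - y^M) (1 - y S)^-1 applied to [h], and this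
    is the resolvent equation. The boundary terms of the two truncated sums cancel by periodicity of
    the powers of [r]. *)
Lemma geom_rec r y h g : (0 < Q)%N -> prime r -> periodic_mod h ->
  geom r y h g = (1 - y ^+ M) * h g + y * geom r y h (g * r)%N.
Proof.
move=> Q0 pr H; rewrite /geom.
have E n m : \sum_(i < n.+1) y ^+ (m + i) * h (g * r ^ i)%N + y ^+ (m + n.+1) * h (g * r ^ n.+1)%N =
    y ^+ m * h g + y * \sum_(i < n.+1) y ^+ (m + i) * h (g * r * r ^ i)%N.
  transitivity (\sum_(i < n.+2) y ^+ (m + i) * h (g * r ^ i)%N).
    by rewrite [RHS]big_ord_recr.
  rewrite big_ord_recl /= addn0 expn0 muln1; congr (_ + _).
  rewrite mulr_sumr; apply: eq_bigr => i _.
  by rewrite /bump /= add1n addnS exprS expnS mulnA mulrA.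
have E' n m : \sum_(i < n) y ^+ (m + i) * h (g * r ^ i)%N + y ^+ (m + n) * h (g * r ^ n)%N =
    y ^+ m * h g + y * \sum_(i < n) y ^+ (m + i) * h (g * r * r ^ i)%N.
  by case: n => [|n] //; rewrite !big_ord0 addn0 expn0 muln1 mulr0 addrC.
have e1 : \sum_(i < L + M) y ^+ i * h (g * r ^ i)%N + y ^+ (L + M) * h (g * r ^ (L + M))%N =
    y ^+ 0 * h g + y * \sum_(i < L + M) y ^+ i * h (g * r * r ^ i)%N := E' (L + M)%N 0%N.
have e2 := E' L M.
have p := periodic_modMl g H (prime_pow_period Q0 pr).
rewrite -/L -/M in p; rewrite expr0 mul1r p in e1; rewrite (addnC M) in e2.
set c := y ^+ (L + M) * _ in e1 e2.
move: e1 e2; set S1 := \sum_(i < L + M) _; set T1 := \sum_(i < L + M) _.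
set S2 := \sum_(i < L) _; set T2 := \sum_(i < L) _; set yM := y ^+ M.
clearbody S1 T1 S2 T2 yM c => e1 e2.
have -> : S1 = h g + y * T1 - c by rewrite -e1 addrK.
have -> : S2 = yM * h g + y * T2 - c by rewrite -e2 addrK.
ring.
Qed.

(** Up to the product of the 1 - y^M, this sums h (g n), with completely multiplicative weights,
    over all n composed of the primes of [s]. With the denominators cleared it is polynomial in the
    weights, which may therefore be indeterminates. *)
Fixpoint geoms s h : nat -> A :=
  if s is (r, y) :: s' then geom r y (geoms s' h) else h.

Lemma geoms_periodic s h : periodic_mod h -> periodic_mod (geoms s h).
Proof. by move=> H; elim: s => [|[r y] s IH] //=; apply: geom_periodic. Qed.

Lemma geom_shift r y h a g : geom r y (fun n => h (a * n)%N) g = geom r y h (a * g)%N.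
Proof. by rewrite /geom; congr (_ - _); apply: eq_bigr => i _; rewrite mulnA. Qed.

Lemma eq_geom r y h h' : h =1 h' -> geom r y h =1 geom r y h'.
Proof. by move=> E g; rewrite /geom; congr (_ - _); apply: eq_bigr => i _; rewrite E. Qed.

Lemma geoms_shift s h a g : geoms s (fun n => h (a * n)%N) g = geoms s h (a * g)%N.
Proof.
elim: s g => [|[r y] s IH] g //=; rewrite -geom_shift; exact: eq_geom.
Qed.

Lemma geom_lin r y h h' a g :
  geom r y (fun n => h n - a * h' n) g = geom r y h g - a * geom r y h' g.
Proof.
rewrite /geom; under eq_bigr do rewrite mulrBr; rewrite sumrB.
under [X in _ - X]eq_bigr do rewrite mulrBr; rewrite sumrB mulrBr !mulr_sumr.
under [X in _ - X - _]eq_bigr do rewrite mulrCA.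
under [X in _ - (_ - X)]eq_bigr do rewrite mulrCA.
ring.
Qed.

Lemma geoms_lin s h h' a g :
  geoms s (fun n => h n - a * h' n) g = geoms s h g - a * geoms s h' g.
Proof.
elim: s g => [|[r y] s IH] g //=; rewrite -geom_lin; exact: eq_geom.
Qed.

End GeometricOperator.

Lemma geoms_morph (A B : comNzRingType) (phi : {rmorphism A -> B}) Q s (h : nat -> A) g :
  phi (geoms Q s h g) = geoms Q [seq (p.1, phi p.2) | p <- s] (phi \o h) g.
Proof.
elim: s g => [|[r y] s IH] g //=.
rewrite /geom rmorphB !rmorph_sum /=.
by congr (_ - _); apply: eq_bigr => i _; rewrite rmorphM rmorphXn IH.
Qed.

(** * Cyclic Dirichlet series with periodic coefficients *)

Section Cyclic.
Context {R : realType}.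
Local Notation C := R[i].
Local Notation normc := (@Normc.normc R).

Definition dconv n0 (c : nat -> R) (a : nat -> R) m : R :=
  \sum_(1 <= k < n0.+1 | (k %| m)%N) c k * a (m %/ k)%N.

(* the Dirichlet series with coefficients a is cyclic: the unit is a limit in l2
   of its products with Dirichlet polynomials *)
Definition dcyclic (a : nat -> R) := forall e, 0 < e ->
  exists n0 c, forall N, \sum_(1 <= m < N.+1) ((m == 1%N)%:R - dconv n0 c a m) ^+ 2 <= e.

Variable Q : nat.
Hypothesis Q_gt0 : (0 < Q)%N.

Let M := (3 * totient Q)%N.

Lemma periodic_bounded (h : nat -> C) : periodic_mod Q h ->
  exists2 B, 0 <= B & forall n, normc (h n) <= B.
Proof.
move=> H; exists (\sum_(i < Q) normc (h i)).
  by apply: sumr_ge0 => i _; exact: normc_ge0.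
move=> n; rewrite -H (bigD1 (Ordinal (ltn_pmod n Q_gt0))) //=.
by rewrite lerDl sumr_ge0 // => i _; exact: normc_ge0.
Qed.

(** The factor 1 / r coming from f n / n is included in the second component y; the completely
    multiplicative weight at [r] is r y, and the bound 1 / 2 makes these weights summable over the
    integers. *)
Definition small_weights (s : seq (nat * C)) :=
  all (fun p => p.1%:R * normc p.2 <= 1 / 2) s.

Definition geoms_den (s : seq (nat * C)) : C := \prod_(p <- s) (1 - p.2 ^+ M).

Definition weighted_sum (s : seq (nat * C)) (f : nat -> R) N g : C :=
  \sum_(1 <= n < N.+1) ((f (g * n)%N / n%:R)%:C)%C *
    cmult [seq (p.1, p.1%:R * p.2) | p <- s] n.

Lemma good_primes_scale (s : seq (nat * C)) :
  good_primes [seq (p.1, p.1%:R * p.2) | p <- s] = good_primes s.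
Proof. by rewrite /good_primes all_map -map_comp. Qed.

Lemma weighted_sum_cons r y s f N g : good_primes ((r, y) :: s) ->
  weighted_sum ((r, y) :: s) f N g =
  weighted_sum s f N g + y * weighted_sum ((r, y) :: s) f (N %/ r) (g * r)%N.
Proof.
move=> gs; have := gs; rewrite good_primes_cons => /and3P[pr _ _].
have r0 : (r%:R : R) != 0 by rewrite pnatr_eq0 -lt0n prime_gt0.
rewrite /weighted_sum /= (@cmult_split C _ r (r%:R * y)); last first.
  by rewrite -(good_primes_scale ((r, y) :: s)) in gs.
congr (_ + _); rewrite !mulr_sumr; apply: eq_big_nat => n /andP[n0 _].
rewrite -/cmult mulrA [RHS]mulrA; congr (_ * _).
have -> : (r%:R : C) = ((r%:R : R)%:C)%C by rewrite rmorph_nat.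
rewrite mulrAC -rmorphM mulrC mulnA; congr (_ * _%:C)%C.
have n1 : (n%:R : R) != 0 by rewrite pnatr_eq0 -lt0n.
by rewrite natrM; field; rewrite r0 n1.
Qed.

Definition realfun (f : nat -> R) : nat -> C := fun n => ((f n)%:C)%C.

Definition remainder s f N g : C :=
  geoms_den s * weighted_sum s f N g - geoms Q s (realfun f) g.

Lemma remainder_cons r y s f N g : good_primes ((r, y) :: s) -> periodic_mod Q f ->
  remainder ((r, y) :: s) f N g =
  (1 - y ^+ M) * remainder s f N g + y * remainder ((r, y) :: s) f (N %/ r) (g * r)%N.
Proof.
move=> gs pf; have := gs; rewrite good_primes_cons => /and3P[pr _ _].
rewrite {1}/remainder weighted_sum_cons // {1}/geoms -/(geoms Q) geom_rec //; last first.
  by apply: geoms_periodic => n; rewrite /realfun pf.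
rewrite /remainder [geoms_den (_ :: _)]big_cons -/(geoms_den s) /= -/M.
ring.
Qed.

Lemma small_weights_cons r y s : prime r -> small_weights ((r, y) :: s) ->
  normc y <= 1 / 4 /\ small_weights s.
Proof.
move=> pr /= /andP[h ->]; split => //.
have r2 : (2 : R) <= r%:R by rewrite ler_nat prime_gt1.
have : 2 * normc y <= r%:R * normc y by apply: ler_wpM2r => //; exact: normc_ge0.
lra.
Qed.

Lemma period_gt0 : (0 < M)%N.
Proof. by rewrite muln_gt0 totient_gt0. Qed.

Lemma normc_1subX (y : C) : normc y <= 1 / 4 -> normc (1 - y ^+ M) <= 5 / 4.
Proof.
move=> y4; apply: le_trans (normcD _ _) _.
rewrite normc_opp Normc.normc1 normcX.
have : normc y ^+ M <= normc y.
  by apply: ler_iXnr; rewrite ?period_gt0 ?normc_ge0 //; lra.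
lra.
Qed.

(** By [remainder_cons] the error at [N] is a bounded multiple of the error with one prime fewer
    plus [y], of modulus at most 1 / 4, times the error at N %/ r: a contraction. Uniformity in [g]
    is needed because the recursion replaces [g] by g r. *)
Lemma remainder_cvg s f : good_primes s -> small_weights s -> periodic_mod Q f ->
  (exists B, forall N g, normc (remainder s f N g) <= B) /\
  (forall e, 0 < e -> exists N0, forall N g, (N0 <= N)%N -> normc (remainder s f N g) <= e).
Proof.
move=> gs ws pf; elim: s gs ws => [|[r y] s IH] gs ws.
  have pf' : periodic_mod Q (realfun f) by move=> n; rewrite /realfun pf.
  have [B B0 HB] := periodic_bounded pf'.
  have R1 N g : (0 < N)%N -> remainder [::] f N g = 0.
    move=> N0; rewrite /remainder /geoms_den big_nil mul1r /weighted_sum /=.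
    rewrite big_ltn // big1_seq ?addr0 ?muln1 ?eqxx ?divr1 ?mulr1 ?subrr //.
    by move=> i; rewrite mem_index_iota; case: i => [|[|i]] //=; rewrite mulr0.
  split; last by move=> e e0; exists 1%N => N g /R1 ->; rewrite Normc.normc0 ltW.
  exists B => N g; case: N => [|N]; last by rewrite R1 // Normc.normc0.
  rewrite /remainder /geoms_den /weighted_sum big_geq // mulr0 sub0r normc_opp.
  exact: HB.
have := gs; rewrite good_primes_cons => /and3P[pr rs gs'].
have [y4 ws'] := small_weights_cons pr ws.
have [[B HB] H0] := IH gs' ws'.
have step N g : normc (remainder ((r, y) :: s) f N g) <=
   5 / 4 * normc (remainder s f N g) + 1 / 4 * normc (remainder ((r, y) :: s) f (N %/ r) (g * r)%N).
  rewrite remainder_cons //; apply: le_trans (normcD _ _) _.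
  rewrite !Normc.normcM; apply: lerD; apply: ler_wpM2r; rewrite ?normc_ge0 //.
  exact: normc_1subX.
have pfs : periodic_mod Q (geoms Q ((r, y) :: s) (realfun f)).
  by apply: geoms_periodic => n; rewrite /realfun pf.
have [B1 B10 HB1] := periodic_bounded pfs.
have B0 : 0 <= B by apply: le_trans (HB 0%N 0%N); exact: normc_ge0.
pose B2 := B1 + 2 * B.
have bnd N g : normc (remainder ((r, y) :: s) f N g) <= B2.
  elim/ltn_ind: N g => N IHN g; have [N0|N0] := posnP N.
    rewrite N0 /remainder /weighted_sum big_geq // mulr0 sub0r normc_opp.
    by apply: le_trans (HB1 _) _; rewrite /B2; lra.
  apply: le_trans (step N g) _.
  have := IHN (N %/ r)%N (ltn_Pdiv (prime_gt1 pr) N0) (g * r)%N.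
  have := HB N g; rewrite /B2; lra.
split; first by exists B2.
move=> e e0.
have [N1 HN1] := H0 (e / 5) ltac:(lra).
have main j : exists N0, forall N g, (N0 <= N)%N ->
    normc (remainder ((r, y) :: s) f N g) <= e / 2 + B2 * (1 / 4) ^+ j.
  elim: j => [|j [N0 HN0]].
    by exists 0%N => N g _; rewrite expr0 mulr1; have := bnd N g; lra.
  exists (maxn N1 (r * N0)) => N g; rewrite geq_max => /andP[h1 h2].
  have h3 : (N0 <= N %/ r)%N by rewrite leq_divRL ?prime_gt0 // mulnC.
  apply: le_trans (step N g) _; have := HN1 N g h1; have := HN0 _ (g * r)%N h3.
  by rewrite exprS; lra.
have : (fun j => B2 * (1 / 4) ^+ j) @ \oo --> (0 : R).
  rewrite -(mulr0 B2); apply: cvgMr; apply: cvg_expr.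
  by rewrite ger0_norm; lra.
move/cvgrPdist_lt => /(_ (e / 2) ltac:(lra)) [j _ /(_ j (leqnn j))] /=.
rewrite sub0r normrN => hj.
have [N0 HN0] := main j; exists N0 => N g h; apply: le_trans (HN0 N g h) _.
by have := ler_norm (B2 * (1 / 4) ^+ j); lra.
Qed.

End Cyclic.

Section Cyclic2.
Context {R : realType}.
Local Notation C := R[i].
Local Notation normc := (@Normc.normc R).

Lemma cmult_le1 (s : seq (nat * R)) n :
  all (fun p => 0 <= p.2 <= 1 / 2) s -> cmult s n <= 1.
Proof.
elim: s n => [|[r x] s IH] n /=; first by case: eqP.
move=> /andP[/andP[x0 x1] h].
rewrite -[leRHS]mulr1; apply: ler_pM; rewrite ?exprn_ge0 ?IH //.
  by apply: cmult_ge0; apply: sub_all h => p /andP[].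
by rewrite exprn_ile1 //; lra.
Qed.

Variable Q : nat.
Hypothesis Q_gt0 : (0 < Q)%N.

(** Complete multiplicativity splits the weight of k m, so pairing with a Dirichlet product reduces
    to pairings with [f] alone, cut off at N %/ k. *)
Lemma dconv_weighted_sum (s : seq (nat * C)) (f : nat -> R) n0 c N : good_primes s ->
  \sum_(1 <= n < N.+1) ((dconv n0 c (fun n => f n / n%:R) n)%:C)%C *
    cmult [seq (p.1, p.1%:R * p.2) | p <- s] n =
  \sum_(1 <= k < n0.+1) ((c k)%:C)%C * cmult [seq (p.1, p.1%:R * p.2) | p <- s] k *
    weighted_sum s f (N %/ k) 1.
Proof.
move=> gs; set psi := cmult _.
transitivity (\sum_(1 <= n < N.+1) \sum_(1 <= k < n0.+1)
   (if (k %| n)%N then ((c k * (f (n %/ k)%N / (n %/ k)%:R))%:C)%C * psi n else 0)).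
  apply: eq_bigr => n _; rewrite /dconv rmorph_sum /= mulr_suml big_mkcond.
  by apply: eq_bigr => k _.
rewrite exchange_big_nat /=; apply: eq_big_nat => k /andP[k0 _].
rewrite -big_mkcond sum_multiples // mulr_sumr.
apply: eq_big_nat => m /andP[m0 _]; rewrite mulKn // mul1n.
by rewrite /psi cmultM // rmorphM /=; ring.
Qed.

(** If the value at 1 were 0, the functional given by the weights psi would vanish on all Dirichlet
    multiples of f n / n; but it is bounded on l2 and takes the value psi 1 = 1 at the unit. *)
Lemma dcyclic_geoms_neq0 (f : nat -> R) s : dcyclic (fun n => f n / n%:R) ->
  periodic_mod Q f -> good_primes s -> small_weights s ->
  geoms Q s (realfun f) 1 != 0.
Proof.
move=> cf pf gs ws; apply/eqP => g0.
pose K : R := 2 ^+ size s.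
have K1 : 1 <= K by rewrite exprn_ege1 // ler1n.
have K0 : 0 < K by lra.
have Kn0 : K != 0 by rewrite gt_eqF.
have [n0 [c Hc]] := cf (1 / (4 * K)) ltac:(by rewrite divr_gt0 //; lra).
pose psi := cmult [seq (p.1, p.1%:R * p.2) | p <- s].
pose t := [seq (p.1, normc (p.1%:R * p.2)) | p <- s].
have psiE n : normc (psi n) = cmult t n by rewrite normc_cmult -map_comp.
have tw : all (fun p => 0 <= p.2 <= 1 / 2) t.
  rewrite all_map; apply: sub_all ws => p /= h.
  rewrite normc_ge0 Normc.normcM.
  have -> : (p.1%:R : C) = ((p.1%:R : R)%:C)%C by rewrite rmorph_nat.
  by rewrite normcR ger0_norm ?ler0n.
have gt : good_primes t.
  by rewrite /t (good_primes_map (fun p => normc (p.1%:R * p.2))).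
have psi0 n : 0 <= normc (psi n) by exact: normc_ge0.
have psi1 n : normc (psi n) <= 1 by rewrite psiE cmult_le1.
have psiK N : \sum_(1 <= n < N.+1) normc (psi n) <= K.
  rewrite /K -(size_map (fun p => (p.1, normc (p.1%:R * p.2)))) -/t.
  by under eq_bigr do rewrite psiE; exact: cmult_sum_le.
have den0 : geoms_den Q s != 0.
  rewrite prodf_seq_neq0; apply/allP => -[r y] ry /=.
  have pr : prime r by case/andP: gs => /allP /(_ _ ry).
  have y4 : normc y <= 1 / 4.
    have /allP/(_ _ ry) h := ws.
    by have [] := @small_weights_cons R r y [::] pr; rewrite /small_weights /= ?h.
  rewrite subr_eq0 eq_sym; apply/eqP => /(congr1 normc).
  rewrite normcX Normc.normc1 => /eqP.
  by rewrite pexpr_eq1 ?(period_gt0 Q_gt0) ?normc_ge0 // => /eqP; lra.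
pose T := \sum_(1 <= k < n0.+1) normc (((c k)%:C)%C * psi k).
have T0 : 0 <= T by apply: sumr_ge0 => k _; exact: normc_ge0.
(* A weighted AM-GM replaces the Cauchy-Schwarz inequality. As [K] bounds the sum of the |psi n|, a
   squared l2 error of 1 / (4 K) costs 1 / 4 + 1 / 4; with another 1 / 4 for truncation, 1 would be
   at most 3 / 4. *)
have amgm (a b : R) : 0 <= b <= 1 -> a * b <= K * a ^+ 2 + (4 * K)^-1 * b.
  move=> /andP[b0 b1]; have : 0 <= (2 * K * a - b) ^+ 2 by exact: sqr_ge0.
  have : b ^+ 2 <= b by rewrite expr2 ler_piMl.
  move=> h1 h2; rewrite -subr_ge0.
  have -> : K * a ^+ 2 + (4 * K)^-1 * b - a * b = (4 * K)^-1 * ((2 * K * a - b) ^+ 2 + (b - b ^+ 2)).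
    by field.
  by rewrite mulr_ge0 ?invr_ge0 //; lra.
pose d : R := normc (geoms_den Q s).
have d0 : 0 < d.
  by rewrite lt_def normc_ge0 andbT; apply: contra den0 => /eqP/Normc.eq0_normc ->.
have [_ Rc] := remainder_cvg Q_gt0 gs ws pf.
have [N0 HN0] := Rc (d / (4 * (T + 1))) ltac:(by rewrite divr_gt0 //; lra).
have W N : (N0 <= N)%N -> normc (weighted_sum s f N 1) <= 1 / (4 * (T + 1)).
  move=> h; have := HN0 N 1%N h.
  rewrite /remainder g0 subr0 Normc.normcM -/d => h2.
  by rewrite -(ler_pM2l d0) mul1r.
pose N := (n0 * (maxn N0 1) + 1)%N.
pose h n := (n == 1%N)%:R - dconv n0 c (fun n => f n / n%:R) n.
have S1 : normc (\sum_(1 <= n < N.+1) ((h n)%:C)%C * psi n) <= 1 / 2.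
  apply: le_trans (normc_sum _ _ _) _.
  apply: (@le_trans _ _ (\sum_(1 <= n < N.+1) (K * h n ^+ 2 + (4 * K)^-1 * normc (psi n)))).
    apply: ler_sum => n _; rewrite Normc.normcM normcR.
    have := amgm `|h n| (normc (psi n)); rewrite psi0 psi1 => /(_ isT).
    by rewrite real_normK ?num_real.
  rewrite big_split /= -!mulr_sumr.
  have h1 : K * \sum_(1 <= n < N.+1) h n ^+ 2 <= 1 / 4.
    apply: (@le_trans _ _ (K * (1 / (4 * K)))); first by apply: ler_wpM2l; rewrite ?Hc // ltW.
    by rewrite le_eqVlt; apply/orP; left; apply/eqP; field.
  have h2 : (4 * K)^-1 * \sum_(1 <= n < N.+1) normc (psi n) <= 1 / 4.
    apply: (@le_trans _ _ ((4 * K)^-1 * K)); first by apply: ler_wpM2l; rewrite ?invr_ge0 //; lra.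
    by rewrite le_eqVlt; apply/orP; left; apply/eqP; field.
  by lra.
have S2 : \sum_(1 <= n < N.+1) ((h n)%:C)%C * psi n =
   1 - \sum_(1 <= k < n0.+1) ((c k)%:C)%C * psi k * weighted_sum s f (N %/ k) 1.
  rewrite -dconv_weighted_sum //.
  under eq_bigr do rewrite /h rmorphB mulrBl; rewrite sumrB; congr (_ - _).
  rewrite /N addn1 big_ltn //= rmorph1 mul1r /psi cmult1.
  rewrite big1_seq ?addr0 // => i /andP[_]; rewrite mem_index_iota.
  by case: i => [|[|i]] //= _; rewrite rmorph0 mul0r.
have S3 : normc (\sum_(1 <= k < n0.+1) ((c k)%:C)%C * psi k * weighted_sum s f (N %/ k) 1) <= 1 / 4.
  apply: le_trans (normc_sum _ _ _) _.
  apply: (@le_trans _ _ (T * (1 / (4 * (T + 1))))).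
    rewrite mulr_suml; apply: ler_sum_nat => k /andP[k0 kn].
    rewrite Normc.normcM; apply: ler_wpM2l; first exact: normc_ge0.
    apply: W; rewrite leq_divRL // /N.
    apply: leq_trans (leq_addr _ _).
    by rewrite mulnC leq_mul // leq_maxl.
  by rewrite mul1r ler_pdivrMr; lra.
move: S1; rewrite S2 => S1.
have : normc (1 : C) <= 3 / 4.
  rewrite -[X in normc X](subrK (\sum_(1 <= k < n0.+1) ((c k)%:C)%C * psi k * weighted_sum s f (N %/ k) 1) 1).
  by apply: le_trans (normcD _ _) _; lra.
by rewrite Normc.normc1; lra.
Qed.

End Cyclic2.

Lemma unbounded_class_primes {R : realType} (P : pred nat) (E : seq nat) (Z : R) :
  ~ @recip_bounded R P ->
  exists S : seq nat, [/\ uniq S, all prime S, all P S, all (fun r => r \notin E) S &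
    Z <= \sum_(r <- S) r%:R^-1].
Proof.
move=> nb; have [x hx] : exists x, Z + (size E)%:R < recip_sum P x :> R.
  apply: contrapT => H; apply: nb; exists (Z + (size E)%:R) => x.
  by rewrite leNgt; apply/negP => h; apply: H; exists x.
exists [seq r <- iota 0 x | [&& prime r, P r & r \notin E]]; split.
- by rewrite filter_uniq // iota_uniq.
- by apply/allP => r; rewrite mem_filter => /andP[/and3P[]].
- by apply/allP => r; rewrite mem_filter => /andP[/and3P[]].
- by apply/allP => r; rewrite mem_filter => /andP[/and3P[]].
move: hx; rewrite /recip_sum -(big_mkord (fun r => prime r && P r) (fun r => r%:R^-1)).
rewrite (bigID (fun r => r \notin E)) /= => hx.
have : \sum_(0 <= i < x | prime i && P i && ~~ (i \notin E)) i%:R^-1 <= (size E)%:R :> R.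
  rewrite -big_filter.
  set s := [seq _ <- _ | _].
  apply: (@le_trans _ _ (size s)%:R).
    have : forall i, i \in s -> prime i by move=> i; rewrite mem_filter => /andP[/andP[/andP[]]].
    elim: s {hx} => [|i s IH] h; first by rewrite big_nil.
    rewrite big_cons /= -nat1r; apply: lerD.
      by rewrite invf_le1 ?ltr0n ?ler1n prime_gt0 ?h ?mem_head.
    by apply: IH => j js; apply: h; rewrite inE js orbT.
  rewrite ler_nat uniq_leq_size //; first by rewrite filter_uniq // iota_uniq.
  by move=> i; rewrite mem_filter negbK => /andP[/andP[]].
have -> : \sum_(r <- [seq r <- iota 0 x | [&& prime r, P r & r \notin E]]) r%:R^-1 =
  \sum_(0 <= i < x | prime i && P i && (i \notin E)) i%:R^-1 :> R.
  by rewrite big_filter /index_iota subn0; apply: eq_bigl => i; rewrite andbA.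
by move=> h; lra.
Qed.

Lemma good_primesE (A : Type) (s : seq (nat * A)) :
  good_primes s = all prime (map fst s) && uniq (map fst s).
Proof. by rewrite /good_primes all_map. Qed.

(** * The second cumulant of a cyclic series along a class of primes *)

Section Cumulant.
Context {R : realType}.
Local Notation C := R[i].
Local Notation normc := (@Normc.normc R).
Variable Q : nat.
Hypothesis Q_gt0 : (0 < Q)%N.
Let M := (3 * totient Q)%N.

(** The two sums are at most 1 / (1 - t) and t / (1 - t) with t = |y|, and (1 + t) / (1 - t) <= 1 +
    4 t for t <= 1 / 4. For y = z / (2 r) on the unit circle, a prime costs the factor exp (2 /
    r). *)
Lemma normc_geom_le r (y : C) h H g : normc y <= 1 / 4 ->
  (forall n, normc (h n) <= H) -> normc (geom Q r y h g) <= expR (4 * normc y) * H.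
Proof.
move=> y4 hH; set t : R := normc y; have t0 : 0 <= t by exact: normc_ge0.
have H0 : 0 <= H by apply: le_trans (hH 0%N); exact: normc_ge0.
have gs n : \sum_(i < n) t ^+ i <= 1 / (1 - t).
  rewrite ler_pdivlMr; last by rewrite /t; lra.
  have := subrX1 t n.
  have -> : (t - 1) * (\sum_(i < n) t ^+ i) = - ((\sum_(i < n) t ^+ i) * (1 - t)) by ring.
  by have := exprn_ge0 n t0; lra.
apply: (@le_trans _ _ ((1 + 4 * t) * H)); last first.
  by apply: ler_wpM2r => //; exact: expR_ge1Dx.
apply: (@le_trans _ _ ((1 / (1 - t) + t * (1 / (1 - t))) * H)); last first.
  apply: ler_wpM2r => //; rewrite mulrA mulr1 -mulrDl ler_pdivrMr; last by rewrite /t; lra.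
  have : t * t <= 1 / 4 * t by apply: ler_wpM2r.
  by rewrite /t in t0 *; lra.
rewrite /geom -/M; apply: le_trans (normcD _ _) _; rewrite normc_opp mulrDl.
apply: lerD.
  apply: (le_trans (normc_sum _ _ _)); apply: (@le_trans _ _ ((\sum_(i < Q + M) t ^+ i) * H)).
    rewrite mulr_suml; apply: ler_sum => i _; rewrite Normc.normcM normcX.
    by apply: ler_wpM2l; rewrite ?exprn_ge0.
  by apply: ler_wpM2r.
apply: (le_trans (normc_sum _ _ _)); apply: (@le_trans _ _ ((t * \sum_(i < Q) t ^+ i) * H)).
  rewrite mulr_sumr mulr_suml; apply: ler_sum => i _; rewrite Normc.normcM normcX -/t.
  apply: ler_pM; rewrite ?exprn_ge0 ?normc_ge0 // exprD; apply: ler_wpM2r; first exact: exprn_ge0.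
  by apply: ler_iXnr; rewrite ?(period_gt0 Q_gt0) // /t; lra.
by apply: ler_wpM2r => //; apply: ler_wpM2l.
Qed.

Section Slice.
Variables (b : nat) (psi : seq (nat * R)) (f : nat -> R).
Hypothesis pf : periodic_mod Q f.
Let U := geoms Q psi f.

(** The primes of [S] share one indeterminate, while [psi] stays fixed; the factor 1 / (2 r) keeps
    the weights admissible for all |z| <= 1. *)
Definition slice_weights (S : seq nat) : seq (nat * {poly R}) :=
  [seq (r, (2 * r%:R)^-1 *: 'X) | r <- S] ++ [seq (p.1, p.2%:P) | p <- psi].

Definition slice S : nat -> {poly R} := geoms Q (slice_weights S) (fun n => (f n)%:P).

Lemma slice_nil g : slice [::] g = (U g)%:P.
Proof. by rewrite /slice /slice_weights /= /U geoms_morph. Qed.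

Lemma slice_periodic S : periodic_mod Q (slice S).
Proof. by apply: geoms_periodic => n; rewrite pf. Qed.

(** Since [S] lies in one class, an integer enters only through its number of prime factors from
    [S]. The coefficients are therefore the complete homogeneous symmetric functions of the 1 / (2
    r), the second being half the sum of the squared first and the second power sum. The factors 1 -
    y^M do not reach degree 2. *)
Lemma coef_slice S g : all prime S -> all (fun r => r == b %[mod Q])%N S ->
  let Z := \sum_(r <- S) r%:R^-1 in let Z2 := \sum_(r <- S) r%:R^-1 ^+ 2 in
  [/\ (slice S g)`_0 = U g, (slice S g)`_1 = Z / 2 * U (g * b)%N &
      (slice S g)`_2 = (Z ^+ 2 + Z2) / 8 * U (g * b * b)%N].
Proof.
move=> + + Z Z2; rewrite {}/Z {}/Z2.
have E0 (c : R) p q : ((1 - (c *: 'X) ^+ M) * p + (c *: 'X) * q)`_0 = p`_0.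
  rewrite coefD coef0M coefB coef1 exprZn coefZ coefXn (ltn_eqF (period_gt0 Q_gt0)).
  by rewrite -scalerAl coefZ coefXM !mulr0 subr0 mul1r addr0.
have M2 : (2 < M)%N by rewrite /M; have := period_gt0 Q_gt0; lia.
have E1 (c : R) p q : ((1 - (c *: 'X) ^+ M) * p + (c *: 'X) * q)`_1 = p`_1 + c * q`_0.
  rewrite coefD coefM1 !coefB !coef1 exprZn !coefZ !coefXn -scalerAl coefZ coefXM /=.
  rewrite (ltn_eqF (period_gt0 Q_gt0)) (ltn_eqF (_ : 1 < M)%N) ?(ltn_trans _ M2) //.
  by rewrite !mulr0 !subr0 mul1r mul0r addr0.
have E2 (c : R) p q : ((1 - (c *: 'X) ^+ M) * p + (c *: 'X) * q)`_2 = p`_2 + c * q`_1.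
  rewrite coefD coefM2 !coefB !coef1 exprZn !coefZ !coefXn -scalerAl coefZ coefXM /=.
  rewrite (ltn_eqF (period_gt0 Q_gt0)) (ltn_eqF (_ : 1 < M)%N) ?(ltn_trans _ M2) // (ltn_eqF M2).
  by rewrite !mulr0 !subr0 mul1r !mul0r !addr0.
elim: S g => [|r S IH] g.
  move=> _ _; rewrite slice_nil !big_nil !coefC /= expr0n addr0 !mul0r.
  by split.
move=> /= /andP[pr pS] /andP[rb bS].
have step n : slice (r :: S) n = (1 - ((2 * r%:R)^-1 *: 'X) ^+ M) * slice S n +
    ((2 * r%:R)^-1 *: 'X) * slice (r :: S) (n * b)%N.
  rewrite -(@periodic_modMl Q _ _ n r b (@slice_periodic (r :: S))); last by apply/eqP.
  by rewrite /slice /= geom_rec //; apply: slice_periodic.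
have r0 : (r%:R : R) != 0 by rewrite pnatr_eq0 -lt0n prime_gt0.
have H0 n : (slice (r :: S) n)`_0 = U n by rewrite step E0; case: (IH n pS bS).
have H1 n : (slice (r :: S) n)`_1 = (r%:R^-1 + \sum_(r <- S) r%:R^-1) / 2 * U (n * b)%N.
  rewrite step E1 H0; case: (IH n pS bS) => _ -> _.
  by field.
rewrite !big_cons; split => //.
rewrite step E2 H1; case: (IH g pS bS) => _ _ ->.
by field.
Qed.

Definition eval_slice (z : C) : {rmorphism {poly R} -> C} :=
  (horner_eval z \o map_poly (real_complex R)).

Lemma slice_horner S z g : (map_poly (real_complex R) (slice S g)).[z] =
  geoms Q ([seq (r, ((2 * r%:R)^-1)%:C%C * z) | r <- S] ++ [seq (p.1, (p.2)%:C%C) | p <- psi])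
    (realfun f) g.
Proof.
rewrite -[LHS]/(eval_slice z (slice S g)) geoms_morph map_cat -!map_comp.
congr (geoms Q (_ ++ _) _ g).
- apply: eq_map => r /=; congr pair; rewrite /horner_eval map_polyZ map_polyX hornerZ hornerX.
  by [].
- by apply: eq_map => p /=; rewrite /horner_eval map_polyC hornerC.
- by apply/funext => n /=; rewrite /horner_eval map_polyC hornerC.
Qed.

Lemma slice_bound H S z g : all prime S -> normc z = 1 -> (forall n, `|U n| <= H) ->
  normc (map_poly (real_complex R) (slice S g)).[z] <= expR (2 * \sum_(r <- S) r%:R^-1) * H.
Proof.
move=> pS z1 HU; rewrite slice_horner; elim: S g pS => [|r S IH] g.
  move=> _; rewrite big_nil mulr0 expR0 mul1r /=.
  have -> : geoms Q [seq (p.1, (p.2)%:C%C) | p <- psi] (realfun f) g = (U g)%:C%C.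
    by rewrite /U (geoms_morph (real_complex R)).
  by rewrite normcR.
move=> /= /andP[pr pS].
have r2 : (2 : R) <= r%:R by rewrite ler_nat prime_gt1.
have ny : normc (((2 * r%:R)^-1)%:C%C * z) = (2 * r%:R)^-1.
  by rewrite Normc.normcM z1 mulr1 normcR ger0_norm // invr_ge0; lra.
have h := @normc_geom_le r _ _ _ g _ (fun n => IH n pS).
apply: le_trans (h _ _) _; rewrite ny.
  rewrite -[1 / 4]invrK lef_pV2 ?posrE; lra.
rewrite mulrA -expRD big_cons mulrDr.
rewrite (_ : 4 * (2 * r%:R)^-1 = 2 * r%:R^-1) //.
by field; rewrite gt_eqF //; lra.
Qed.

End Slice.

Definition small_real_weights (s : seq (nat * R)) :=
  all (fun p => p.1%:R * `|p.2| <= 1 / 2) s.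

Lemma dcyclic_geoms_real_neq0 (f : nat -> R) s : dcyclic (fun n => f n / n%:R) ->
  periodic_mod Q f -> good_primes s -> small_real_weights s -> geoms Q s f 1 != 0.
Proof.
move=> cf pf gs ws.
have : geoms Q [seq (p.1, (p.2)%:C%C) | p <- s] (realfun f) 1 != 0.
  apply: dcyclic_geoms_neq0 => //.
    by rewrite (good_primes_map (fun p => (p.2)%:C%C)).
  rewrite /small_weights all_map; apply: sub_all ws => p h.
  by change (is_true (p.1%:R * normc ((p.2)%:C)%C <= 1 / 2)); rewrite normcR.
have -> : geoms Q [seq (p.1, (p.2)%:C%C) | p <- s] (realfun f) 1 = (geoms Q s f 1)%:C%C.
  by rewrite (geoms_morph (real_complex R)).
by apply: contra => /eqP ->.
Qed.

(* A zero-free slice through ever more primes of the class b has a bounded second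
   log-coefficient relative to Z = sum 1/r, while the quadratic term in Z is the
   second cumulant of f along b; so that cumulant vanishes. *)
Lemma dcyclic_cumulant (f : nat -> R) b psi : dcyclic (fun n => f n / n%:R) ->
  periodic_mod Q f -> ~ @recip_bounded R (fun r => r == b %[mod Q])%N ->
  good_primes psi -> small_real_weights psi ->
  let U := geoms Q psi f in U b ^+ 2 = U 1%N * U (b * b)%N.
Proof.
move=> cf pf nb gp wp U.
have U0 : U 1%N != 0 by exact: dcyclic_geoms_real_neq0.
have pU : periodic_mod Q (fun n => (U n)%:C%C).
  by move=> n; rewrite /U geoms_periodic.
have [H0 H00 HH0] := periodic_bounded Q_gt0 pU.
pose H := H0 + 1.
have Hp : 0 < H by rewrite /H; lra.
have HH n : `|U n| <= H by have := HH0 n; rewrite normcR /H; lra.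
pose D := U b ^+ 2 - U 1%N * U (b * b)%N.
suff : D = 0 by move/eqP; rewrite subr_eq0 => /eqP.
apply/eqP/negPn/negP => D0.
pose u := U 1%N ^+ 2.
have u0 : 0 < u by rewrite exprn_even_gt0.
(* [al] and [be] come from the inequality Z^2 |D| <= al Z + be reached at the end; the primes are
   then taken so numerous that Z |D| exceeds al + be. *)
pose al := `|U 1%N * U (b * b)%N| + 32 * u.
pose be := 8 * u * `|ln (H ^+ 2 / u)|.
have al0 : 0 <= al by rewrite /al; have := normr_ge0 (U 1%N * U (b * b)%N); lra.
have be0 : 0 <= be by rewrite /be mulr_ge0 ?normr_ge0 // mulr_ge0 // ltW.
have [S [uS pS bS dS ZS]] := @unbounded_class_primes R _ (map fst psi)
  ((al + be) / `|D| + 1) nb.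
set Z := \sum_(r <- S) r%:R^-1 in ZS.
have Z1 : 1 <= Z by apply: le_trans ZS; rewrite lerDr divr_ge0 // addr_ge0.
have [c0 c1 c2] := @coef_slice b psi f pf S 1%N pS bS.
rewrite -/Z in c1 c2; set Z2 := \sum_(r <- S) _ in c2.
have Z2Z : Z2 <= Z.
  rewrite /Z2 /Z big_seq [leRHS]big_seq; apply: ler_sum => r rS.
  have r1 : (1 : R) <= r%:R by rewrite ler1n prime_gt0 ?(allP pS).
  by rewrite expr2 ler_piMl ?invr_ge0 ?ler0n // invf_le1 //; lra.
have Z20 : 0 <= Z2 by apply: sumr_ge0 => r _; rewrite sqr_ge0.
pose P := map_poly (real_complex R) (slice psi f S 1%N).
have zf z : modsq z <= 1 -> P.[z] != 0.
  rewrite modsq_le1 => z1; rewrite /P slice_horner // dcyclic_geoms_neq0 //.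
    rewrite good_primesE map_cat -!map_comp.
    rewrite (_ : [seq _ | r <- S] = S); last by rewrite map_id_in.
    rewrite (_ : [seq _ | p <- psi] = map fst psi); last exact: eq_map.
    move: gp; rewrite good_primesE all_cat pS cat_uniq uS /= => /andP[-> ->].
    rewrite andbT /=; apply/hasPn => r rp /=.
    by apply/negP => h; have /allP/(_ _ h)/negP := dS; apply.
  rewrite /small_weights all_cat !all_map; apply/andP; split.
    apply/allP => r rS /=; rewrite Normc.normcM normcR ger0_norm ?invr_ge0 ?mulr_ge0 ?ler0n //.
    have r1 : (1 : R) <= r%:R by rewrite ler1n prime_gt0 ?(allP pS).
    rewrite mulrA (_ : r%:R * (2 * r%:R)^-1 = 1 / 2).
      by rewrite -[leRHS]mulr1; apply: ler_wpM2l; lra.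
    by field; rewrite gt_eqF //; lra.
  apply: sub_all wp => p h.
  by change (is_true (p.1%:R * normc ((p.2)%:C)%C <= 1 / 2)); rewrite normcR.
have bd z : modsq z = 1 -> modsq P.[z] <= (expR (2 * Z) * H) ^+ 2.
  move=> z1; rewrite -normc_sqr lerXn2r ?nnegrE ?normc_ge0 ?mulr_ge0 ?expR_ge0 //; first exact: ltW.
  apply: slice_bound => //; apply/eqP.
  by rewrite -(@pexpr_eq1 _ _ 2) ?normc_ge0 // normc_sqr z1.
have := zero_free_psum2 zf bd.
have -> : psum2 P / P`_0 ^+ 2 =
   (((Z ^+ 2 * D - Z2 * (U 1%N * U (b * b)%N)) / (4 * u))%:C)%C.
  rewrite /psum2 /P !coef_map /= c0 c1 c2 -/U !mul1n.
  have -> : (2 : C) = ((2 : R)%:C)%C by rewrite rmorph_nat.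
  rewrite -!(rmorphM, rmorphXn, rmorphB) -fmorphV -rmorphM; congr (_%:C)%C.
  by rewrite /D /u; field.
rewrite /= /P coef_map c0 -/U modsqR -/u.
have -> : (expR (2 * Z) * H) ^+ 2 / u = expR (4 * Z) * (H ^+ 2 / u).
  rewrite exprMn -mulrA; congr (_ * _); rewrite -expRM_natl; congr expR.
  by rewrite mulrA; congr (_ * _); ring.
have Hu : 0 < H ^+ 2 / u by apply: divr_gt0 => //; apply: exprn_gt0.
rewrite lnM ?posrE ?expR_gt0 // expRK.
rewrite normrM [X in _ * X]ger0_norm ?invr_ge0; last by lra.
rewrite ler_pdivrMr; last by lra.
set l := ln _; set V := U 1%N * U (b * b)%N => hl.
have l1 : u * l <= u * `|l| by apply: ler_wpM2l; [exact: ltW|exact: ler_norm].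
have t1 : Z ^+ 2 * `|D| <= `|Z ^+ 2 * D - Z2 * V| + Z * `|V|.
  have -> : Z ^+ 2 * `|D| = `|Z ^+ 2 * D - Z2 * V + Z2 * V|.
    by rewrite subrK normrM ger0_norm // sqr_ge0.
  apply: le_trans (ler_normD _ _) _; rewrite lerD2l normrM ger0_norm //.
  exact: ler_wpM2r.
have t2 : Z ^+ 2 * `|D| <= al * Z + be.
  apply: le_trans t1 _; rewrite /al /be -/V -/l.
  have e : 2 * (4 * Z + l) * (4 * u) = 32 * u * Z + 8 * (u * l) by ring.
  move: hl; rewrite e; lra.
have t3 : Z ^+ 2 * `|D| <= (al + be) * Z.
  apply: le_trans t2 _; rewrite (mulrDl al be) lerD2l.
  by rewrite -{1}[be]mulr1; apply: ler_wpM2l.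
have Dp : 0 < `|D| by rewrite normr_gt0.
have t4 : Z * `|D| <= al + be.
  by rewrite -(@ler_pM2r _ Z) ?(lt_le_trans ltr01) // mulrAC -expr2.
have : Z <= (al + be) / `|D| by rewrite ler_pdivlMr.
lra.
Qed.

End Cumulant.

Lemma poly_eq0_itv (R : realType) (p : {poly R}) (d : R) : 0 < d ->
  (forall y, 0 < y <= d -> p.[y] = 0) -> p = 0.
Proof.
move=> d0 H; apply/eqP/negPn/negP => p0.
pose s := [seq d / (k.+1)%:R | k <- iota 0 (size p)].
have dn0 : d != 0 by rewrite gt_eqF.
have us : uniq s.
  rewrite map_inj_uniq ?iota_uniq // => i j /(mulfI dn0)/invr_inj.
  by move/eqP; rewrite eqr_nat eqSS => /eqP.
have rs : all (root p) s.
  apply/allP => _ /mapP[k _ ->]; rewrite /root H //.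
  by rewrite divr_gt0 //= ler_pdivrMr // ler_peMr ?ler1n // ltW.
by have := max_poly_roots p0 rs us; rewrite size_map size_iota ltnn.
Qed.

(** * From the cumulant identity to invariance up to sign under units *)

Section Multiplicativity.
Context {R : realType}.
Variable Q : nat.
Hypothesis Q_gt0 : (0 < Q)%N.
Let M := (3 * totient Q)%N.

Definition geom_poly r (h : nat -> R) g : {poly R} := geom Q r 'X (fun n => (h n)%:P) g.

Lemma geom_poly_horner r h g y : (geom_poly r h g).[y] = geom Q r y h g.
Proof.
have := @geoms_morph _ _ (@horner_eval R y) Q [:: (r, 'X)] (fun n => (h n)%:P) g.
rewrite /= /horner_eval hornerX => ->.
by apply: eq_geom => n /=; rewrite /horner_eval hornerC.
Qed.

(** The coefficient of degree i is h (g r^i), diminished by h (g r^(i - M)) once i >= M; so the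
    values vanish one after the other. *)
Lemma geom_poly_eq0 r h g : prime r -> periodic_mod Q h -> geom_poly r h g = 0 ->
  forall i, h (g * r ^ i)%N = 0.
Proof.
move=> pr ph g0; elim/ltn_ind => i IH.
have [iQ|iQ] := ltnP i (Q + M); last first.
  rewrite -(IH (i - M)%N); last by have := period_gt0 Q_gt0; rewrite -/M; lia.
  apply: periodic_modMl => //.
  have := prime_pow_period Q_gt0 pr; rewrite -/M => E.
  have -> : i = ((Q + M) + (i - (Q + M)))%N by rewrite subnKC.
  have -> : (Q + M + (i - (Q + M)) - M = Q + (i - (Q + M)))%N by lia.
  by rewrite !(expnD _ _ (i - _)) -modnMml E modnMml.
have := congr1 (fun p : {poly R} => p`_i) g0; rewrite /geom_poly /geom -/M coefB coef0.
have -> : \sum_(j < Q + M) 'X ^+ j * (h (g * r ^ j)%N)%:P =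
    \poly_(j < Q + M) h (g * r ^ j)%N.
  by rewrite poly_def; apply: eq_bigr => j _; rewrite mulrC mul_polyC.
have -> : \sum_(j < Q) 'X ^+ (M + j) * (h (g * r ^ j)%N)%:P =
    'X^M * \poly_(j < Q) h (g * r ^ j)%N.
  rewrite poly_def mulr_sumr; apply: eq_bigr => j _.
  by rewrite exprD -mulrA; congr (_ * _); rewrite mulrC mul_polyC.
rewrite coef_poly iQ coefXnM; case: ltnP => iM; first by rewrite subr0.
rewrite coef_poly (IH (i - M)%N) ?if_same ?subr0 //.
by have := period_gt0 Q_gt0; rewrite -/M; lia.
Qed.

Lemma geom_eq0 r (h : nat -> R) g : prime r -> periodic_mod Q h ->
  (forall y : R, 0 < y <= (2 * r%:R)^-1 -> geom Q r y h g = 0) ->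
  forall i, h (g * r ^ i)%N = 0.
Proof.
move=> pr ph H; apply: geom_poly_eq0 => //.
apply: (@poly_eq0_itv _ _ (2 * r%:R)^-1).
  by rewrite invr_gt0 mulr_gt0 // ltr0n prime_gt0.
by move=> y hy; rewrite geom_poly_horner H.
Qed.

Lemma small_weight (r : nat) (y : R) : prime r -> 0 < y <= (2 * r%:R)^-1 ->
  r%:R * `|y| <= 1 / 2 /\ y < 1.
Proof.
move=> pr /andP[y0 y1]; have r1 : (1 : R) <= r%:R by rewrite ler1n prime_gt0.
move: y1; rewrite -[_^-1]mul1r ler_pdivlMr; last by lra.
rewrite gtr0_norm // mulrCA mulrC => y1; split; first by lra.
have : y <= y * r%:R by rewrite ler_peMr // ltW.
by lra.
Qed.

Variable f : nat -> R.
Hypothesis cf : dcyclic (fun n => f n / n%:R).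
Hypothesis pf : periodic_mod Q f.

Section Class.
Variable b : nat.
Hypothesis bQ : coprime b Q.
Hypothesis nb : ~ @recip_bounded R (fun r => r == b %[mod Q])%N.

(** A further prime [s] of the class, with variable weight y, extends the cumulant identity to all
    powers of [b]: by [geom_rec] the identity for the extended V becomes U 1 V (b b) = U b V b for
    all small y, and comparing coefficients gives U (b^i) = t^i U 1. Periodicity makes the real
    number t a root of unity. *)
Lemma geoms_class_sqr psi : good_primes psi -> small_real_weights psi ->
  geoms Q psi f b ^+ 2 = geoms Q psi f 1 ^+ 2.
Proof.
move=> gp wp; set U := geoms Q psi f.
have pU : periodic_mod Q U by apply: geoms_periodic.
have U0 : U 1%N != 0 by exact: dcyclic_geoms_real_neq0.
have [S [_ pS bS dS]] := @unbounded_class_primes R _ (map fst psi) 1 nb.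
case: S pS bS dS => [|s S]; first by rewrite big_nil ler10.
move=> /= /andP[ps _] /andP[/eqP sb _] /andP[spsi _] _.
pose h g := U 1%N * U (g * b * b)%N - U b * U (g * b)%N.
have ph : periodic_mod Q h.
  move=> n; rewrite /h; congr (_ * _ - _ * _); apply: (periodic_modP pU).
    by rewrite -!mulnA modnMml.
  by rewrite modnMml.
have hs i : h (s ^ i)%N = 0.
  rewrite -[(s ^ i)%N]mul1n; apply: geom_eq0 => // y hy.
  have [sy y1] := small_weight ps hy; have y0 : 0 < y by case/andP: hy.
  have gp' : good_primes ((s, y) :: psi) by rewrite good_primes_cons ps spsi gp.
  have wp' : small_real_weights ((s, y) :: psi) by rewrite /small_real_weights /= sy.
  have := dcyclic_cumulant Q_gt0 cf pf nb gp' wp'.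
  rewrite -/M; set V := geoms Q _ f => E.
  have pV : periodic_mod Q V by apply: geoms_periodic.
  have V1 : V 1%N = (1 - y ^+ M) * U 1%N + y * V b.
    rewrite /V /= geom_rec // -/U -/M; congr (_ + _ * _).
    by rewrite mul1n; apply: (periodic_modP pV).
  have Vb : V b = (1 - y ^+ M) * U b + y * V (b * b)%N.
    rewrite /V /= [LHS]geom_rec // -/U -/M; congr (_ + _ * _).
    exact: (periodic_modMl _ pV).
  have yM : 1 - y ^+ M != 0.
    by rewrite subr_eq0 eq_sym pexpr_eq1 ?period_gt0 ?lt_eqF // ltW.
  have E2 : U 1%N * V (b * b)%N - U b * V b = 0.
    apply: (mulfI yM); rewrite mulr0.
    have : V 1%N * V (b * b)%N - V b ^+ 2 = 0 by rewrite E subrr.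
    by rewrite expr2 {1}V1 {2}Vb => <-; ring.
  rewrite -[RHS]E2.
  transitivity (geom Q s y (fun g => U 1%N * U (b * b * g)%N) 1 -
     geom Q s y (fun g => U b * U (b * g)%N) 1).
    rewrite -[X in _ - X]mul1r -geom_lin; apply: eq_geom => g; rewrite /h mul1r.
    by congr (_ * U _ - _ * U _); rewrite mulnC ?mulnA // mulnC -mulnA mulnC.
  have scal a k : geom Q s y (fun g => a * U (k * g)%N) 1 = a * V k.
    have := geom_lin Q s y (fun _ => 0) (fun g => U (k * g)%N) (- a) 1.
    have z : geom Q s y (fun _ => 0) 1 = 0 :> R.
      by rewrite /geom !big1 ?subrr // => j _; rewrite mulr0.
    rewrite z sub0r mulNr opprK geom_shift muln1 => <-.
    by apply: eq_geom => g; rewrite sub0r mulNr opprK.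
  by rewrite !scal.
pose t := U b / U 1%N.
have Ub i : U (b ^ i)%N = t ^+ i * U 1%N.
  elim: i => [|i IH]; first by rewrite expn0 mul1r.
  case: i IH => [|j] IH; first by rewrite expn1 expr1 divfK.
  have := hs j; rewrite /h.
  have -> : U (s ^ j * b * b)%N = U (b ^ j.+2)%N.
    apply: (periodic_modP pU); rewrite -mulnA -modnMml -modnXm sb modnXm modnMml.
    by rewrite !expnSr mulnA.
  have -> : U (s ^ j * b)%N = U (b ^ j.+1)%N.
    by apply: (periodic_modP pU); rewrite -modnMml -modnXm sb modnXm modnMml expnSr.
  rewrite IH => /eqP; rewrite subr_eq0 => /eqP E.
  apply: (mulfI U0); rewrite E [t ^+ j.+2]exprS /t.
  by field.
have : t ^+ M = 1.
  apply: (mulIf U0); rewrite -Ub mul1r; apply: (periodic_modP pU).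
  by rewrite /M mulnC expnM -modnXm Euler_exp_totient // modnXm exp1n.
move/(congr1 Num.norm); rewrite normrX normr1 => /eqP.
rewrite pexpr_eq1 ?period_gt0 // => /eqP t1.
have -> : U b = t * U 1%N by rewrite divfK.
by rewrite exprMn -(real_normK (num_real t)) t1 expr1n mul1r.
Qed.

Lemma f1_neq0 : f 1 != 0.
Proof. exact: (@dcyclic_geoms_real_neq0 _ _ Q_gt0 f [::]). Qed.

Let t := f b / f 1.

Lemma class_ratio_sqr : t ^+ 2 = 1.
Proof.
have := @geoms_class_sqr [::] isT isT => /= E.
by rewrite /t expr_div_n E divff // expf_neq0 // f1_neq0.
Qed.

(** The sign cannot change with the weights: as polynomials in the weight of one prime, [A] and [B]
    have product 0, and [B] takes the nonzero value 2 t U 1 at weight 0, so [A] is the zero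
    polynomial. *)
Lemma geoms_class_ratio psi : good_primes psi -> small_real_weights psi ->
  all (fun p => 0 < p.2) psi ->
  geoms Q psi f b = t * geoms Q psi f 1.
Proof.
elim: psi => [|[r y] psi IH]; first by move=> _ _ _; rewrite /= divfK // f1_neq0.
rewrite good_primes_cons => /and3P[pr rpsi gp] /= /andP[wr wp] /andP[y0 pos].
have {}IH := IH gp wp pos; set U := geoms Q psi f in IH *.
have pU : periodic_mod Q U by apply: geoms_periodic.
pose A := geom_poly r U b - t%:P * geom_poly r U 1.
pose B := geom_poly r U b + t%:P * geom_poly r U 1.
have AB : A * B = 0.
  apply: (@poly_eq0_itv _ _ (2 * r%:R)^-1).
    by rewrite invr_gt0 mulr_gt0 // ltr0n prime_gt0.
  move=> z hz; have [rz _] := small_weight pr hz.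
  have := @geoms_class_sqr ((r, z) :: psi).
  rewrite good_primes_cons pr rpsi gp /small_real_weights /= rz => /(_ isT wp) E.
  have := geom_poly_horner r U b z; have := geom_poly_horner r U 1 z.
  rewrite hornerM /A /B; move: (geom_poly r U b) (geom_poly r U 1) => pb p1 e1 eb.
  rewrite !hornerD hornerN !hornerM !hornerC e1 eb.
  by rewrite -subr_sqr exprMn class_ratio_sqr mul1r -/U E subrr.
have U0 : U 1%N != 0 by exact: dcyclic_geoms_real_neq0.
have B0 : B != 0.
  have z n : (geom_poly r U n).[0] = U n.
    by rewrite geom_poly_horner geom_rec // expr0n (gtn_eqF (period_gt0 Q_gt0)) subr0 mul1r mul0r addr0.
  apply/eqP => /(congr1 (fun p : {poly R} => p.[0])).
  rewrite horner0 /B hornerD hornerM hornerC !z IH => /eqP.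
  rewrite -mulr2n mulrn_eq0 /= mulf_eq0 (negPf U0) orbF => /eqP t0.
  by have := class_ratio_sqr; rewrite t0 expr0n => /eqP; rewrite eq_sym oner_eq0.
move/eqP: AB; rewrite mulf_eq0 (negPf B0) orbF => /eqP /(congr1 (fun p : {poly R} => p.[y])).
rewrite horner0 /A hornerD hornerN hornerM hornerC !geom_poly_horner.
by move/eqP; rewrite subr_eq0 => /eqP.
Qed.

(** The relation at 1, known for all weights, is carried to [n] by moving the prime powers of [n]
    one at a time from the weights to the argument: vanishing for all small weights on [r] means
    vanishing at each r^i. The value at 0 is the value at [Q]. *)
Lemma class_multiplicative n : f (b * n)%N = t * f n.
Proof.
pose d n := f (b * n)%N - t * f n.
suff : d n = 0 by move/eqP; rewrite subr_eq0 => /eqP.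
have pd : periodic_mod Q d.
  by move=> m; rewrite /d pf; congr (_ - _); rewrite -pf modnMmr pf.
have main m psi : (0 < m)%N -> good_primes psi -> small_real_weights psi ->
    all (fun p => 0 < p.2) psi -> all (fun p => ~~ (p.1 %| m)%N) psi ->
    geoms Q psi d m = 0.
  elim/ltn_ind: m psi => m IH psi m0 gp wp pos dv.
  have [m1|m1] := leqP m 1.
    have -> : m = 1%N by lia.
    rewrite geoms_lin geoms_shift muln1 geoms_class_ratio // subrr //.
  pose r := pdiv m; have pr : prime r by exact: pdiv_prime.
  have rm : (r %| m)%N by exact: pdiv_dvd.
  pose i := logn r m; pose m' := partn m (negn r).
  have mE : m = (m' * r ^ i)%N by rewrite -p_part mulnC partnC.
  have m'0 : (0 < m')%N by rewrite part_gt0.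
  rewrite mE; apply: (geom_eq0 pr).
    exact: geoms_periodic.
  move=> y hy; have [ry _] := small_weight pr hy.
  have rm' : ~~ (r %| m')%N.
    apply/negP => h; have := part_pnat (negn r) m.
    by move/(pnat_dvd h); rewrite pnatE // !inE eqxx.
  apply: (IH m' _ ((r, y) :: psi)) => //.
  - rewrite [X in (_ < X)%N]mE ltn_Pmulr // -{1}(expn0 r) ltn_exp2l ?prime_gt1 //.
    by rewrite logn_gt0 mem_primes pr m0.
  - rewrite good_primes_cons pr gp andbT /=.
    apply/mapP => -[p pp rp]; have /allP/(_ p pp) := dv.
    by rewrite -rp rm.
  - by rewrite /small_real_weights /= ry.
  - by case/andP: hy => /= -> _.
  rewrite /= rm' /=; apply: sub_all dv => p; apply: contra => h.
  by rewrite mE dvdn_mulr.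
have [n0|n0] := posnP n; last by have := @main n [::] n0 isT isT isT isT.
by rewrite n0 -pd mod0n -(modnn Q) pd; apply: (@main Q [::]).
Qed.

End Class.

Theorem dcyclic_quasi_invariant a : coprime a Q -> (1 < Q)%N ->
  exists2 t : R, t ^+ 2 = 1 & forall n, f (a * n)%N = t * f n.
Proof.
move=> aQ Q1.
pose G m := `[< exists2 t : R, t ^+ 2 = 1 & forall n, f (m * n)%N = t * f n >].
suff : G a by move/asboolP.
apply: (@prime_classes_generate R Q G Q1 _ _ _ _ a aQ).
- by apply/asboolP; exists 1; rewrite ?expr1n // => n; rewrite mul1n mul1r.
- move=> m k /asboolP[t t1 Ht] /asboolP[u u1 Hu]; apply/asboolP.
  exists (t * u); first by rewrite exprMn t1 u1 mulr1.
  by move=> n; rewrite -mulnA Ht Hu mulrA.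
- move=> n; apply/asboolP/asboolP => -[t t1 Ht]; exists t => // m.
    by rewrite -Ht; apply: (periodic_modP pf); rewrite modnMml.
  by rewrite -Ht; apply: (periodic_modP pf); rewrite modnMml.
move=> b bQ nb; apply/asboolP; exists (f b / f 1).
  exact: class_ratio_sqr.
by move=> n; apply: class_multiplicative.
Qed.

End Multiplicativity.

(** * Sine series in L2(0,1) *)

Section InnerProduct.
Context {R : realType}.
Local Notation mu := (@lebesgue_measure R).
Implicit Types (u v w g : R -> R).

Lemma measurable_I01 : measurable (I01 : set (measurableTypeR R)).
Proof. exact: measurable_itv. Qed.

Lemma I01E (x : R) : I01 x = (0 < x < 1) :> Prop.
Proof. by rewrite /I01 /= in_itv. Qed.

Lemma mu_I01 : mu (@I01 R) = 1%:E.
Proof. by rewrite /I01 lebesgue_measure_itv /= lte_fin ltr01 sube0. Qed.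

Lemma mu_I01_lty : (mu (@I01 R) < +oo)%E.
Proof. by rewrite mu_I01 ltry. Qed.

Lemma L2_integrable_sqr u : L2 u -> mu.-integrable I01 (EFin \o (fun x => u x ^+ 2)).
Proof.
move=> [mu_ hu]; apply/integrableP; split.
  by apply/measurable_EFinP; apply: measurable_funX.
apply: le_lt_trans hu; rewrite le_eqVlt; apply/orP; left; apply/eqP.
by apply: eq_integral => x _ /=; rewrite ger0_norm // sqr_ge0.
Qed.

Lemma L2_integrableM u v : L2 u -> L2 v ->
  mu.-integrable I01 (EFin \o (fun x => u x * v x)).
Proof.
move=> Lu Lv; have := integrableD measurable_I01 (L2_integrable_sqr Lu) (L2_integrable_sqr Lv).
apply: le_integrable; first exact: measurable_I01.
  by apply/measurable_EFinP; apply: measurable_funM; [case: Lu|case: Lv].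
move=> x _; rewrite /= lee_fin.
rewrite [leRHS]ger0_norm ?addr_ge0 ?sqr_ge0 //.
rewrite normrM -(real_normK (num_real (u x))) -(real_normK (num_real (v x))).
have := sqr_ge0 (`|u x| - `|v x|); have := normr_ge0 (u x); have := normr_ge0 (v x).
set a := `|u x|; set b := `|v x| => b0 a0 h.
have : 0 <= a * b by apply: mulr_ge0.
have e : (a - b) ^+ 2 = a ^+ 2 + b ^+ 2 - 2 * (a * b) by ring.
by rewrite e in h; lra.
Qed.

Lemma L2_of_integrable_sqr u : measurable_fun I01 u ->
  mu.-integrable I01 (EFin \o (fun x => u x ^+ 2)) -> L2 u.
Proof.
move=> mu_ /integrableP[_ h]; split => //; apply: le_lt_trans h.
rewrite le_eqVlt; apply/orP; left; apply/eqP.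
by apply: eq_integral => x _ /=; rewrite ger0_norm // sqr_ge0.
Qed.

Lemma L2D u v : L2 u -> L2 v -> L2 (fun x => u x + v x).
Proof.
move=> Lu Lv; apply: L2_of_integrable_sqr.
  by apply: measurable_funD; [case: Lu|case: Lv].
have := integrableD measurable_I01 (integrableD measurable_I01 (L2_integrable_sqr Lu) (L2_integrable_sqr Lv))
  (integrableZl measurable_I01 2 (L2_integrableM Lu Lv)).
apply: eq_integrable; first exact: measurable_I01.
by move=> x _ /=; rewrite -!EFinM -!EFinD; congr EFin; ring.
Qed.

Lemma L2Z a u : L2 u -> L2 (fun x => a * u x).
Proof.
move=> Lu; apply: L2_of_integrable_sqr.
  by apply: measurable_funM => //; case: Lu.
have := integrableZl measurable_I01 (a ^+ 2) (L2_integrable_sqr Lu).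
apply: eq_integrable; first exact: measurable_I01.
by move=> x _ /=; rewrite -!EFinM; congr EFin; ring.
Qed.

Lemma L2_bounded u B : measurable_fun I01 u -> (forall x, I01 x -> `|u x| <= B) -> L2 u.
Proof.
move=> mu_ hB; apply: L2_of_integrable_sqr => //.
apply: measurable_bounded_integrable; [exact: measurable_I01|exact: mu_I01_lty| |].
  exact: measurable_funX.
exists (B ^+ 2); split; first exact: num_real.
move=> M hM x /= Ix; rewrite ger0_norm ?sqr_ge0 //; apply: le_trans (ltW hM).
have := hB x Ix; rewrite -(real_normK (num_real (u x))) => h.
by rewrite lerXn2r ?nnegrE // (le_trans _ h).
Qed.

Lemma L2_cst a : L2 (fun _ => a : R).
Proof. by apply: (@L2_bounded _ `|a|). Qed.

Lemma L2_sum (I : Type) (s : seq I) (P : pred I) (F : I -> R -> R) :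
  (forall i, L2 (F i)) -> L2 (fun x => \sum_(i <- s | P i) F i x).
Proof.
move=> LF; elim: s => [|i s IH].
  rewrite (_ : (fun x => _) = (fun _ => 0)); first exact: L2_cst.
  by apply/funext => x; rewrite big_nil.
rewrite (_ : (fun x => _) = (fun x => (if P i then F i x else 0) + \sum_(i <- s | P i) F i x)).
  apply: L2D => //; case: (P i) => //; exact: L2_cst.
by apply/funext => x; rewrite big_cons; case: (P i); rewrite ?add0r.
Qed.

Lemma L2B u v : L2 u -> L2 v -> L2 (fun x => u x - v x).
Proof.
move=> Lu Lv; rewrite (_ : (fun x => _) = (fun x => u x + -1 * v x)).
  by apply: L2D => //; apply: L2Z.
by apply/funext => x; rewrite mulN1r.
Qed.

Definition ip u v : R := \int[mu]_(x in I01) (u x * v x).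

Lemma ipC u v : ip u v = ip v u.
Proof. by apply: eq_Rintegral => x _; rewrite mulrC. Qed.

Lemma eq_ip u u' v v' : (forall x, I01 x -> u x = u' x) ->
  (forall x, I01 x -> v x = v' x) -> ip u v = ip u' v'.
Proof. by move=> h h'; apply: eq_Rintegral => x; rewrite inE => Ix; rewrite h ?h'. Qed.

Lemma ipDl u v w : L2 u -> L2 v -> L2 w -> ip (fun x => u x + v x) w = ip u w + ip v w.
Proof.
move=> Lu Lv Lw; rewrite /ip -RintegralD; [|exact: measurable_I01|exact: L2_integrableM|exact: L2_integrableM].
by apply: eq_Rintegral => x _; rewrite mulrDl.
Qed.

Lemma ipZl a u w : L2 u -> L2 w -> ip (fun x => a * u x) w = a * ip u w.
Proof.
move=> Lu Lw; rewrite /ip -RintegralZl; [|exact: measurable_I01|exact: L2_integrableM].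
by apply: eq_Rintegral => x _; rewrite mulrA.
Qed.

Lemma ip0l w : ip (fun _ => 0) w = 0.
Proof.
rewrite /ip (_ : (fun x => 0 * w x) = cst 0); last by apply/funext => x; rewrite mul0r.
by rewrite Rintegral_cst ?mul0r //; exact: measurable_I01.
Qed.

Lemma ip_suml (I : Type) (s : seq I) (P : pred I) (F : I -> R -> R) w :
  (forall i, L2 (F i)) -> L2 w ->
  ip (fun x => \sum_(i <- s | P i) F i x) w = \sum_(i <- s | P i) ip (F i) w.
Proof.
move=> LF Lw; elim: s => [|i s IH].
  rewrite big_nil -[RHS](ip0l w); apply: eq_ip => // x _.
  by rewrite big_nil.
rewrite big_cons -IH; case: ifP => Pi.
  rewrite -ipDl //; last exact: L2_sum.
  by apply: eq_ip => // x _; rewrite big_cons Pi.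
by apply: eq_ip => // x _; rewrite big_cons Pi.
Qed.

Lemma ip_ge0 u : 0 <= ip u u.
Proof. by apply: Rintegral_ge0 => x _; rewrite -expr2 sqr_ge0. Qed.

Lemma L2_normE u : L2 u -> (\int[mu]_(x in I01) ((u x) ^+ 2)%:E)%E = (ip u u)%:E.
Proof.
move=> Lu; rewrite /ip /Rintegral fineK; last first.
  exact: (integrable_fin_num measurable_I01 (L2_integrableM Lu Lu)).
by apply: eq_integral => x _.
Qed.

Lemma ip_sqrD u v : L2 u -> L2 v ->
  ip (fun x => u x + v x) (fun x => u x + v x) <= 2 * ip u u + 2 * ip v v.
Proof.
move=> Lu Lv; have LD := L2D Lu Lv; have LB := L2B Lu Lv.
have h := ip_ge0 (fun x => u x + -1 * v x).
have LN : L2 (fun x => -1 * v x) by exact: L2Z.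
move: h; rewrite !ipDl //; last exact: L2D.
rewrite [ip u (fun x => _ + _)]ipC [ip (fun x => -1 * v x) (fun x => _ + _)]ipC !ipDl //.
rewrite [ip u (fun x => _ + _)]ipC [ip v (fun x => _ + _)]ipC !ipDl //.
rewrite !ipZl // ![ip _ (fun x => -1 * v x)]ipC !ipZl // (ipC v u).
by lra.
Qed.

End InnerProduct.

Section Sines.
Context {R : realType}.
Local Notation mu := (@lebesgue_measure R).
Implicit Types (u v w g : R -> R).

Lemma Rintegral_FTC (F f : R -> R) a b : a < b ->
  (forall x, is_derive x (1 : R) F (f x)) -> continuous f ->
  \int[mu]_(x in `]a, b[) f x = F b - F a.
Proof.
move=> ab dF cf.
have cF : continuous F.
  by move=> x; apply: differentiable_continuous; apply/derivable1_diffP; case: (dF x).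
have h : (\int[mu]_(x in `[a, b]) (f x)%:E = (F b)%:E - (F a)%:E)%E.
  apply: continuous_FTC2 => //.
  - exact: continuous_subspaceT.
  - split => [x _|  |].
    + by case: (dF x).
    + by apply: cvg_at_right_filter; exact: cF.
    + by apply: cvg_at_left_filter; exact: cF.
  - by move=> x _; rewrite derive1E; case: (dF x).
rewrite /Rintegral -(@integral_itv_bndoo _ a b _ true false).
  by rewrite h.
apply/measurable_EFinP; apply: (measurable_funS measurableT) => //.
exact: continuous_measurable_fun.
Qed.

Lemma sin_natpi n : sin (n%:R * pi : R) = 0.
Proof.
elim: n => [|n IH]; first by rewrite mul0r sin0.
by rewrite -natr1 mulrDl mul1r sinDpi IH oppr0.
Qed.

Lemma cos_2natpi n (x : R) : cos (x + (2 * n)%:R * pi) = cos x.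
Proof.
elim: n => [|n IH]; first by rewrite muln0 mul0r addr0.
have -> : x + (2 * n.+1)%:R * pi = (x + (2 * n)%:R * pi) + pi *+ 2.
  by rewrite mulnS natrD -mulr_natl; ring.
by rewrite cosD2pi.
Qed.

Definition sn (n : nat) (x : R) : R := sin (n%:R * pi * x).

Lemma continuous_sn n : continuous (sn n).
Proof.
move=> x; apply: (@continuous_comp _ _ _ (fun x => n%:R * pi * x) (@sin R)).
  by apply: cvgM; [exact: cvg_cst|exact: cvg_id].
exact: continuous_sin.
Qed.

Lemma L2_continuous g B : continuous g -> (forall x, `|g x| <= B) -> L2 g.
Proof.
move=> cg hB; apply: (L2_bounded (B := B)) => //.
apply: (measurable_funS measurableT) => //.
exact: continuous_measurable_fun.
Qed.

Lemma L2_sn n : L2 (sn n).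
Proof. by apply: (L2_continuous (B := 1) (@continuous_sn n)) => x; exact: sin_max. Qed.

Lemma is_derive_cos_scale c x : is_derive x (1 : R) (fun y : R => cos (c * y)) (- c * sin (c * x)).
Proof.
have h1 : is_derive x (1 : R) (fun y : R => c * y) c.
  by apply: is_derive_eq; rewrite /GRing.scale /= mulr1.
have := @is_derive1_comp _ (@cos R) (fun y : R => c * y) x _ _ (is_derive_cos _) h1.
by rewrite mulrC mulrN mulNr.
Qed.

Lemma is_derive_sin_scale c x : is_derive x (1 : R) (fun y : R => sin (c * y)) (c * cos (c * x)).
Proof.
have h1 : is_derive x (1 : R) (fun y : R => c * y) c.
  by apply: is_derive_eq; rewrite /GRing.scale /= mulr1.
have := @is_derive1_comp _ (@sin R) (fun y : R => c * y) x _ _ (is_derive_sin _) h1.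
by rewrite mulrC.
Qed.

Lemma integral_sn n a b : (0 < n)%N -> a < b ->
  \int[mu]_(x in `]a, b[) sn n x =
  (cos (n%:R * pi * a) - cos (n%:R * pi * b)) / (n%:R * pi).
Proof.
move=> n0 ab; set c := n%:R * pi.
have c0 : c != 0 by rewrite mulf_neq0 ?pnatr_eq0 -?lt0n // gt_eqF // pi_gt0.
have dF (x : R) : is_derive x (1 : R) (fun x : R => - c^-1 * cos (c * x)) (sn n x).
  have h := is_derive_cos_scale c x.
  by apply: is_derive_eq; rewrite /GRing.scale /= /sn -/c; field.
rewrite (Rintegral_FTC ab dF (@continuous_sn n)).
by field.
Qed.

Lemma ip_sn_diag n : (0 < n)%N -> ip (sn n) (sn n) = 1 / 2.
Proof.
move=> n0; set c : R := n%:R * pi.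
have c0 : c != 0 by rewrite mulf_neq0 ?pnatr_eq0 -?lt0n // gt_eqF // pi_gt0.
have dF (x : R) : is_derive x (1 : R) (fun x : R => x / 2 - (4 * c)^-1 * sin (2 * c * x))
    (sn n x * sn n x).
  have h := is_derive_sin_scale (2 * c) x.
  apply: is_derive_eq; rewrite /GRing.scale /= /sn -/c.
  have -> : 2 * c * x = (c * x) *+ 2 by ring.
  by rewrite cos_mulr2n -expr2 sin2cos2; field.
have cF : continuous (fun x => sn n x * sn n x).
  by move=> x; apply: cvgM; exact: continuous_sn.
rewrite /ip (Rintegral_FTC ltr01 dF cF).
have s0 : sin (2 * c) = 0 by rewrite /c mulrA -natrM sin_natpi.
rewrite !mulr1 s0 !mulr0 sin0 !mulr0 mul0r; lra.
Qed.

Lemma ip_sn_ortho n m : (0 < n)%N -> (0 < m)%N -> n != m -> ip (sn n) (sn m) = 0.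
Proof.
wlog mn : n m / (m < n)%N.
  move=> W n0 m0 nm; case: (ltngtP m n) => h; first exact: W.
    by rewrite ipC W // eq_sym.
  by rewrite h eqxx in nm.
move=> n0 m0 _; pose a : R := (n - m)%:R * pi; pose b : R := (n + m)%:R * pi.
have a0 : a != 0 by rewrite mulf_neq0 ?pnatr_eq0 -?lt0n ?subn_gt0 // gt_eqF // pi_gt0.
have b0 : b != 0 by rewrite mulf_neq0 ?pnatr_eq0 -?lt0n ?addn_gt0 ?n0 // gt_eqF // pi_gt0.
have dF (x : R) : is_derive x (1 : R)
    (fun x : R => (2 * a)^-1 * sin (a * x) - (2 * b)^-1 * sin (b * x)) (sn n x * sn m x).
  have ha := is_derive_sin_scale a x; have hb := is_derive_sin_scale b x.
  apply: is_derive_eq; rewrite /GRing.scale /= /sn.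
  have -> : a * x = n%:R * pi * x - m%:R * pi * x by rewrite /a natrB ?(ltnW mn) //; ring.
  have -> : b * x = n%:R * pi * x + m%:R * pi * x by rewrite /b natrD; ring.
  by rewrite cosB cosD; field; rewrite a0 b0.
have cF : continuous (fun x => sn n x * sn m x).
  by move=> x; apply: cvgM; exact: continuous_sn.
rewrite /ip (Rintegral_FTC ltr01 dF cF).
by rewrite !mulr0 !mulr1 sin0 !sin_natpi; lra.
Qed.

Lemma ip_sn n m : (0 < n)%N -> (0 < m)%N -> ip (sn n) (sn m) = (n == m)%:R / 2.
Proof.
move=> n0 m0; case: eqVneq => [<-|nm]; first exact: ip_sn_diag.
by rewrite mul0r ip_sn_ortho.
Qed.

Definition sine_poly N (d : nat -> R) (x : R) : R := \sum_(1 <= j < N.+1) d j * sn j x.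

Lemma L2_sine_poly N d : L2 (sine_poly N d).
Proof. by apply: L2_sum => j; apply: L2Z; apply: L2_sn. Qed.

(** Completing the square. The choice of [d] that annihilates the last sum yields Bessel's
    inequality; dropping that sum for a good approximation yields the converse estimate. *)
Lemma ip_sine_poly_sq v N d : L2 v ->
  ip (fun x => v x - sine_poly N d x) (fun x => v x - sine_poly N d x) =
  ip v v - 2 * \sum_(1 <= j < N.+1) ip v (sn j) ^+ 2 +
  1 / 2 * \sum_(1 <= j < N.+1) (2 * ip v (sn j) - d j) ^+ 2.
Proof.
move=> Lv; have Ls := L2_sine_poly N d.
have E1 w : L2 w -> ip (sine_poly N d) w = \sum_(1 <= j < N.+1) d j * ip (sn j) w.
  move=> Lw; rewrite /sine_poly ip_suml //; last by move=> j; apply: L2Z; apply: L2_sn.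
  by apply: eq_bigr => j _; rewrite ipZl //; apply: L2_sn.
have E2 j : (0 < j < N.+1)%N -> ip (sine_poly N d) (sn j) = d j / 2.
  move=> /andP[j0 jN]; rewrite E1; last exact: L2_sn.
  rewrite (bigD1_seq j) ?iota_uniq ?mem_index_iota ?j0 //= ip_sn_diag //.
  rewrite big1_seq ?addr0; first by rewrite mul1r.
  move=> i /andP[ij]; rewrite mem_index_iota => /andP[i0 _].
  by rewrite ip_sn_ortho // mulr0.
have E3 : ip (sine_poly N d) (sine_poly N d) = 1 / 2 * \sum_(1 <= j < N.+1) d j ^+ 2.
  rewrite E1 // mulr_sumr; apply: eq_big_nat => j jN.
  by rewrite ipC E2 //; field.
have Lm : L2 (fun x => -1 * sine_poly N d x) by apply: L2Z.
transitivity (ip (fun x => v x + -1 * sine_poly N d x) (fun x => v x + -1 * sine_poly N d x)).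
  by apply: eq_ip => x _; rewrite mulN1r.
set S := sine_poly N d in Ls E1 E2 E3 Lm *.
pose S2 := \sum_(1 <= j < N.+1) d j * ip v (sn j).
have Sv : ip S v = S2 by rewrite E1 //; apply: eq_bigr => j _; rewrite ipC.
rewrite ipDl //; last exact: L2D.
rewrite ipZl //; last exact: L2D.
rewrite (ipC v) (ipC S) !ipDl // !ipZl // (ipC v S) Sv E3.
have -> : \sum_(1 <= j < N.+1) (2 * ip v (sn j) - d j) ^+ 2 =
   4 * \sum_(1 <= j < N.+1) ip v (sn j) ^+ 2 - 4 * S2 + \sum_(1 <= j < N.+1) d j ^+ 2.
  rewrite /S2 !mulr_sumr -sumrB -big_split /=; apply: eq_bigr => j _; ring.
lra.
Qed.

End Sines.

(** * Density of the sine polynomials *)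

Section SineSpan.
Context {R : realType}.
Local Notation mu := (@lebesgue_measure R).
Implicit Types (u v w g : R -> R).

Definition sine_span g := exists N d, forall x, g x = sine_poly N d x.

Lemma eq_sine_span g h : g =1 h -> sine_span g -> sine_span h.
Proof. by move=> E [N [d H]]; exists N, d => x; rewrite -E. Qed.

Lemma sine_poly_widen N N' d : (N <= N')%N ->
  sine_poly N d =1 sine_poly N' (fun j => if (j <= N)%N then d j else 0) :> (R -> R).
Proof.
move=> h x; rewrite /sine_poly [RHS](big_cat_nat (n := N.+1)) //=.
rewrite [X in _ = _ + X]big1_seq ?addr0; last first.
  by move=> j /andP[_]; rewrite mem_index_iota => /andP[Nj _]; rewrite leqNgt Nj mul0r.
by apply: eq_big_nat => j /andP[_ jN]; rewrite -ltnS jN.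
Qed.

Lemma sine_spanD g h : sine_span g -> sine_span h -> sine_span (fun x => g x + h x).
Proof.
move=> [N [d Hd]] [N' [d' Hd']].
exists (maxn N N'), (fun j => (if (j <= N)%N then d j else 0) + (if (j <= N')%N then d' j else 0)) => x.
rewrite Hd Hd' (sine_poly_widen d (leq_maxl N N')) (sine_poly_widen d' (leq_maxr N N')).
by rewrite /sine_poly -big_split /=; apply: eq_bigr => j _; rewrite mulrDl.
Qed.

Lemma sine_spanZ a g : sine_span g -> sine_span (fun x => a * g x).
Proof.
move=> [N [d Hd]]; exists N, (fun j => a * d j) => x; rewrite Hd /sine_poly mulr_sumr.
by apply: eq_bigr => j _; rewrite mulrA.
Qed.

Lemma sine_span0 : sine_span (fun _ => 0).
Proof. by exists 0%N, (fun _ => 0) => x; rewrite /sine_poly big_geq. Qed.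

Lemma sine_span_sn j : (0 < j)%N -> sine_span (sn j).
Proof.
move=> j0; exists j, (fun i => (i == j)%:R) => x; rewrite /sine_poly.
rewrite big_nat_recr //= eqxx mul1r big1_seq ?add0r // => i /andP[_].
by rewrite mem_index_iota => /andP[_ ij]; rewrite ltn_eqF // mul0r.
Qed.

Lemma sine_span_sum (s : seq nat) (F : nat -> R -> R) :
  (forall i, i \in s -> sine_span (F i)) -> sine_span (fun x => \sum_(i <- s) F i x).
Proof.
elim: s => [|i s IH] H.
  by apply: eq_sine_span sine_span0 => x; rewrite big_nil.
apply: (@eq_sine_span (fun x => F i x + \sum_(i <- s) F i x)).
  by move=> x; rewrite big_cons.
apply: sine_spanD; first by apply: H; rewrite mem_head.
by apply: IH => k ks; apply: H; rewrite inE ks orbT.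
Qed.

Lemma sine_span_cos g : sine_span g -> sine_span (fun x => g x * cos (pi * x)).
Proof.
move=> [N [d Hd]].
apply: (@eq_sine_span (fun x => \sum_(1 <= j < N.+1) d j * (sn j x * cos (pi * x)))).
  by move=> x; rewrite Hd /sine_poly mulr_suml; apply: eq_bigr => j _; rewrite mulrA.
apply: sine_span_sum => -[|j]; rewrite mem_index_iota => // _.
apply: (sine_spanZ (d j.+1)).
apply: (@eq_sine_span (fun x => 1 / 2 * (sn j.+2 x + sn j x))).
  move=> x; rewrite /sn.
  have -> : (j.+2)%:R * pi * x = (j.+1)%:R * pi * x + pi * x by rewrite -[(j.+2)%:R]natr1; ring.
  have -> : j%:R * pi * x = (j.+1)%:R * pi * x - pi * x by rewrite -[(j.+1)%:R]natr1; ring.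
  by rewrite sinD sinB; field.
apply: (sine_spanZ (1 / 2)); apply: sine_spanD; first exact: sine_span_sn.
case: j => [|j]; last exact: sine_span_sn.
by apply: eq_sine_span sine_span0 => x; rewrite /sn !mul0r sin0.
Qed.

(** Gives access to all polynomials in cos (pi x), a variable that separates the points of (0,1).
    The factor [sn 1], common to all sine polynomials, is carried along until [sine_closure_ge0]
    divides by it. *)
Lemma sine_span_poly (p : {poly R}) : sine_span (fun x => sn 1 x * p.[cos (pi * x)]).
Proof.
elim/poly_ind: p => [|p c IH].
  by apply: eq_sine_span sine_span0 => x; rewrite horner0 mulr0.
apply: (@eq_sine_span (fun x => sn 1 x * p.[cos (pi * x)] * cos (pi * x) + c * sn 1 x)).
  by move=> x; rewrite hornerMXaddC; ring.
apply: sine_spanD; first exact: sine_span_cos.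
by apply: sine_spanZ; apply: sine_span_sn.
Qed.

Lemma L2_sine_span g : sine_span g -> L2 g.
Proof.
move=> [N [d H]]; rewrite (_ : g = sine_poly N d); first exact: L2_sine_poly.
exact/funext.
Qed.

Definition dist2 g h := ip (fun x => g x - h x) (fun x => g x - h x).

Definition sine_closure g := L2 g /\
  forall e, 0 < e -> exists h, sine_span h /\ dist2 g h < e.

Lemma dist2_tri g h k : L2 g -> L2 h -> L2 k ->
  dist2 g k <= 2 * dist2 g h + 2 * dist2 h k.
Proof.
move=> Lg Lh Lk; apply: le_trans (ip_sqrD (L2B Lg Lh) (L2B Lh Lk)).
rewrite le_eqVlt; apply/orP; left; apply/eqP.
by apply: eq_ip => x _; ring.
Qed.

Lemma sine_closure_lim g : L2 g ->
  (forall e, 0 < e -> exists u, sine_closure u /\ dist2 g u < e) -> sine_closure g.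
Proof.
move=> Lg H; split => // e e0.
have [u [[Lu Hu] hu]] := H (e / 4) ltac:(lra).
have [h [sh hh]] := Hu (e / 4) ltac:(lra).
exists h; split => //; apply: le_lt_trans (dist2_tri Lg Lu (L2_sine_span sh)) _; lra.
Qed.

Lemma sine_closure_span g : sine_span g -> sine_closure g.
Proof.
move=> sg; split; first exact: L2_sine_span.
move=> e e0; exists g; split => //; rewrite /dist2.
rewrite (@eq_ip _ _ (fun _ => 0) _ (fun x => g x - g x)) ?ip0l // => x _.
by rewrite subrr.
Qed.

Lemma sine_closureD g h : sine_closure g -> sine_closure h ->
  sine_closure (fun x => g x + h x).
Proof.
move=> [Lg Hg] [Lh Hh]; split; first exact: L2D.
move=> e e0; have [g' [sg hg]] := Hg (e / 4) ltac:(lra).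
have [h' [sh hh]] := Hh (e / 4) ltac:(lra).
exists (fun x => g' x + h' x); split; first exact: sine_spanD.
have := ip_sqrD (L2B Lg (L2_sine_span sg)) (L2B Lh (L2_sine_span sh)).
rewrite -/(dist2 g g') -/(dist2 h h') => D.
have -> : dist2 (fun x => g x + h x) (fun x => g' x + h' x) =
  ip (fun x => g x - g' x + (h x - h' x)) (fun x => g x - g' x + (h x - h' x)).
  by apply: eq_ip => x _; ring.
by apply: le_lt_trans D _; lra.
Qed.

Lemma sine_closureZ a g : sine_closure g -> sine_closure (fun x => a * g x).
Proof.
move=> [Lg Hg]; split; first exact: L2Z.
move=> e e0; have a2 : 0 < a ^+ 2 + 1 by have := sqr_ge0 a; lra.
have [h [sh hh]] := Hg (e / (a ^+ 2 + 1)) ltac:(exact: divr_gt0).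
exists (fun x => a * h x); split; first exact: sine_spanZ.
have LB := L2B Lg (L2_sine_span sh).
have -> : dist2 (fun x => a * g x) (fun x => a * h x) = a ^+ 2 * dist2 g h.
  transitivity (ip (fun x => a * (g x - h x)) (fun x => a * (g x - h x))).
    by apply: eq_ip => x _; ring.
  by rewrite ipZl // 1?ipC ?ipZl //; [rewrite mulrA|exact: L2Z].
have d0 : 0 <= dist2 g h by exact: ip_ge0.
move: hh; rewrite ltr_pdivlMr // => hh.
by apply: le_lt_trans hh; rewrite mulrC ler_wpM2l // lerDl.
Qed.

Lemma sine_closure_eq g h : (forall x, I01 x -> g x = h x) -> L2 h ->
  sine_closure g -> sine_closure h.
Proof.
move=> E Lh [Lg Hg]; split => // e e0; have [k [sk hk]] := Hg e e0.
exists k; split => //; apply: le_lt_trans hk; rewrite le_eqVlt; apply/orP; left; apply/eqP.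
by apply: eq_ip => x Ix; rewrite E.
Qed.

Lemma sine_closure_dominated g (u : nat -> R -> R) G : L2 G -> L2 g ->
  (forall n, sine_closure (u n)) ->
  (forall x n, I01 x -> `|u n x| <= G x) -> (forall x, I01 x -> `|g x| <= G x) ->
  {ae mu, forall x, I01 x -> u ^~ x @ \oo --> g x} -> sine_closure g.
Proof.
move=> LG Lg Hu uG gG ug; apply: sine_closure_lim => // e e0.
have Lu n : L2 (u n) by case: (Hu n).
pose f n x := ((g x - u n x) ^+ 2)%:E.
have h1 n : measurable_fun I01 (f n).
  by apply/measurable_EFinP; apply: measurable_funX; case: (L2B Lg (Lu n)).
have h2 : measurable_fun (I01 : set R) (fun _ : R => 0%E : \bar R) by exact: measurable_cst.
have h3 : {ae mu, forall x, I01 x -> f ^~ x @ \oo --> (0%E : \bar R)}.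
  case: ug => N [mN N0 hN]; exists N; split => // x /= hx; apply: hN => /= hx2; apply: hx => Ix.
  have h : (fun n => g x - u n x) @ \oo --> g x - g x.
    by apply: cvgB; [exact: cvg_cst|exact: hx2].
  apply: cvg_EFin; first exact: nearW.
  have -> : fine \o f ^~ x = (fun n => (g x - u n x) * (g x - u n x)).
    by apply/funext => n; rewrite /f /= expr2.
  by rewrite subrr in h; rewrite -[X in _ --> X](mulr0 0); apply: cvgM.
have h4 : mu.-integrable I01 (fun x => ((2 * G x) ^+ 2)%:E).
  exact: L2_integrable_sqr (L2Z 2 LG).
have h5 : {ae mu, forall x n, I01 x -> (`|f n x| <= ((2 * G x) ^+ 2)%:E)%E}.
  apply: aeW => x n Ix; rewrite /f /= lee_fin ger0_norm ?sqr_ge0 //.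
  rewrite -(real_normK (num_real (g x - u n x))).
  have := uG x n Ix; have := gG x Ix => a b.
  rewrite lerXn2r ?nnegrE //; first by have := normr_ge0 (g x); lra.
  apply: le_trans (ler_normB _ _) _; lra.
have [_ _ h] := dominated_convergence measurable_I01 h1 h2 h3 h4 h5.
have : (fun n => dist2 g (u n)) @ \oo --> (0 : R).
  have -> : (fun n => dist2 g (u n)) = (fun n => fine (\int[mu]_(x in I01) (f n x))%E).
    by apply/funext => n; rewrite /f L2_normE //; exact: L2B.
  apply: fine_cvg; move: h; rewrite integral0; exact.
move/cvgrPdist_lt => /(_ e e0) [n _ /(_ n (leqnn n))] /=.
rewrite sub0r normrN ger0_norm ?ip_ge0 // => hn.
by exists (u n).
Qed.

End SineSpan.

Lemma bernoulli_ineq (R : realDomainType) (u : R) m : -1 <= u -> 1 + m%:R * u <= (1 + u) ^+ m.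
Proof.
move=> u1; elim: m => [|m IH]; first by rewrite mul0r addr0 expr0.
rewrite exprS; have h : (1 + u) * (1 + m%:R * u) <= (1 + u) * (1 + u) ^+ m.
  by apply: ler_wpM2l => //; lra.
apply: le_trans h; rewrite -natr1.
have : 0 <= m%:R * (u * u) by rewrite mulr_ge0 // -expr2 sqr_ge0.
have -> : (1 + u) * (1 + m%:R * u) = 1 + (m%:R + 1) * u + m%:R * (u * u) by ring.
lra.
Qed.

Section Threshold.
Context {R : realType}.

Lemma threshold_bounds (t : R) n : 0 <= t <= 1 -> 0 <= (1 - t ^+ n) ^+ (2 ^ n) <= 1.
Proof.
move=> /andP[t0 t1]; have h0 : 0 <= t ^+ n by exact: exprn_ge0.
have h1 : t ^+ n <= 1 by exact: exprn_ile1.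
by rewrite exprn_ge0 ?exprn_ile1 //; lra.
Qed.

(** Bernoulli's inequality bounds the value from below by 1 - (2 t)^n. These are the step-like
    polynomials of the elementary proof of the Stone-Weierstrass theorem, with threshold 1 / 2. *)
Lemma cvg_threshold_lt (t : R) : 0 <= t < 1 / 2 ->
  (fun n => (1 - t ^+ n) ^+ (2 ^ n)) @ \oo --> (1 : R).
Proof.
move=> /andP[t0 t1].
apply: (@squeeze_cvgr _ _ _ _ (fun n => 1 - (2 * t) ^+ n) (fun _ => 1)).
- apply: nearW => n.
  have t01 : 0 <= t <= 1 by lra.
  have /andP[_ ->] := threshold_bounds n t01; rewrite andbT.
  have h1 : t ^+ n <= 1 by apply: exprn_ile1; lra.
  have := @bernoulli_ineq R (- t ^+ n) (2 ^ n)%N ltac:(lra).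
  by rewrite exprMn natrX mulrN.
- rewrite -[X in _ --> X]subr0; apply: cvgB; first exact: cvg_cst.
  by apply: cvg_expr; rewrite ger0_norm; lra.
- exact: cvg_cst.
Qed.

(** (1 - t^n) (1 + t^n) is at most 1, and by Bernoulli's inequality (1 + t^n)^(2^n) is at least (2
    t)^n. *)
Lemma cvg_threshold_gt (t : R) : 1 / 2 < t <= 1 ->
  (fun n => (1 - t ^+ n) ^+ (2 ^ n)) @ \oo --> (0 : R).
Proof.
move=> /andP[t0 t1].
apply: (@squeeze_cvgr _ _ _ _ (fun _ => 0) (fun n => ((2 * t)^-1) ^+ n)).
- apply: nearW => n.
  have t01 : 0 <= t <= 1 by lra.
  have /andP[-> _] := threshold_bounds n t01; rewrite andTb.
  have h0 : 0 < t ^+ n by apply: exprn_gt0; lra.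
  have B := @bernoulli_ineq R (t ^+ n) (2 ^ n)%N ltac:(lra).
  have E : (1 - t ^+ n) ^+ (2 ^ n) * (1 + t ^+ n) ^+ (2 ^ n) <= 1.
    rewrite -exprMn; apply: exprn_ile1.
      have : t ^+ n <= 1 by apply: exprn_ile1; lra.
      by move=> h1; apply: mulr_ge0; lra.
    have -> : (1 - t ^+ n) * (1 + t ^+ n) = 1 - t ^+ n ^+ 2 by ring.
    by have := sqr_ge0 (t ^+ n); lra.
  rewrite exprVn exprMn -[leRHS]mul1r ler_pdivlMr; last by apply: mulr_gt0; apply: exprn_gt0; lra.
  apply: le_trans E; apply: ler_wpM2l.
    by have /andP[] := threshold_bounds n t01.
  by rewrite natrX in B; lra.
- exact: cvg_cst.
- apply: cvg_expr; rewrite ger0_norm ?invr_ge0; last by lra.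
  by rewrite invf_lt1; lra.
Qed.

End Threshold.

Section Density.
Context {R : realType}.
Local Notation mu := (@lebesgue_measure R).
Implicit Types (g : R -> R).

Lemma sn1_bounds x : I01 x -> 0 < sn 1 x <= (1 : R).
Proof.
rewrite I01E => /andP[x0 x1]; rewrite /sn mul1r sin_le1 andbT.
apply: sin_gt0_pi; rewrite mulr_gt0 ?pi_gt0 //=.
by rewrite -[ltRHS]mulr1 ltr_pM2l // pi_gt0.
Qed.

Lemma L2_sn1_indic (A : set R) : measurable A -> L2 (fun x => sn 1 x * \1_A x).
Proof.
move=> mA; apply: (L2_bounded (B := 1)).
  apply: measurable_funM; first by case: (@L2_sn R 1).
  by apply: (measurable_funS measurableT) => //; exact: measurable_indic.
move=> x _; rewrite normrM -[leRHS]mulr1; apply: ler_pM => //; first exact: sin_max.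
by rewrite indicE; case: (_ \in _); rewrite ?normr1 ?normr0.
Qed.

Lemma sine_closure_sn1 : sine_closure (sn 1 : R -> R).
Proof. by apply: sine_closure_span; apply: sine_span_sn. Qed.

Lemma sine_closure_ray (a : R) : sine_closure (fun x => sn 1 x * \1_(`]a, +oo[%classic : set R) x).
Proof.
have mA : measurable (`]a, +oo[%classic : set R) by exact: measurable_itv.
have L := L2_sn1_indic mA.
have [a0|a0] := leP a 0.
  apply: sine_closure_eq L sine_closure_sn1 => x; rewrite I01E => /andP[x0 _].
  by rewrite indicE mem_set ?mulr1 //= in_itv /= andbT (le_lt_trans a0).
have [a1|a1] := leP 1 a.
  apply: sine_closure_eq L (sine_closure_span (@sine_span0 R)) => x; rewrite I01E => /andP[_ x1].
  by rewrite indicE memNset ?mulr0 //= in_itv /= andbT => ax; lra.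
pose c := cos (pi * a).
(* An affine map sending the values of the cosine into [0,1] and cos (pi a) to 1 / 2; as the cosine
   decreases, values below the threshold mean x > a. *)
pose T : {poly R} := (1 / 4)%:P * 'X + (1 / 2 - c / 4)%:P.
pose u n x := sn 1 x * ((1 - T ^+ n) ^+ (2 ^ n)).[cos (pi * x)].
pose t x := 1 / 4 * cos (pi * x) + (1 / 2 - c / 4).
have uE n x : u n x = sn 1 x * (1 - (t x) ^+ n) ^+ (2 ^ n).
  have TE : T.[cos (pi * x)] = t x by rewrite /T hornerD hornerM !hornerC hornerX.
  by rewrite /u horner_exp hornerD hornerN hornerC (horner_exp T) TE.
have t01 x : 0 <= t x <= 1.
  rewrite /t /c; have := cos_max (pi * x); have := cos_max (pi * a).
  by rewrite !ler_norml; lra.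
apply: (@sine_closure_dominated _ _ u (fun _ => 1)) => //.
- exact: L2_cst.
- by move=> n; apply: sine_closure_span; apply: sine_span_poly.
- move=> x n _; rewrite uE normrM -[leRHS]mulr1; apply: ler_pM => //; first exact: sin_max.
  have /andP[h0 h1] := threshold_bounds n (t01 x).
  by rewrite ger0_norm.
- move=> x Ix; rewrite normrM -[leRHS]mulr1; apply: ler_pM => //; first exact: sin_max.
  by rewrite indicE; case: (_ \in _); rewrite ?normr1 ?normr0.
exists [set a]; split; [exact: measurable_set1|exact: lebesgue_measure_set1|].
move=> x /= h; apply: contrapT => xa; apply: h => Ix.
have /andP[x0 x1] : 0 < x < 1 by rewrite -I01E.
have pi0 := pi_gt0 R.
have cosE : (t x < 1 / 2) = (a < x).
  have -> : (t x < 1 / 2) = (cos (pi * x) < c) by rewrite /t; apply/idP/idP; lra.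
  rewrite /c ltr_cos ?in_itv /= ?mulr_ge0 ?ltW //; [by rewrite ltr_pM2l| |];
    by rewrite -[ltRHS]mulr1 ltr_pM2l.
rewrite indicE; have [ax|ax] := ltP a x.
  rewrite mem_set /= ?in_itv /= ?ax // mulr1 -[X in _ --> X]mulr1.
  have -> : u ^~ x = (fun n => sn 1 x * (1 - (t x) ^+ n) ^+ (2 ^ n)).
    by apply/funext => n; rewrite uE.
  apply: cvgM; first exact: cvg_cst.
  by apply: cvg_threshold_lt; rewrite cosE ax andbT; case/andP: (t01 x).
rewrite memNset /= ?in_itv /= ?andbT; last by move/(le_lt_trans ax); rewrite ltxx.
have -> : u ^~ x = (fun n => sn 1 x * (1 - (t x) ^+ n) ^+ (2 ^ n)).
  by apply/funext => n; rewrite uE.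
apply: cvgM; first exact: cvg_cst.
apply: cvg_threshold_gt; have /andP[_ ->] := t01 x; rewrite andbT.
rewrite lt_neqAle [1 / 2 <= _]leNgt cosE -leNgt ax andbT; apply/eqP => E.
apply: xa; apply: (mulfI (lt0r_neq0 pi0)).
apply: cos_inj; rewrite ?in_itv /= ?mulr_ge0 ?ltW //.
- by rewrite -[ltRHS]mulr1 ltr_pM2l.
- by rewrite -[ltRHS]mulr1 ltr_pM2l.
by move: E; rewrite /t -/c; lra.
Qed.

(** Dynkin's argument: the rays are stable under intersection and generate the Borel sets, and
    increasing unions pass through by dominated convergence. *)
Lemma sine_closure_indic (A : set R) : measurable (A : set (measurableTypeR R)) ->
  sine_closure (fun x => sn 1 x * \1_A x).
Proof.
pose H (A : set R) := measurable (A : set (measurableTypeR R)) /\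
  sine_closure (fun x => sn 1 x * \1_A x).
suff : <<s @RGenOInfty.G R >> `<=` H.
  move=> h mA; have : (@RGenOInfty.G R).-sigma.-measurable A by rewrite -RGenOInfty.measurableE.
  by move/h => -[].
have lH : lambda_system setT H.
  split => //.
  - split; first exact: measurableT.
    apply: sine_closure_eq (L2_sn1_indic measurableT) sine_closure_sn1 => x _.
    by rewrite indicE mem_set ?mulr1.
  - move=> B C CB [mB HB] [mC HC].
    have mBC : measurable (B `\` C : set (measurableTypeR R)) by exact: measurableD.
    split => //; apply: sine_closure_eq (L2_sn1_indic mBC)
      (sine_closureD HB (sine_closureZ (-1) HC)) => x _.
    rewrite !indicE in_setD; have := CB x.
    case: (boolP (x \in B)); case: (boolP (x \in C)) => //=; rewrite ?mulr0 ?mulr1; try by move=> *; ring.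
    by move=> /set_mem Cx /negP Bx h; case: Bx; apply/mem_set/h.
  - move=> F ndF HF.
    have mF : measurable (\bigcup_i F i : set (measurableTypeR R)).
      by apply: bigcup_measurable => i _; case: (HF i).
    split => //.
    apply: (@sine_closure_dominated _ _ (fun n x => sn 1 x * \1_(F n) x) (fun _ => 1)).
    + exact: L2_cst.
    + exact: L2_sn1_indic.
    + by move=> n; case: (HF n).
    + move=> x n _; rewrite normrM -[leRHS]mulr1; apply: ler_pM => //; first exact: sin_max.
      by rewrite indicE; case: (_ \in _); rewrite ?normr1 ?normr0.
    + move=> x _; rewrite normrM -[leRHS]mulr1; apply: ler_pM => //; first exact: sin_max.
      by rewrite indicE; case: (_ \in _); rewrite ?normr1 ?normr0.
    apply: aeW => x _; apply: cvgM; first exact: cvg_cst.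
    rewrite [X in _ --> X]indicE; case: (boolP (x \in _)) => [/set_mem[N _ FN]|xF].
      apply: (@cvg_trans _ ((fun _ : nat => 1 : R) @ \oo)); last exact: cvg_cst.
      apply: near_eq_cvg; exists N => // n /= Nn; rewrite indicE mem_set //.
      by have /subsetPset := ndF _ _ Nn; apply.
    have -> : (fun n => \1_(F n) x) = (fun _ => 0 : R); last exact: cvg_cst.
    apply/funext => n; rewrite indicE memNset // => Fx; move/negP: xF; apply.
    by apply/mem_set; exists n.
apply: lambda_system_subset lH _ _ => //.
  move=> _ _ [x ->] [y ->]; exists (Num.max x y); apply/seteqP; split => z /=.
    by rewrite !in_itv /= !andbT gt_max => -[-> ->].
  by rewrite !in_itv /= !andbT gt_max => /andP[].
move=> _ [x ->]; split; first exact: measurable_itv.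
exact: sine_closure_ray.
Qed.

Import HBSimple HBNNSimple.

Lemma sine_closure_nnsfun (s : {nnsfun (measurableTypeR R) >-> R}) :
  sine_closure (fun x => sn 1 x * s x).
Proof.
have [m [r sE]] : exists m (r : nat -> R), forall x, s x = \sum_(i < m) r i * \1_(s @^-1` [set r i]) x.
  pose F := finmap.enum_fset (fset_set (s @` setT)).
  by exists (size F), (nth 0 F) => x; exact: (fimfunEord s).
have mA y : measurable (s @^-1` [set y] : set (measurableTypeR R)) by exact: measurable_funPTI.
rewrite (_ : (fun x => _) = (fun x => \sum_(i < m) (r i * (sn 1 x * \1_(s @^-1` [set r i]) x)))); last first.
  by apply/funext => x; rewrite sE mulr_sumr; apply: eq_bigr => i _; rewrite mulrCA.
elim: m {sE} => [|n IH].
  rewrite (_ : (fun x => _) = (fun _ => 0)); first exact: (sine_closure_span (@sine_span0 R)).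
  by apply/funext => x; rewrite big_ord0.
rewrite (_ : (fun x => _) = (fun x => \sum_(i < n) (r i * (sn 1 x * \1_(s @^-1` [set r i]) x)) +
    r n * (sn 1 x * \1_(s @^-1` [set r n]) x))); last first.
  by apply/funext => x; rewrite big_ord_recr.
by apply: sine_closureD => //; apply: sine_closureZ; apply: sine_closure_indic.
Qed.

(** The quotient of [g] by [sn 1] need not be square integrable, but its simple approximations from
    below, multiplied by [sn 1] again, are dominated by [g]. *)
Lemma sine_closure_ge0 g : L2 g -> (forall x, 0 <= g x) -> sine_closure g.
Proof.
move=> Lg g0.
pose h x := ((g x / sn 1 x)%:E : \bar R).
have mh : measurable_fun (I01 : set (measurableTypeR R)) h.
  apply/measurable_EFinP; apply: measurable_funM; first by case: Lg.
  apply: open_continuous_measurable_fun; first exact: interval_open.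
  move=> x /set_mem Ix; have /andP[s0 _] := sn1_bounds Ix.
  by apply: cvgV; [rewrite gt_eqF|exact: continuous_sn].
have h0 x : I01 x -> (0 <= h x)%E.
  by move=> /sn1_bounds /andP[s0 _]; rewrite lee_fin divr_ge0 // ltW.
pose s := nnsfun_approx measurable_I01 mh.
have cs x : I01 x -> (fun n => s n x) @ \oo --> g x / sn 1 x.
  move=> Ix; have := @cvg_nnsfun_approx _ _ _ _ measurable_I01 _ mh h0 x Ix.
  by move/fine_cvg.
have le x n : I01 x -> s n x <= g x / sn 1 x.
  move=> Ix; have cv := cs x Ix; rewrite -(cvg_lim _ cv) //.
  apply: (@nondecreasing_cvgn_le _ (fun n => s n x)); last by apply/cvg_ex; eexists; exact: cv.
  move=> m k mk; have /lefP := nd_nnsfun_approx measurable_I01 mh mk; exact.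
apply: (@sine_closure_dominated _ _ (fun n x => sn 1 x * s n x) g) => //.
- by move=> n; apply: sine_closure_nnsfun.
- move=> x n Ix; have /andP[s0 _] := sn1_bounds Ix.
  rewrite ger0_norm; last by rewrite mulr_ge0 // ltW.
  by rewrite mulrC -ler_pdivlMr // le.
- by move=> x _; rewrite ger0_norm.
apply: aeW => x Ix; have /andP[s0 _] := sn1_bounds Ix.
have -> : g x = sn 1 x * (g x / sn 1 x) by rewrite mulrC divfK // gt_eqF.
by apply: cvgM; [exact: cvg_cst|exact: cs].
Qed.

Theorem sine_dense g : L2 g -> sine_closure g.
Proof.
move=> Lg; have La : L2 (fun x => `|g x|).
  case: Lg => mg hg; split; first exact: measurableT_comp.
  apply: le_lt_trans hg; rewrite le_eqVlt; apply/orP; left; apply/eqP.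
  by apply: eq_integral => x _; rewrite real_normK // num_real.
have Lp : L2 (fun x => 1 / 2 * (`|g x| + g x)) by apply: L2Z; apply: L2D.
have Ln : L2 (fun x => 1 / 2 * (`|g x| - g x)) by apply: L2Z; apply: L2B.
have hp : sine_closure (fun x => 1 / 2 * (`|g x| + g x)).
  apply: sine_closure_ge0 => // x; have := ler_norm (- g x); rewrite normrN; lra.
have hn : sine_closure (fun x => 1 / 2 * (`|g x| - g x)).
  by apply: sine_closure_ge0 => // x; have := ler_norm (g x); lra.
apply: sine_closure_eq Lg (sine_closureD hp (sine_closureZ (-1) hn)) => x _.
by field.
Qed.

End Density.

(** * Fourier coefficients of step functions and their dilations *)

Section StepFunctions.
Context {R : realType}.
Local Notation mu := (@lebesgue_measure R).
Implicit Types (u : R -> R) (w W : nat -> R).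

Definition step_on N W u := forall i, (i < N)%N -> forall x,
  i%:R / N%:R < x < (i.+1)%:R / N%:R -> u x = W i.

Lemma grid_lt N i : (0 < N)%N -> (i%:R / N%:R : R) < (i.+1)%:R / N%:R.
Proof. by move=> N0; rewrite ltr_pM2r ?invr_gt0 ?ltr0n // ltr_nat. Qed.

Lemma measurable_step N W u : (0 < N)%N -> step_on N W u -> measurable_fun I01 u.
Proof.
move=> N0 su.
have main m : (m <= N)%N -> measurable_fun (`]0, (m%:R / N%:R)[ : set R) u.
  elim: m => [|m IH] mN.
    by rewrite mul0r set_itvoo0; exact: measurable_fun_set0.
  have mI : measurable_fun (`]m%:R / N%:R, (m.+1)%:R / N%:R[ : set R) u.
    apply: (eq_measurable_fun (fun _ => W m)); last exact: measurable_cst.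
    by move=> x; rewrite inE /= in_itv /= => h; rewrite (su m).
  have sI : measurable_fun ([set m%:R / N%:R] : set R) u by exact: measurable_fun_set1.
  have := IH (ltnW mN); rewrite leq_eqVlt in mN => IH'.
  pose A : set R := `]0, (m%:R / N%:R)[%classic `|` [set m%:R / N%:R].
  pose B : set R := `]m%:R / N%:R, (m.+1)%:R / N%:R[%classic.
  have m1 : measurable (`]0, (m%:R / N%:R)[%classic : set R) by exact: measurable_itv.
  have m2 : measurable ([set m%:R / N%:R] : set R) by exact: measurable_set1.
  have mA : measurable A by exact: measurableU.
  have mB : measurable B by exact: measurable_itv.
  have hA : measurable_fun A u by apply/(measurable_funU u m1 m2).
  have h : measurable_fun (A `|` B) u by apply/(measurable_funU u mA mB).
  apply: measurable_funS h; first exact: measurableU.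
  move=> x /=; rewrite !in_itv /= => /andP[x0 x1].
  have [xm|xm|->] := ltgtP x (m%:R / N%:R).
  - by left; left; rewrite /= in_itv /= x0.
  - by right; rewrite /B /= in_itv /= xm.
  - by left; right.
by have := main N (leqnn N); rewrite divff // pnatr_eq0 -lt0n.
Qed.

Lemma step_integral N W u v (V : nat -> R) : (0 < N)%N -> step_on N W u -> L2 u -> L2 v ->
  (forall i, (i < N)%N -> \int[mu]_(x in `]i%:R / N%:R, (i.+1)%:R / N%:R[) v x = V i) ->
  ip u v = \sum_(i < N) W i * V i.
Proof.
move=> N0 su Lu Lv HV.
have iuv := L2_integrableM Lu Lv.
have iv : mu.-integrable I01 (EFin \o v).
  have := L2_integrableM Lv (@L2_cst R 1); apply: eq_integrable; first exact: measurable_I01.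
  by move=> x _ /=; rewrite mulr1.
have le01 m : (m <= N)%N -> m%:R / N%:R <= 1 :> R.
  by move=> mN; rewrite ler_pdivrMr ?ltr0n // mul1r ler_nat.
have sub m : (m <= N)%N -> (`]0, (m%:R / N%:R)[ : set R) `<=` I01.
  move=> mN x /=; rewrite in_itv /= => /andP[x0 xm]; rewrite I01E x0.
  exact: lt_le_trans xm (le01 m mN).
have main m : (m <= N)%N ->
  \int[mu]_(x in `]0, (m%:R / N%:R)[) (u x * v x) = \sum_(i < m) W i * V i.
  elim: m => [|m IH] mN; first by rewrite mul0r set_itvoo0 Rintegral_set0 big_ord0.
  rewrite big_ord_recr /= -IH ?(ltnW mN) //.
  have i1 : mu.-integrable (`]0, ((m.+1)%:R / N%:R)[ : set R) (EFin \o (fun x => u x * v x)).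
    apply: integrableS iuv; [exact: measurable_I01|exact: measurable_itv|exact: sub].
  have m0 : 0 <= m%:R / N%:R :> R by rewrite divr_ge0.
  have := @Rintegral_itvB R _ (BRight 0) (BLeft ((m.+1)%:R / N%:R)) (m%:R / N%:R) i1.
  rewrite !bnd_simp => /(_ m0 (grid_lt m N0)) /eqP; rewrite subr_eq => /eqP ->.
  rewrite [RHS]addrC; congr (_ + _); last first.
    rewrite Rintegral_itv_bndo_bndc //.
    apply: integrableS iuv; [exact: measurable_I01|exact: measurable_itv|].
    exact: sub (ltnW mN).
  rewrite -HV // -RintegralZl; [|exact: measurable_itv|].
    apply: eq_Rintegral => x; rewrite inE /= in_itv /= => h.
    by rewrite (su m).
  apply: integrableS iv; [exact: measurable_I01|exact: measurable_itv|].
  move=> x /=; rewrite in_itv /= => /andP[h1 h2]; rewrite I01E (le_lt_trans m0 h1) /=.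
  exact: lt_le_trans h2 (le01 m.+1 mN).
by have := main N (leqnn N); rewrite divff // pnatr_eq0 -lt0n.
Qed.

Lemma step_ip_sn N W u n : (0 < N)%N -> (0 < n)%N -> step_on N W u -> L2 u ->
  ip u (sn n) = (n%:R * pi)^-1 * \sum_(i < N) W i *
    (cos (n%:R * pi * (i%:R / N%:R)) - cos (n%:R * pi * ((i.+1)%:R / N%:R))).
Proof.
move=> N0 n0 su Lu.
rewrite (step_integral (V := fun i => (cos (n%:R * pi * (i%:R / N%:R)) -
  cos (n%:R * pi * ((i.+1)%:R / N%:R))) / (n%:R * pi)) N0 su Lu (L2_sn n)).
  by rewrite mulr_sumr; apply: eq_bigr => i _; rewrite mulrA mulrC.
by move=> i iN; rewrite integral_sn // grid_lt.
Qed.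

End StepFunctions.

Section OddExtension.
Context {R : realType}.
Variables (q : nat) (w : nat -> R).
Hypothesis q_gt0 : (0 < q)%N.

(* values on the grid 1/q of the odd 2-periodic extension of the step function w *)
Definition oddext_steps (i : nat) : R :=
  let r := (i %% (2 * q))%N in if (r < q)%N then w r else - w (2 * q - r.+1)%N.

Lemma oddext_steps_mod i : oddext_steps (i %% (2 * q)) = oddext_steps i.
Proof. by rewrite /oddext_steps modn_mod. Qed.

Lemma oddext_stepsD i k : oddext_steps (i + 2 * q * k) = oddext_steps i.
Proof. by rewrite -oddext_steps_mod addnC mulnC modnMDl oddext_steps_mod. Qed.

Lemma step_oddext phi k : (0 < k)%N -> step_on q w phi ->
  step_on (q * k) oddext_steps (fun x => oddext phi (k%:R * x)).
Proof.
move=> k0 sp i iN x /andP[h1 h2].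
have q0 : (0 : R) < q%:R by rewrite ltr0n.
have kp : (0 : R) < k%:R by rewrite ltr0n.
set y := k%:R * x.
have y1 : i%:R / q%:R < y.
  rewrite /y -(ltr_pM2l kp) in h1 *; apply: le_lt_trans h1; rewrite natrM.
  by rewrite le_eqVlt; apply/orP; left; apply/eqP; field; rewrite !gt_eqF.
have y2 : y < (i.+1)%:R / q%:R.
  rewrite /y -(ltr_pM2l kp) in h2 *; apply: lt_le_trans h2 _; rewrite natrM.
  by rewrite le_eqVlt; apply/orP; left; apply/eqP; field; rewrite !gt_eqF.
rewrite /oddext_steps; set r := (i %% (2 * q))%N; pose m := (i %/ (2 * q))%N.
have iE : (i = m * (2 * q) + r)%N by exact: divn_eq.
have rq : (r < 2 * q)%N by rewrite ltn_mod muln_gt0.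
have y1' : r%:R / q%:R < y - 2 * m%:R.
  rewrite ltrBrDr; apply: le_lt_trans y1; rewrite iE natrD !natrM.
  by rewrite le_eqVlt; apply/orP; left; apply/eqP; field; rewrite gt_eqF.
have y2' : y - 2 * m%:R < (r.+1)%:R / q%:R.
  rewrite ltrBlDr; apply: lt_le_trans y2 _; rewrite iE -addnS natrD !natrM.
  by rewrite le_eqVlt; apply/orP; left; apply/eqP; field; rewrite gt_eqF.
have r0 : 0 <= r%:R / q%:R :> R by rewrite divr_ge0.
have r2 : (r.+1)%:R / q%:R <= 2 :> R by rewrite ler_pdivrMr // -natrM ler_nat.
have fl : Num.floor (y / 2) = m.
  apply: floor_def; rewrite -[(m + 1)%:~R]/((m + 1)%:~R).
  have -> : ((Posz m + 1)%:~R : R) = m%:R + 1 by rewrite intrD.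
  rewrite -[((Posz m)%:~R : R)]/(m%:R).
  by apply/andP; split; lra.
rewrite /oddext fl -[((Posz m)%:~R : R)]/(m%:R).
case: (ltnP r q) => rq2.
  have rq3 : (r.+1)%:R / q%:R <= 1 :> R by rewrite ler_pdivrMr // mul1r ler_nat.
  rewrite (le_lt_trans r0 y1') (lt_le_trans y2' rq3) /=.
  by apply: (sp r rq2); rewrite y1' y2'.
(* On the second half-period the reflection y to 2 - y carries the cell [r] onto the cell 2 q - r -
   1, its endpoints being exchanged. *)
have rq3 : 1 <= r%:R / q%:R :> R by rewrite ler_pdivlMr // mul1r ler_nat.
have y3 := le_lt_trans rq3 y1'.
rewrite (lt_gtF y3) andbF y3; congr (- _); apply: sp.
  by move: rq rq2; clearbody r; clear; lia.
have e : (2 * q - r.+1)%:R / q%:R = 2 - (r.+1)%:R / q%:R :> R.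
  by rewrite natrB // natrM; field; rewrite gt_eqF.
have -> : (2 * q - r.+1).+1 = (2 * q - r)%N by rewrite -subSn // subSS.
have -> : (2 * q - r)%:R / q%:R = 2 - r%:R / q%:R :> R.
  by rewrite natrB ?(ltnW rq) // natrM; field; rewrite gt_eqF.
by rewrite e; apply/andP; split; lra.
Qed.

(** The index [i + 2 * q - 1] is the cyclic predecessor of [i], free of truncation at 0. *)
Definition jump (i : nat) : R := oddext_steps i - oddext_steps (i + 2 * q - 1).

(** Divided by [m], this is the m-th Fourier sine coefficient, twice the integral against [sn m].
    Without the division it depends only on [m] modulo 2 q. *)
Definition fcoef (m : nat) : R :=
  pi^-1 * \sum_(i < 2 * q) jump i * cos (m%:R * pi * (i%:R / q%:R)).

Lemma sum_cos_shift k n (A : R) : (0 < k)%N ->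
  \sum_(j < k) cos (A + 2 * pi * (n * j)%:R / k%:R) = if (k %| n)%N then k%:R * cos A else 0.
Proof.
move=> k0.
have -> : \sum_(j < k) cos (A + 2 * pi * (n * j)%:R / k%:R) =
   complex.Re (expi A * \sum_(j < k) uroot k ^+ (n * j)).
  rewrite mulr_sumr Re_sum; apply: eq_bigr => j _.
  rewrite /uroot -expiMn -expiD /=; congr (cos (_ + _)).
  by rewrite -(mulr_natr (2 * pi / _)); ring.
rewrite sum_uroot //; case: ifP => _; last by rewrite mulr0.
have -> : (k%:R : R[i]) = ((k%:R : R)%:C)%C by rewrite rmorph_nat.
by rewrite mulrC ReRM.
Qed.

Lemma oddext_steps_anti N i : (2 * q %| N)%N -> (i < N)%N ->
  oddext_steps (N - i.+1) = - oddext_steps i.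
Proof.
move=> /dvdnP[m ->] iN; rewrite /oddext_steps.
have E : ((m * (2 * q) - i.+1) %% (2 * q) = 2 * q - (i %% (2 * q)).+1)%N.
  have rq : (i %% (2 * q) < 2 * q)%N by rewrite ltn_mod muln_gt0.
  have dm : (i %/ (2 * q) < m)%N by rewrite ltn_divLR // muln_gt0.
  have -> : (m * (2 * q) - i.+1 = (m - (i %/ (2 * q)).+1) * (2 * q) + (2 * q - (i %% (2 * q)).+1))%N.
    rewrite {1}(divn_eq i (2 * q)) mulnBl -addnS.
    have : ((i %/ (2 * q)).+1 * (2 * q) <= m * (2 * q))%N by rewrite leq_mul2r dm orbT.
    by rewrite mulSn; lia.
  by rewrite modnMDl modn_small //; lia.
rewrite E; set r := (i %% (2 * q))%N.
have rq : (r < 2 * q)%N by rewrite ltn_mod muln_gt0.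
case: (ltnP r q) => h; last first.
  by rewrite (_ : (2 * q - r.+1 < q)%N) ?opprK //; lia.
rewrite (_ : (2 * q - r.+1 < q)%N = false); last by lia.
by rewrite (_ : (2 * q - (2 * q - r.+1).+1 = r)%N) //; lia.
Qed.

End OddExtension.

Lemma sum_periodic_shift (A : zmodType) (G : nat -> A) N : G N = G 0%N ->
  \sum_(i < N) G i.+1 = \sum_(i < N) G i.
Proof.
case: N => [|N] GN; first by rewrite !big_ord0.
rewrite big_ord_recr /= GN [RHS]big_ord_recl /= addrC; congr (_ + _).
Qed.

Lemma sum_blocks (A : zmodType) (G : nat -> A) P k :
  \sum_(i < P * k) G i = \sum_(i < P) \sum_(j < k) G (i + P * j)%N.
Proof.
elim: k => [|k IH].
  by rewrite muln0 big_ord0 big1 // => i _; rewrite big_ord0.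
under [RHS]eq_bigr do rewrite big_ord_recr /=.
rewrite big_split /= -IH mulnS addnC big_split_ord /=; congr (_ + _).
by apply: eq_bigr => i _; rewrite addnC.
Qed.

(** * Sine coefficients of dilations and recovery of the jumps *)

Section Coefficients.
Context {R : realType}.
Variables (q : nat) (w : nat -> R).
Hypothesis q_gt0 : (0 < q)%N.
Local Notation W := (oddext_steps q w).
Local Notation e := (jump q w).
Local Notation f := (fcoef q w).

Lemma grid_size_neq0 : (q%:R : R) != 0.
Proof. by rewrite pnatr_eq0 -lt0n. Qed.

Lemma pi_neq0 : (pi : R) != 0.
Proof. by rewrite gt_eqF // pi_gt0. Qed.

(** Oddness of the steps and evenness of the cosines double the half-period to a full one; summation
    by parts, without boundary terms by periodicity, then moves the differences to the steps. *)
Lemma abel_half_period k n : (0 < k)%N ->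
  let c i := cos (n%:R * pi * (i%:R / (q * k)%:R) : R) in
  2 * \sum_(i < q * k) W i * (c i - c i.+1) = \sum_(i < 2 * q * k) e i * c i.
Proof.
move=> k0 c; set N := (q * k)%N.
have N0 : (0 < N)%N by rewrite muln_gt0 q_gt0.
have NR : (N%:R : R) != 0 by rewrite pnatr_eq0 -lt0n.
have N2 : (2 * q * k = 2 * N)%N by rewrite /N mulnA.
have dN : (2 * q %| 2 * N)%N by rewrite -N2 dvdn_mulr.
have csym i : (i <= 2 * N)%N -> c (2 * N - i)%N = c i.
  move=> iN; rewrite /c natrB // natrM.
  have -> : n%:R * pi * ((2 * N%:R - i%:R) / N%:R) = - (n%:R * pi * (i%:R / N%:R)) + (2 * n)%:R * pi :> R.
    by rewrite natrM; field.
  by rewrite cos_2natpi cosN.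
have half : \sum_(i < 2 * N) W i * (c i - c i.+1) = 2 * \sum_(i < N) W i * (c i - c i.+1).
  rewrite mul2n -addnn big_split_ord /= [in RHS]mulr_natl mulr2n; congr (_ + _).
  rewrite (reindex_inj rev_ord_inj) /=; apply: eq_bigr => i _.
  have -> : (N + (N - i.+1) = 2 * N - i.+1)%N by rewrite mul2n -addnn addnBA.
  have -> : (2 * N - i.+1).+1 = (2 * N - i)%N by have := ltn_ord i; lia.
  rewrite !csym; try by have := ltn_ord i; lia.
  by rewrite (oddext_steps_anti w q_gt0 dN); [ring|have := ltn_ord i; lia].
rewrite -half N2.
under eq_bigr do rewrite mulrBr; rewrite sumrB.
pose G i := W (i + 2 * q - 1)%N * c i.
have -> : \sum_(i < 2 * N) W i * c i.+1 = \sum_(i < 2 * N) G i.+1.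
  apply: eq_bigr => i _; rewrite /G; congr (_ * _).
  by rewrite addSn subn1 /= -[in RHS](muln1 (2 * q)%N) oddext_stepsD.
rewrite sum_periodic_shift; last first.
  rewrite /G; congr (_ * _); last by rewrite -(csym 0%N) // subn0.
  have -> : (2 * N + 2 * q - 1 = (2 * q - 1) + 2 * q * k)%N by rewrite -N2; have := q_gt0; lia.
  by rewrite oddext_stepsD.
rewrite -sumrB; apply: eq_bigr => i _; rewrite /G /jump mulrBl //.
Qed.

(** The grid of step 1 / (q k) carries k copies of one period of jumps, and the cosines summed over
    the copies cancel unless k divides n. Dilation by k thus acts on coefficients as the shift from
    n to k n. *)
Lemma coef_oddext phi k n : (0 < k)%N -> (0 < n)%N -> step_on q w phi ->
  L2 (fun x => oddext phi (k%:R * x)) ->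
  ip (fun x => oddext phi (k%:R * x)) (sn n) =
  if (k %| n)%N then 1 / 2 * (f (n %/ k) / (n %/ k)%:R) else 0.
Proof.
move=> k0 n0 sp Lp.
have qk0 : (0 < q * k)%N by rewrite muln_gt0 q_gt0.
rewrite (step_ip_sn qk0 n0 (step_oddext q_gt0 k0 sp) Lp).
have nR : (n%:R : R) != 0 by rewrite pnatr_eq0 -lt0n.
have kR : (k%:R : R) != 0 by rewrite pnatr_eq0 -lt0n.
have := @abel_half_period k n k0; rewrite /=; set S := \sum_(i < q * k) _ => E.
have -> : S = 1 / 2 * \sum_(i < 2 * q * k) e i * cos (n%:R * pi * (i%:R / (q * k)%:R)).
  by rewrite -E; field.
rewrite (sum_blocks (fun i => e i * cos (n%:R * pi * (i%:R / (q * k)%:R))) (2 * q) k).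
have eP i j : e (i + 2 * q * j)%N = e i.
  rewrite /jump oddext_stepsD; congr (_ - _).
  have -> : (i + 2 * q * j + 2 * q - 1 = (i + 2 * q - 1) + 2 * q * j)%N by have := q_gt0; lia.
  by rewrite oddext_stepsD.
have inner i : \sum_(j < k) e (i + 2 * q * j)%N * cos (n%:R * pi * ((i + 2 * q * j)%:R / (q * k)%:R)) =
   e i * (if (k %| n)%N then k%:R * cos (n%:R * pi * (i%:R / (q * k)%:R)) else 0).
  rewrite -sum_cos_shift // mulr_sumr; apply: eq_bigr => j _; rewrite eP; congr (_ * cos _).
  by rewrite !(natrD, natrM); field; rewrite grid_size_neq0 kR.
under eq_bigr do rewrite inner.
case: ifP => [/dvdnP[m nE]|_]; last first.
  by rewrite big1 ?mulr0 // => i _; rewrite mulr0.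
have m0 : (0 < m)%N by move: n0; rewrite nE muln_gt0 => /andP[].
have mR : (m%:R : R) != 0 by rewrite pnatr_eq0 -lt0n.
rewrite nE mulnK // /fcoef.
have -> : \sum_(i < 2 * q) e i * (k%:R * cos ((m * k)%:R * pi * (i%:R / (q * k)%:R))) =
   k%:R * \sum_(i < 2 * q) e i * cos (m%:R * pi * (i%:R / q%:R)).
  rewrite mulr_sumr; apply: eq_bigr => i _; rewrite mulrCA; congr (_ * (_ * cos _)).
  by rewrite !natrM; field; rewrite grid_size_neq0 kR.
move: pi_neq0; move: (pi : R) => P P0.
by rewrite natrM; field; rewrite mR P0 kR.
Qed.

Lemma cos_grid_mod m i : cos (m%:R * pi * ((i %% (2 * q))%:R / q%:R)) =
  cos (m%:R * pi * (i%:R / q%:R)) :> R.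
Proof.
rewrite [in RHS](divn_eq i (2 * q)) natrD !natrM.
have -> : m%:R * pi * (((i %/ (2 * q))%:R * (2 * q%:R) + (i %% (2 * q))%:R) / q%:R) =
  m%:R * pi * ((i %% (2 * q))%:R / q%:R) + (2 * (m * (i %/ (2 * q))))%:R * pi :> R.
  by rewrite !natrM; field; exact: grid_size_neq0.
by rewrite cos_2natpi.
Qed.

Lemma cos_grid_swap m i : cos (m%:R * pi * (i%:R / q%:R)) = cos (i%:R * pi * (m%:R / q%:R)) :> R.
Proof. by congr cos; field; exact: grid_size_neq0. Qed.

Lemma fcoef_periodic m : f (m %% (2 * q)) = f m.
Proof.
rewrite /fcoef; congr (_ * _); apply: eq_bigr => i _; congr (_ * _).
by rewrite cos_grid_swap cos_grid_mod cos_grid_swap.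
Qed.

Lemma jump_mod i : e (i %% (2 * q)) = e i.
Proof.
rewrite /jump oddext_steps_mod; congr (_ - _).
rewrite -[LHS]oddext_steps_mod -[RHS]oddext_steps_mod; congr (W _).
have q2 : (0 < 2 * q)%N by rewrite muln_gt0.
by rewrite -(addnBA (i %% (2 * q)) q2) -(addnBA i q2) modnDml.
Qed.

Lemma jump_even i : (i <= 2 * q)%N -> e (2 * q - i) = e i.
Proof.
move=> iq; have d2 : (2 * q %| 2 * q)%N by [].
have q2 : (0 < 2 * q)%N by rewrite muln_gt0.
have [->|i0] := posnP i.
  by rewrite subn0 -jump_mod modnn.
have [->|iN] := eqVneq i (2 * q)%N; first by rewrite subnn -[RHS]jump_mod modnn.
have {}iN : (i < 2 * q)%N by rewrite ltn_neqAle iN.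
rewrite /jump.
have -> : (2 * q - i = 2 * q - i.-1.+1)%N by rewrite prednK.
rewrite oddext_steps_anti //; last by lia.
have -> : (2 * q - i.-1.+1 + 2 * q - 1 = (2 * q - i.+1) + 2 * q * 1)%N by lia.
rewrite oddext_stepsD oddext_steps_anti //.
have -> : (i + 2 * q - 1 = i.-1 + 2 * q * 1)%N by lia.
by rewrite oddext_stepsD; ring.
Qed.

Lemma sum_cos_grid j : \sum_(m < 2 * q) cos (m%:R * pi * (j%:R / q%:R)) =
  if (2 * q %| j)%N then (2 * q)%:R else 0 :> R.
Proof.
have q2 : (0 < 2 * q)%N by rewrite muln_gt0.
have := sum_cos_shift (R := R) j 0 q2; rewrite cos0 mulr1 => <-.
apply: eq_bigr => m _; congr cos; rewrite add0r !natrM.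
by field; exact: grid_size_neq0.
Qed.

(** Orthogonality leaves the contributions of the indices j and -j, which agree because the jumps
    are even. *)
Lemma fourier_inversion j : (j < 2 * q)%N ->
  \sum_(m < 2 * q) f m * cos (m%:R * pi * (j%:R / q%:R)) = 2 * q%:R / pi * e j.
Proof.
move=> jq; have q2 : (0 < 2 * q)%N by rewrite muln_gt0.
transitivity (pi^-1 * \sum_(i < 2 * q) e i * (1 / 2 *
   (\sum_(m < 2 * q) cos (m%:R * pi * ((i + j)%:R / q%:R)) +
    \sum_(m < 2 * q) cos (m%:R * pi * ((i + (2 * q - j))%:R / q%:R))))).
  have fE m : f m * cos (m%:R * pi * (j%:R / q%:R)) = pi^-1 * \sum_(i < 2 * q)
      e i * cos (m%:R * pi * (i%:R / q%:R)) * cos (m%:R * pi * (j%:R / q%:R)).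
    by rewrite /fcoef -[LHS]mulrA; congr (_ * _); rewrite big_distrl.
  under eq_bigr do rewrite fE.
  rewrite -mulr_sumr exchange_big /=; congr (_ * _); apply: eq_bigr => i _.
  rewrite -big_split /= !mulr_sumr; apply: eq_bigr => m _.
  rewrite -mulrA; congr (_ * _).
  have -> : cos (m%:R * pi * ((i + (2 * q - j))%:R / q%:R)) =
    cos (m%:R * pi * (i%:R / q%:R) - m%:R * pi * (j%:R / q%:R)) :> R.
    rewrite -[RHS](cos_2natpi m); congr cos; rewrite natrD natrB ?(ltnW jq) // !natrM.
    by field; exact: grid_size_neq0.
  have -> : m%:R * pi * ((i + j)%:R / q%:R) = m%:R * pi * (i%:R / q%:R) + m%:R * pi * (j%:R / q%:R) :> R.
    by rewrite natrD; field; exact: grid_size_neq0.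
  by rewrite cosB cosD; field.
under eq_bigr do rewrite !sum_cos_grid mulrDr mulrDr.
rewrite big_split /=.
have jr : ((2 * q - j) %% (2 * q) < 2 * q)%N by rewrite ltn_mod.
rewrite [X in _ * (X + _)](bigD1 (Ordinal jr)) //= big1 ?addr0; last first.
  move=> i; rewrite -val_eqE /= => ij; case: ifP => [/dvdnP[k ek]|_]; last by rewrite !mulr0.
  case/eqP: ij; have := ltn_ord i => iq.
  have : (k < 2)%N by rewrite -(ltn_pmul2r q2) -ek; lia.
  case: k ek => [|[|//]] ek _.
    have -> : j = 0%N by lia.
    by rewrite subn0 modnn; lia.
  by rewrite modn_small; lia.
rewrite [X in _ * (_ + X)](bigD1 (Ordinal jq)) //= big1 ?addr0; last first.
  move=> i; rewrite -val_eqE /= => ij; case: ifP => [/dvdnP[k ek]|_]; last by rewrite !mulr0.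
  case/eqP: ij; have := ltn_ord i => iq.
  have : (k < 2)%N by rewrite -(ltn_pmul2r q2) -ek; lia.
  by case: k ek => [|[|//]] ek _; lia.
have -> : (2 * q %| (2 * q - j) %% (2 * q) + j)%N.
  rewrite /dvdn modnDml subnK ?modnn //; exact: ltnW.
have -> : (2 * q %| j + (2 * q - j))%N by rewrite subnKC // ltnW.
rewrite jump_mod jump_even ?(ltnW jq) // natrM.
by move: pi_neq0; move: (pi : R) => P P0; field.
Qed.

(** Multiplication by the unit [a] permutes the residues and moves [a] from the jump index to the
    frequency; [t] is its own inverse. *)
Lemma jump_quasi_invariant a (t : R) : coprime a (2 * q) -> t ^+ 2 = 1 ->
  (forall m, f (a * m) = t * f m) -> forall j, e (a * j) = t * e j.
Proof.
move=> ca t1 H j; have q2 : (0 < 2 * q)%N by rewrite muln_gt0.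
rewrite -jump_mod -(jump_mod j).
have l1 : ((a * j) %% (2 * q) < 2 * q)%N by rewrite ltn_mod.
have l2 : (j %% (2 * q) < 2 * q)%N by rewrite ltn_mod.
have c0 : 2 * q%:R / pi != 0 :> R by rewrite !mulf_neq0 ?invr_neq0 ?pi_neq0 ?grid_size_neq0.
apply: (mulfI c0); rewrite mulrCA -!fourier_inversion // mulr_sumr.
pose s (m : 'I_(2 * q)) : 'I_(2 * q) := Ordinal (ltn_pmod (a * m) q2).
have sinj : injective s.
  move=> m m' /(congr1 val) /= /eqP h; apply: val_inj => /=.
  wlog mm : m m' h / (m' <= m)%N.
    by move=> W; case: (leqP m' m) => c; [exact: W|apply/esym/W; rewrite ?(ltnW c) 1?eq_sym].
  move: h; rewrite eqn_mod_dvd ?leq_mul2l ?mm ?orbT // -mulnBr Gauss_dvdr; last by rewrite coprime_sym.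
  by have := ltn_ord m; case: (posnP (m - m')) => [|h0 h1 /(dvdn_leq h0)]; lia.
rewrite [RHS](reindex_inj sinj) /=; apply: eq_bigr => m _.
rewrite fcoef_periodic H -[t * f m * _]mulrA [RHS]mulrA -expr2 t1 mul1r; congr (_ * _).
rewrite !cos_grid_mod [RHS]cos_grid_swap cos_grid_mod.
by congr cos; rewrite !natrM; field; exact: grid_size_neq0.
Qed.

End Coefficients.

(** * Cyclicity in coefficients and in L2 *)

Section DirichletSpan.
Context {R : realType}.
Implicit Types (a b c : nat -> R).

Definition dspan a b := exists n0 c, forall m, (0 < m)%N -> b m = dconv n0 c a m.

Definition dclosure a b := forall e, 0 < e -> exists2 b', dspan a b' &
  forall N, \sum_(1 <= m < N.+1) (b m - b' m) ^+ 2 <= e.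

(** Multiplication of the Dirichlet series by j^(-s); an isometry of l2 for positive [j]. *)
Definition dshift j b m := if (j %| m)%N then b (m %/ j)%N else 0.

Lemma dconv_widen n0 n1 c a m : (n0 <= n1)%N ->
  dconv n0 c a m = dconv n1 (fun k => if (k <= n0)%N then c k else 0) a m.
Proof.
move=> h; rewrite /dconv [RHS]big_mkcond [RHS](big_cat_nat (n := n0.+1)) //=.
rewrite [X in _ = _ + X]big1_seq ?addr0; last first.
  move=> k /andP[_]; rewrite mem_index_iota => /andP[nk _].
  by rewrite leqNgt nk mul0r if_same.
rewrite big_mkcond; apply: eq_big_nat => k /andP[_ kn].
by rewrite -ltnS kn.
Qed.

Lemma dspan_self a : dspan a a.
Proof.
exists 1%N, (fun _ => 1) => m m0; rewrite /dconv big_mkcond big_nat1 /= dvd1n divn1.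
by rewrite mul1r.
Qed.

Lemma eq_dspan a b b' : (forall m, (0 < m)%N -> b m = b' m) -> dspan a b -> dspan a b'.
Proof. by move=> E [n0 [c H]]; exists n0, c => m m0; rewrite -E // H. Qed.

Lemma dspanD a b b' : dspan a b -> dspan a b' -> dspan a (fun m => b m + b' m).
Proof.
move=> [n [c H]] [n' [c' H']].
exists (maxn n n'), (fun k => (if (k <= n)%N then c k else 0) + (if (k <= n')%N then c' k else 0)).
move=> m m0; rewrite H // H' // (dconv_widen c a m (leq_maxl n n')).
rewrite (dconv_widen c' a m (leq_maxr n n')) /dconv -big_split /=.
by apply: eq_bigr => k _; rewrite mulrDl.
Qed.

Lemma dspanZ x a b : dspan a b -> dspan a (fun m => x * b m).
Proof.
move=> [n [c H]]; exists n, (fun k => x * c k) => m m0; rewrite H // /dconv mulr_sumr.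
by apply: eq_bigr => k _; rewrite mulrA.
Qed.

Lemma dspan_sum a (s : seq nat) (F : nat -> nat -> R) :
  (forall i, dspan a (F i)) -> dspan a (fun m => \sum_(i <- s) F i m).
Proof.
move=> H; elim: s => [|i s IH].
  by apply: eq_dspan (dspanZ 0 (dspan_self a)) => m _; rewrite big_nil mul0r.
by apply: eq_dspan (dspanD (H i) IH) => m _; rewrite big_cons.
Qed.

Lemma dspan_shift j a b : (0 < j)%N -> dspan a b -> dspan a (dshift j b).
Proof.
move=> j0 [n [c H]]; exists (j * n)%N, (dshift j c) => m m0.
transitivity (\sum_(1 <= k < (j * n).+1 | (j %| k)%N)
    if (k %| m)%N then c (k %/ j)%N * a (m %/ k)%N else 0); last first.
  rewrite /dconv big_mkcond [RHS]big_mkcond; apply: eq_bigr => k _.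
  by rewrite /dshift; case: (j %| k)%N; case: (k %| m)%N; rewrite ?mul0r.
rewrite sum_multiples // mulKn // /dshift.
case: ifP => [/dvdnP[m' mE]|jm]; last first.
  rewrite big1 // => i _; case: ifP => // h.
  by rewrite (dvdn_trans _ h) ?dvdn_mulr in jm.
have m'0 : (0 < m')%N by move: m0; rewrite mE muln_gt0 => /andP[].
rewrite mE mulnK // H // /dconv big_mkcond; apply: eq_bigr => i _.
by rewrite [(m' * j)%N]mulnC dvdn_pmul2l // divnMl // mulKn.
Qed.

Lemma dclosureD a b b' : dclosure a b -> dclosure a b' -> dclosure a (fun m => b m + b' m).
Proof.
move=> H H' e e0; have e4 : 0 < e / 4 by lra.
have [u su hu] := H _ e4; have [v sv hv] := H' _ e4.
exists (fun m => u m + v m); first exact: dspanD.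
move=> N; apply: (@le_trans _ _ (2 * (\sum_(1 <= m < N.+1) (b m - u m) ^+ 2) +
   2 * (\sum_(1 <= m < N.+1) (b' m - v m) ^+ 2))).
  rewrite !mulr_sumr -big_split /=; apply: ler_sum => m _.
  have := sqr_ge0 ((b m - u m) - (b' m - v m)); nra.
by have := hu N; have := hv N; lra.
Qed.

Lemma dclosureZ x a b : dclosure a b -> dclosure a (fun m => x * b m).
Proof.
move=> H e e0; have x0 : 0 < x ^+ 2 + 1 by have := sqr_ge0 x; lra.
have [u su hu] := H _ (divr_gt0 e0 x0).
exists (fun m => x * u m); first exact: dspanZ.
move=> N; under eq_bigr do rewrite -mulrBr exprMn.
rewrite -mulr_sumr; have := hu N; rewrite ler_pdivlMr // => h.
have : 0 <= \sum_(1 <= m < N.+1) (b m - u m) ^+ 2 by apply: sumr_ge0 => m _; exact: sqr_ge0.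
by nra.
Qed.

Lemma dclosure_shift j a b : (0 < j)%N -> dclosure a b -> dclosure a (dshift j b).
Proof.
move=> j0 H e e0; have [u su hu] := H _ e0.
exists (dshift j u); first exact: dspan_shift.
move=> N; apply: le_trans (hu (N %/ j)%N); rewrite le_eqVlt; apply/orP; left; apply/eqP.
transitivity (\sum_(1 <= m < N.+1 | (j %| m)%N) (b (m %/ j)%N - u (m %/ j)%N) ^+ 2).
  rewrite [RHS]big_mkcond; apply: eq_bigr => m _; rewrite /dshift.
  by case: ifP => // _; rewrite subrr expr0n.
by rewrite sum_multiples //; apply: eq_bigr => m _; rewrite mulKn.
Qed.

(** A finite sequence is a combination of shifts of the unit, and the closure is stable under
    shifts. *)
Lemma dclosure_finite a N d : dclosure a (fun m => (m == 1%N)%:R) ->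
  dclosure a (fun m => if (0 < m <= N)%N then d m else 0).
Proof.
move=> H.
have H0 : dclosure a (fun _ => 0).
  by move=> e e0; have [u su hu] := dclosureZ 0 H e0; exists u => // M; have := hu M; under eq_bigr do rewrite mul0r.
elim: N => [|N IH].
  move=> e e0; have [u su hu] := H0 e e0; exists u => // M; have := hu M.
  by congr (_ <= _); apply: eq_bigr => m _; case: m.
have D := dclosureD IH (dclosureZ (d N.+1) (dclosure_shift (ltn0Sn N) H)).
move=> e e0; have [u su hu] := D e e0; exists u => // M; have := hu M.
congr (_ <= _); apply: eq_big_nat => m /andP[m0 _]; congr ((_ - _) ^+ 2).
rewrite m0 /= /dshift; case: (ltngtP m N.+1) => mN.
- rewrite -ltnS mN gtnNdvd ?mulr0 ?addr0 //.
- rewrite leqNgt ltnW //= add0r; case: ifP => [/dvdnP[k kE]|_]; last by rewrite mulr0.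
  rewrite kE mulnK // gtn_eqF ?mulr0 //.
  by case: k kE => [|[|k]] //; rewrite ?mul0n ?mul1n => E; rewrite E ?ltnn in m0 mN.
- by rewrite mN ltnn /= dvdnn divnn /= mulr1 add0r.
Qed.

End DirichletSpan.

Section Dilations.
Context {R : realType}.
Variables (q : nat) (w : nat -> R) (phi : R -> R) (B : R).
Hypotheses (q_gt0 : (0 < q)%N) (sp : step_on q w phi) (phiB : forall x, `|phi x| <= B).
Local Notation f := (fcoef q w).
Let a n := f n / n%:R.

Lemma L2_dilate k : L2 (fun x => oddext phi (k%:R * x)).
Proof.
have [->|k0] := posnP k.
  rewrite (_ : (fun x => _) = (fun _ => oddext phi 0)); first exact: L2_cst.
  by apply/funext => x; rewrite mul0r.
apply: (L2_bounded (B := B)).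
  by apply: measurable_step (step_oddext q_gt0 k0 sp); rewrite muln_gt0 q_gt0.
move=> x _; rewrite /oddext; case: ifP => _ //; case: ifP => _; first by rewrite normrN.
by rewrite normr0 (le_trans _ (phiB 0)).
Qed.

Definition dilate_sum n c x := \sum_(1 <= k < n.+1) c k * oddext phi (k%:R * x).

Lemma L2_dilate_sum n c : L2 (dilate_sum n c).
Proof. by apply: L2_sum => k; apply: L2Z; exact: L2_dilate. Qed.

Lemma ip_dilate_sum n c m : (0 < m)%N ->
  ip (dilate_sum n c) (sn m) = 1 / 2 * dconv n c a m.
Proof.
move=> m0; rewrite /dilate_sum ip_suml; last 2 first.
- by move=> k; apply: L2Z; exact: L2_dilate.
- exact: L2_sn.
rewrite /dconv mulr_sumr [RHS]big_mkcond; apply: eq_big_nat => k /andP[k0 _].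
rewrite ipZl; [|exact: L2_dilate|exact: L2_sn].
rewrite (coef_oddext q_gt0 k0 m0 sp (L2_dilate k)).
by case: ifP => _; rewrite ?mulr0 // mulrCA.
Qed.

Lemma coef_sub_dilate g n c m : L2 g -> (0 < m)%N ->
  ip (fun x => g x - dilate_sum n c x) (sn m) = ip g (sn m) - 1 / 2 * dconv n c a m.
Proof.
move=> Lg m0; rewrite -ip_dilate_sum //; have Ld := L2_dilate_sum n c.
transitivity (ip (fun x => g x + -1 * dilate_sum n c x) (sn m)).
  by apply: eq_ip => // x _; rewrite mulN1r.
rewrite ipDl ?ipZl ?mulN1r //; try exact: L2_sn.
exact: L2Z.
Qed.

(** Only the approximation of [sn 1] is used; Bessel's inequality turns its L2 error into an l2
    error of coefficients. *)
Lemma inC_dcyclic : inC phi -> dcyclic a.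
Proof.
move=> [_ H] e e0.
have e2 : 0 < e / 2 by lra.
have [n [c hc]] := H (sn 1) (L2_sn 1) (e / 2) e2.
exists n, c => N; set v := fun x => sn 1 x - dilate_sum n c x.
have Lv : L2 v by apply: L2B; [exact: L2_sn|exact: L2_dilate_sum].
have vv : ip v v < e / 2 by rewrite -lte_fin -L2_normE.
have := ip_ge0 (fun x => v x - sine_poly N (fun j => 2 * ip v (sn j)) x).
rewrite ip_sine_poly_sq // [X in _ + 1 / 2 * X]big1 => [|j _]; last by rewrite subrr expr0n.
rewrite mulr0 addr0 => h.
have -> : \sum_(1 <= m < N.+1) ((m == 1%N)%:R - dconv n c a m) ^+ 2 =
  4 * \sum_(1 <= m < N.+1) ip v (sn m) ^+ 2 :> R.
  rewrite mulr_sumr; apply: eq_big_nat => m /andP[m0 _].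
  rewrite /v coef_sub_dilate ?ip_sn //; last exact: L2_sn.
  by rewrite eq_sym; field.
by lra.
Qed.

(* Expand |v - s|^2 for a sine polynomial s close to v. *)
Lemma ip_le_coefs (v : R -> R) e : L2 v ->
  (forall N, \sum_(1 <= m < N.+1) ip v (sn m) ^+ 2 <= e) -> ip v v <= 2 * e.
Proof.
move=> Lv H; apply/ler_addgt0Pr => d d0.
have [_ /(_ d d0) [h [[N [c hE]] hd]]] := sine_dense Lv.
have : dist2 v h = ip (fun x => v x - sine_poly N c x) (fun x => v x - sine_poly N c x).
  by apply: eq_ip => x _; rewrite hE.
rewrite ip_sine_poly_sq // => E; move: hd; rewrite E.
have : 0 <= \sum_(1 <= j < N.+1) (2 * ip v (sn j) - c j) ^+ 2.
  by apply: sumr_ge0 => j _; exact: sqr_ge0.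
by have := H N; lra.
Qed.

(** The target is first replaced by a sine polynomial, whose finite coefficient sequence lies in the
    closure; completeness of the sines brings l2 closeness back to L2. *)
Lemma dclosure_inC : L2 phi -> dclosure a (fun m => (m == 1%N)%:R) -> inC phi.
Proof.
move=> Lphi D; split => // g Lg e e0.
have e8 : 0 < e / 8 by lra.
have [_ /(_ _ e8) [h [[N [d hE]] hd]]] := sine_dense Lg.
have [b [n [c bE]] hb] := dclosure_finite N d D e8.
exists n, c.
have Lh : L2 h by apply: L2_sine_span; exists N, d.
have Ls := L2_dilate_sum n c.
rewrite (L2_normE (L2B Lg Ls)) lte_fin -/(dist2 g (dilate_sum n c)).
apply: le_lt_trans (dist2_tri Lg Lh Ls) _.
have : dist2 h (dilate_sum n c) <= 2 * (e / 32).
  apply: ip_le_coefs; first exact: L2B.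
  move=> M; have := hb M => hM; apply: (@le_trans _ _ (1 / 4 * (e / 8))); last by lra.
  apply: le_trans (ler_wpM2l _ hM); last by lra.
  rewrite mulr_sumr le_eqVlt; apply/orP; left; apply/eqP.
  apply: eq_big_nat => m /andP[m0 _]; rewrite coef_sub_dilate // bE //.
  have -> : ip h (sn m) = 1 / 2 * (if (0 < m <= N)%N then d m else 0).
    transitivity (ip (sine_poly N d) (sn m)); first by apply: eq_ip => // x _; rewrite hE.
    rewrite ip_suml; [|by move=> j; apply: L2Z; exact: L2_sn|exact: L2_sn].
    transitivity (\sum_(1 <= j < N.+1) if j == m then 1 / 2 * d j else 0).
      apply: eq_big_nat => j /andP[j0 _]; rewrite ipZl ?ip_sn //; try exact: L2_sn.
      case: eqP => _; last by rewrite mul0r mulr0.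
      by rewrite -[_%:R]/(1 : R); field.
    rewrite m0 /= -big_mkcond; case: ifP => mN; last first.
      rewrite mulr0 big1_seq // => j /andP[/eqP->]; rewrite mem_index_iota m0 /= ltnS.
      by rewrite mN.
    by rewrite big_nat1_eq m0 ltnS mN.
  by set X := dconv n c _ m; set Y := (if _ then _ else _); field.
by lra.
Qed.

End Dilations.

(** * Open sets with boundary on a grid *)

Section GridSets.
Context {R : realType}.
Variables (q : nat) (V : set R).
Hypotheses (q_gt0 : (0 < q)%N) (oV : open V) (V01 : V `<=` I01).
Hypothesis nV : nondegenerateV V.
Hypothesis bV : forall x, boundary V x -> exists s : int, x = s%:~R / q%:R.

Definition cell i : set R := `]i%:R / q%:R, (i.+1)%:R / q%:R[%classic.
Definition mid i : R := (i%:R / q%:R + (i.+1)%:R / q%:R) / 2.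
Definition cell_in i : bool := `[< V (mid i) >].

Lemma cellE i x : cell i x = (i%:R / q%:R < x < (i.+1)%:R / q%:R) :> Prop.
Proof. by rewrite /cell /= in_itv. Qed.

Lemma grid_step i : (i.+1)%:R / q%:R = i%:R / q%:R + q%:R^-1 :> R.
Proof. by rewrite -natr1 mulrDl mul1r. Qed.

Lemma invq_gt0 : 0 < (q%:R : R)^-1.
Proof. by rewrite invr_gt0 ltr0n. Qed.

Lemma cell_mid i : cell i (mid i).
Proof. by rewrite cellE /mid grid_step; have := invq_gt0; lra. Qed.

(** An open cell contains no grid point, hence no boundary point of [V]; so [V] meets it in a
    relatively open and closed set, and the cell is connected. *)
Lemma cell_const i x : cell i x -> V x <-> cell_in i.
Proof.
move=> cx; have cc : connected (cell i) by apply/connected_intervalP/interval_is_interval.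
have key y z : cell i y -> cell i z -> V y -> V z.
  move=> cy cz Vy; suff : cell i `&` V = cell i by move/seteqP => [_ /(_ z cz) []].
  apply: cc; [by exists y|by exists V|].
  exists (closure V); first exact: closed_closure.
  apply/seteqP; split=> t [ct Vt]; split => //; first exact: subset_closure.
  apply: contrapT => nVt.
  have [|s sE] := bV (x := t); first by split => // /interior_subset.
  move: ct; rewrite cellE sE !ltr_pM2r ?invq_gt0 //.
  rewrite -[i%:R]/((Posz i)%:~R) -[(i.+1)%:R]/((Posz i.+1)%:~R) !ltr_int.
  by move=> /andP[]; lia.
split; first by move=> Vx; apply/asboolP; apply: key Vx => //; exact: cell_mid.
by move/asboolP => h; apply: key h => //; exact: cell_mid.
Qed.

Lemma open_grid s : V (s.+1%:R / q%:R) -> cell_in s && cell_in s.+1.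
Proof.
move=> Vs; have /nbhs_ballP[e /= e0 he] := open_nbhs_nbhs (conj oV Vs).
have qi := invq_gt0.
have {}e0 : 0 < e by [].
have [d [d0 de dq]] : exists d : R, [/\ 0 < d, d < e & d < q%:R^-1].
  by exists (Num.min e q%:R^-1 / 2); split; case: (leP e q%:R^-1) => h; lra.
apply/andP; split.
  apply/(@cell_const _ (s.+1%:R / q%:R - d)).
    by rewrite cellE grid_step; lra.
  by apply: he; rewrite -ball_normE /= opprB addrC subrK gtr0_norm.
apply/(@cell_const _ (s.+1%:R / q%:R + d)).
  by rewrite cellE [(s.+2)%:R / _]grid_step; lra.
by apply: he; rewrite -ball_normE /= opprD addrA subrr add0r normrN gtr0_norm.
Qed.

Lemma near_cells (P : R -> Prop) s : (forall x, cell s x -> P x) -> P (s.+1%:R / q%:R) ->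
  (forall x, cell s.+1 x -> P x) -> \forall x \near (s.+1%:R / q%:R : R), P x.
Proof.
move=> h1 h2 h3; have qi := invq_gt0.
have := @near_in_itvoo R (s%:R / q%:R) (s.+2%:R / q%:R) (s.+1%:R / q%:R).
rewrite in_itv /= [(s.+2)%:R / _]grid_step [(s.+1)%:R / _]grid_step => /(_ _) H.
have {}H : \forall y \near (s%:R / q%:R + q%:R^-1 : R), y \in `]s%:R / q%:R, (s%:R / q%:R + q%:R^-1 + q%:R^-1)[.
  by apply: H; lra.
apply: filterS H => x; rewrite in_itv /= => /andP[x1 x2].
case: (ltgtP x (s.+1%:R / q%:R)) => hx; last by rewrite hx.
  by apply: h1; rewrite cellE hx x1.
by apply: h3; rewrite cellE hx /= [(s.+2)%:R / _]grid_step [(s.+1)%:R / _]grid_step.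
Qed.

(** Otherwise the grid point would be isolated in the complement: this is where non-degeneracy
    enters. *)
Lemma full_grid s : (s.+1 < q)%N -> cell_in s -> cell_in s.+1 -> V (s.+1%:R / q%:R).
Proof.
move=> sq c1 c2; apply: contrapT => nVs.
apply: (nV (x := s.+1%:R / q%:R)); split.
  rewrite inE; split => //; rewrite I01E divr_gt0 ?ltr0n //=.
  by rewrite ltr_pdivrMr ?ltr0n // mul1r ltr_nat.
exists [set x | x = s.+1%:R / q%:R \/ V x].
  apply: near_cells; last 1 first.
  - by move=> x cx; right; apply/(cell_const cx).
  - by move=> x cx; right; apply/(cell_const cx).
  - by left.
apply/seteqP; split => x /=; first by case=> [[-> //|Vx] [_ /(_ Vx)]].
move=> ->; split; first by left.
split => //; rewrite I01E divr_gt0 ?ltr0n //=.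
by rewrite ltr_pdivrMr ?ltr0n // mul1r ltr_nat.
Qed.

Lemma boundary_grid s : boundary V (s.+1%:R / q%:R) -> (s.+1 < q)%N ->
  cell_in s != cell_in s.+1.
Proof.
move=> [clV iV] sq; apply/eqP => E.
case c1 : (cell_in s); rewrite c1 in E.
  have h : V (s.+1%:R / q%:R) by apply: full_grid.
  by apply: iV; apply: open_nbhs_nbhs.
have nVs : ~ V (s.+1%:R / q%:R) by move=> /open_grid; rewrite c1.
have [|x [Vx]] := clV (~` V); last by [].
apply: near_cells => //.
- by move=> x cx /(cell_const cx); rewrite c1.
- by move=> x cx /(cell_const cx); rewrite -E.
Qed.

Lemma grid_locate (x : R) : 0 < x < 1 -> exists2 i, (i < q)%N &
  (i%:R / q%:R < x < (i.+1)%:R / q%:R) || ((x == i%:R / q%:R) && (0 < i)%N).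
Proof.
move=> /andP[x0 x1].
have main m : x < m%:R / q%:R -> exists2 i, (i < m)%N &
  (i%:R / q%:R < x < (i.+1)%:R / q%:R) || ((x == i%:R / q%:R) && (0 < i)%N).
  elim: m => [|m IH]; first by rewrite mul0r => h; lra.
  move=> h; case: (ltgtP x (m%:R / q%:R)) => hx.
  - by have [i im H] := IH hx; exists i => //; exact: ltnW.
  - by exists m => //; rewrite hx h.
  - exists m => //; rewrite hx eqxx lt0n; case: eqP => [m0|]; last by rewrite orbT.
    by rewrite hx m0 mul0r ltxx in x0.
have [|i iq H] := main q; last by exists i.
by rewrite divff // pnatr_eq0 -lt0n.
Qed.

Lemma step_indic : step_on q (fun i => (cell_in i)%:R) (indic V : R -> R).
Proof.
move=> i iq x; rewrite -cellE => cx; rewrite indicE; congr (_%:R).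
have E := cell_const cx; case: (boolP (x \in V)) => h.
  by rewrite (E.1 (set_mem h)).
by case c : (cell_in i) => //; case/negP: h; apply/mem_set/E.
Qed.

(** Some boundary numerator is not divisible by [p]. It is neither 0 nor [q], both being multiples
    of [p], and an interior boundary point separates a cell inside [V] from one outside. *)
Lemma jump_witness p : (p %| q)%N ->
  ~~ (p %| \big[gcdn/0%N]_(s < q.+1 | `[< boundary V (s%:R / q%:R) >]) (s : nat))%N ->
  exists s, [/\ (s.+1 < q)%N, ~~ (p %| s.+1)%N & cell_in s != cell_in s.+1].
Proof.
move=> pq; apply: contraNP => H; apply/dvdn_biggcdP => s /asboolP bs.
case: s bs => -[|s] /= sq bs //.
have [->//|sq'] := eqVneq s.+1 q.
rewrite ltnS in sq; have {}sq : (s.+1 < q)%N by rewrite ltn_neqAle sq'.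
apply: contrapT => ps; apply: H; exists s; split => //; first exact/negP.
exact: boundary_grid.
Qed.

(** No grid point lies in [V], as [open_grid] would put both adjacent cells into [V]. *)
Lemma alternating_Vodd : odd q -> (forall i, (i < q)%N -> cell_in i = odd i) -> V = Vodd q.
Proof.
move=> oq H; apply/seteqP; split => x.
  move=> Vx; have := V01 Vx; rewrite I01E => /grid_locate[i iq].
  case/orP => [hx|/andP[/eqP hx i0]].
    have : cell_in i by apply/(@cell_const _ x); rewrite ?cellE.
    rewrite H // => oi; exists i./2; first by lia.
    have -> : (2 * i./2 + 1 = i)%N by lia.
    have -> : (2 * i./2 + 2 = i.+1)%N by lia.
    by case/andP: hx.
  case: i i0 hx iq => // i _ hx iq; have : V (i.+1%:R / q%:R) by rewrite -hx.
  by move/open_grid; rewrite !H //=; [case: (odd i)|exact: ltnW].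
case=> j jq [x1 x2]; have iq : (2 * j + 1 < q)%N by lia.
apply/(@cell_const (2 * j + 1)); first by rewrite cellE x1 -addnS.
by rewrite H // addn1 /= mul2n odd_double.
Qed.

Lemma alternating_Veven : odd q -> (forall i, (i < q)%N -> cell_in i = ~~ odd i) -> V = Veven q.
Proof.
move=> oq H; apply/seteqP; split => x.
  move=> Vx; have := V01 Vx; rewrite I01E => /grid_locate[i iq].
  case/orP => [hx|/andP[/eqP hx i0]].
    have : cell_in i by apply/(@cell_const _ x); rewrite ?cellE.
    rewrite H // => oi; exists i./2; first by lia.
    have -> : (2 * i./2 = i)%N by lia.
    by rewrite addn1; case/andP: hx.
  case: i i0 hx iq => // i _ hx iq; have : V (i.+1%:R / q%:R) by rewrite -hx.
  by move/open_grid; rewrite !H //=; [case: (odd i)|exact: ltnW].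
case=> j jq [x1 x2]; have iq : (2 * j < q)%N by lia.
apply/(@cell_const (2 * j)); first by rewrite cellE x1 -addn1.
by rewrite H // mul2n odd_double.
Qed.

End GridSets.

(** * Sign patterns of the jumps *)

Lemma expn_add_mod p y D : (p %| D)%N -> ((y + D) ^ p = y ^ p %[mod p * D])%N.
Proof.
move=> pD; rewrite expnDn big_ord_recl /= bin0 mul1n subn0 expn0 muln1.
rewrite -[in RHS](addn0 (y ^ p)%N) -modnDmr; congr ((_ + _) %% _)%N; apply/eqP.
apply: dvdn_sum => -[i ip] _; rewrite /bump /= add1n.
case: i ip => [|i] ip.
  by rewrite bin1 expn1 dvdn_mul ?dvdn_mull.
rewrite mulnA dvdn_mull // expnS dvdn_mul // expnS dvdn_mulr //.
Qed.

(** By the binomial theorem, each p-th power gains one factor [p] in the modulus of the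
    congruence. *)
Lemma expn_prime_power_mod p x y k : x = y %[mod 2 * p] ->
  (x ^ (p ^ k) = y ^ (p ^ k) %[mod 2 * p ^ k.+1])%N.
Proof.
move=> xy; elim: k => [|k IH]; first by rewrite expn0 !expn1.
rewrite expnSr !expnM; move: IH; set X := (x ^ _)%N; set Y := (y ^ _)%N => {xy}.
wlog YX : X Y / (Y <= X)%N.
  by move=> W h; case: (leqP Y X) => c; [exact: W|apply/esym/W; [exact: ltnW|]].
move=> /eqP; rewrite eqn_mod_dvd // => D.
rewrite -(subnKC YX); set d := (X - Y)%N in D *.
have pd : (p %| d)%N by apply: dvdn_trans D; rewrite expnS mulnCA dvdn_mulr.
have E := expn_add_mod Y pd.
have dv : (2 * p ^ k.+2 %| p * d)%N by rewrite expnS mulnCA dvdn_mul.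
by rewrite -(modn_dvdm _ dv) E modn_dvdm.
Qed.

Section Alternation.
Context {R : realType}.
Variables (p l : nat) (b : nat -> bool) (e : nat -> R).
Let q := (p ^ l)%N.
Hypotheses (pp : prime p) (p7 : (7 <= p)%N) (l0 : (0 < l)%N).
Hypothesis e_mod : forall i, e (i %% (2 * q)) = e i.
Hypothesis e_sym : forall i, (i <= 2 * q)%N -> e (2 * q - i) = e i.
Hypothesis eE : forall k, (0 < k < q)%N -> e k = (b k)%:R - (b k.-1)%:R.
Hypothesis qi : forall a, coprime a (2 * q) ->
  exists2 t : R, t ^+ 2 = 1 & forall j, e (a * j) = t * e j.

Let sg (c : bool) : R := if c then 1 else -1.

Lemma leq_p_q : (p <= q)%N.
Proof. by rewrite /q -{1}(expn1 p) leq_exp2l //; lia. Qed.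

Lemma p_dvd_q : (p %| q)%N.
Proof. by rewrite /q -(prednK l0) expnS dvdn_mulr. Qed.

Lemma odd_p : odd p.
Proof. by case: (even_prime pp) => // p2; move: p7; rewrite p2. Qed.

Lemma odd_q : odd q.
Proof. by rewrite /q oddX odd_p orbT. Qed.

Lemma coprime_2q a : coprime a (2 * q) = odd a && ~~ (p %| a)%N.
Proof.
rewrite coprimeMr coprimen2 /q coprime_pexpr // coprime_sym prime_coprime //.
Qed.

Lemma flipE k : (0 < k < q)%N -> (e k != 0) = (b k != b k.-1).
Proof.
move=> h; rewrite eE //; case: (b k); case: (b k.-1);
  by rewrite /= ?mulr1n ?mulr0n ?subrr ?subr0 ?sub0r ?oppr_eq0 ?oner_eq0 ?eqxx.
Qed.

Lemma signE k : (0 < k < q)%N -> b k != b k.-1 -> e k = sg (b k).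
Proof.
by move=> h; rewrite eE // /sg; case: (b k); case: (b k.-1) => //= _; lra.
Qed.

Lemma e_neg j : e ((2 * q - 1) * j) = e j.
Proof.
have q2 : (0 < 2 * q)%N by have := leq_p_q; lia.
rewrite -e_mod -[RHS]e_mod.
have jq : (j %% (2 * q) < 2 * q)%N by rewrite ltn_mod.
rewrite -[RHS]e_sym; last exact: ltnW.
rewrite -[RHS]e_mod; congr (e _); apply/eqP.
rewrite -(eqn_modDr (j %% (2 * q))) subnK; last exact: ltnW.
by rewrite modnDmr mulnBl mul1n subnK ?modnn ?modnMr // leq_pmull.
Qed.

Lemma mod2p_odd a a' : a = a' %[mod 2 * p] -> odd a = odd a'.
Proof.
move=> aa'; have : a = a' %[mod 2].
  by rewrite -(@modn_dvdm (2 * p)) ?dvdn_mulr // aa' modn_dvdm // dvdn_mulr.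
by rewrite !modn2; case: (odd a); case: (odd a').
Qed.

Lemma mod2p_dvd a a' : a = a' %[mod 2 * p] -> (p %| a)%N = (p %| a')%N.
Proof.
move=> aa'; have : a = a' %[mod p].
  by rewrite -(@modn_dvdm (2 * p)) ?dvdn_mull // aa' modn_dvdm // dvdn_mull.
by rewrite /dvdn => ->.
Qed.

(* Units that are 1 mod 2p have odd order mod 2q (a power of p), so their sign is 1. *)
Lemma e_congr a a' j : odd a -> ~~ (p %| a)%N -> a = a' %[mod 2 * p] ->
  e (a * j) = e (a' * j).
Proof.
move=> oa pa aa'; have oa' : odd a' by rewrite -(mod2p_odd aa').
have pa' : ~~ (p %| a')%N by rewrite -(mod2p_dvd aa').
have [t t1 Ht] : exists2 t : R, t ^+ 2 = 1 & forall j, e (a * j) = t * e j by apply: qi; rewrite coprime_2q oa.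
have [u u1 Hu] : exists2 t : R, t ^+ 2 = 1 & forall j, e (a' * j) = t * e j by apply: qi; rewrite coprime_2q oa'.
have pw c (s : R) : (forall j, e (c * j) = s * e j) -> forall n j, e (c ^ n * j) = s ^+ n * e j.
  move=> H; elim=> [|n IH] i; first by rewrite mul1n expr0 mul1r.
  by rewrite expnS -mulnA H IH exprS mulrA.
have od (s : R) : s ^+ 2 = 1 -> s ^+ (p ^ l.-1) = s.
  move=> s1; rewrite -(odd_double_half (p ^ l.-1)) oddX odd_p orbT add1n exprS -mul2n exprM s1.
  by rewrite expr1n mulr1.
have E := expn_prime_power_mod l.-1 aa'; rewrite prednK // in E.
rewrite Ht Hu -(od _ t1) -(od _ u1) -(pw _ _ Ht) -(pw _ _ Hu).
by rewrite -e_mod -[RHS]e_mod -modnMml E modnMml.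
Qed.

Lemma e_odd k : odd k -> ~~ (p %| k)%N -> exists2 t : R, t ^+ 2 = 1 & forall j, e (k * j) = t * e j.
Proof. by move=> ok pk; apply: qi; rewrite coprime_2q ok. Qed.

(** At even arguments only the residue of the multiplier modulo [q] matters, so adding the odd
    number [q] turns an even multiplier into a unit modulo 2 q: every residue prime to [p] acts on
    the even jumps. *)
Lemma e_even m : ~~ (p %| m)%N -> exists a,
  [/\ odd a, ~~ (p %| a)%N, a = m %[mod p] & forall j, e (a * (2 * j)) = e (2 * m * j)].
Proof.
move=> pm; case: (boolP (odd m)) => om.
  by exists m; split => // j; rewrite mulnCA mulnA.
exists (m + q)%N; split.
- by rewrite oddD (negPf om) odd_q.
- by rewrite dvdn_addl // p_dvd_q.
- by rewrite -modnDmr (eqP p_dvd_q) addn0.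
move=> j; rewrite -e_mod -[RHS]e_mod; congr (e _).
have -> : ((m + q) * (2 * j) = j * (2 * q) + 2 * m * j)%N by lia.
by rewrite modnMDl.
Qed.

Lemma small_coprime k : (0 < k < p)%N -> ~~ (p %| k)%N.
Proof. by move=> /andP[k0 kp]; rewrite gtnNdvd. Qed.

Lemma e_odd_neq0 k : odd k -> ~~ (p %| k)%N -> (e k != 0) = (e 1 != 0).
Proof.
move=> ok pk; have [t t1 H] := e_odd ok pk.
have t0 : t != 0 by apply: contra_eq_neq t1 => ->; rewrite expr0n /= eq_sym oner_eq0.
by rewrite -(muln1 k) H mulf_eq0 (negPf t0).
Qed.

Lemma e_even_neq0 k : ~~ odd k -> ~~ (p %| k)%N -> (e k != 0) = (e 2 != 0).
Proof.
move=> ok pk; have kE : (k = 2 * k./2)%N by lia.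
have pm : ~~ (p %| k./2)%N by apply: contra pk => h; rewrite kE dvdn_mull.
have [a [oa pa am Ha]] := e_even pm; have [t t1 H] := e_odd oa pa.
have t0 : t != 0 by apply: contra_eq_neq t1 => ->; rewrite expr0n /= eq_sym oner_eq0.
by rewrite kE -(muln1 (2 * _)%N) -Ha H muln1 mulf_eq0 (negPf t0).
Qed.

Lemma small_range k : (0 < k)%N -> (k < p)%N -> (0 < k < q)%N.
Proof. by move=> -> kp; exact: leq_trans kp leq_p_q. Qed.

(** All jumps off the multiples of [p] are nonzero, so membership alternates below [p], and the odd
    numbers below [p] act with sign 1. Congruence modulo 2 p and evenness extend this to all odd
    units; hence a jump off the multiples of [p] depends only on the parity of its index. *)
Lemma alternating_case : e 1 != 0 -> e 2 != 0 ->
  forall k, (k < q)%N -> b k = b 0 (+) odd k.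
Proof.
move=> e1 e2.
have fl k : (0 < k < q)%N -> ~~ (p %| k)%N -> b k != b k.-1.
  move=> kq pk; rewrite -flipE //; case: (boolP (odd k)) => ok.
    by rewrite e_odd_neq0.
  by rewrite e_even_neq0.
have bs k : (k < p)%N -> b k = b 0 (+) odd k.
  elim: k => [|k IH] kp; first by rewrite addbF.
  have := fl _ (small_range (ltn0Sn k) kp) (small_coprime (k := k.+1) kp).
  by rewrite /= IH ?(ltnW kp) //=; case: (b k.+1); case: (b 0); case: (odd k).
have es k : odd k -> (k < p)%N -> forall j, e (k * j) = e j.
  move=> ok kp; have k0 : (0 < k)%N by case: (k) ok.
  have pk : ~~ (p %| k)%N by apply: small_coprime; rewrite k0.
  have [t t1 H] := e_odd ok pk.
  have p1 : (1 < p)%N by exact: leq_trans p7.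
  have E : e k = e 1.
    have r1 := small_range (ltn0Sn 0) p1; have rk := small_range k0 kp.
    rewrite (signE rk (fl _ rk pk)) (signE r1); last by apply: fl => //; exact: small_coprime.
    by rewrite (bs k) // (bs 1%N) // ok.
  have : t * e 1 = 1 * e 1 by rewrite -H muln1 E mul1r.
  by move/(mulIf e1) => tE j; rewrite H tE mul1r.
have eo k : odd k -> ~~ (p %| k)%N -> forall j, e (k * j) = e j.
  move=> ok pk j; set r := (k %% (2 * p))%N.
  have kr : k = r %[mod 2 * p] by rewrite modn_mod.
  have or : odd r by rewrite -(mod2p_odd kr).
  have pr : ~~ (p %| r)%N by rewrite -(mod2p_dvd kr).
  rewrite (e_congr j ok pk kr); case: (ltnP r p) => rp; first exact: es.
  have r2 : (r < 2 * p)%N by rewrite ltn_mod muln_gt0 (prime_gt0 pp).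
  have rr : (2 * p - r + r = 2 * p)%N by rewrite subnK ?(ltnW r2).
  (* A residue above [p] is minus the odd number 2 p - r below [p], and [2 * q - 1] represents
     -1. *)
  have rN : r = (2 * q - 1) * (2 * p - r) %[mod 2 * p].
    apply/eqP; rewrite -(eqn_modDr (2 * p - r)) addnC rr.
    rewrite mulnBl mul1n subnK; last by rewrite leq_pmull // muln_gt0 (leq_trans (prime_gt0 pp) leq_p_q).
    rewrite modnn eq_sym; apply/eqP/eqP; rewrite -/(dvdn _ _) dvdn_mulr // dvdn_pmul2l //.
    exact: p_dvd_q.
  rewrite (e_congr j or pr rN) -mulnA e_neg; apply: es.
    by rewrite oddB ?(ltnW r2) // oddM /= or.
  rewrite ltn_subLR ?(ltnW r2) // mul2n -addnn ltn_add2r ltn_neqAle rp andbT.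
  by apply: contraNneq pr => <-.
have ea k : ~~ (p %| k)%N -> e k = if odd k then e 1 else e 2.
  move=> pk; case: ifP => ok; first by rewrite -(muln1 k) eo.
  have kE : (k = 2 * k./2)%N by rewrite mul2n; have := odd_double_half k; rewrite ok.
  have pm : ~~ (p %| k./2)%N by apply: contra pk => h; rewrite kE dvdn_mull.
  have [a [oa pa am Ha]] := e_even pm.
  by rewrite kE -(muln1 (2 * _)%N) -Ha eo.
elim=> [|k IH] kq; first by rewrite addbF.
have {}IH := IH (ltnW kq); case: (boolP (p %| k.+1)%N) => pk; last first.
  have /= := fl k.+1 kq pk; rewrite IH.
  by case: (b k.+1); case: (b 0); case: (odd k).
(* Across a multiple k + 1 of [p], the indices k and k + 2 have the same parity, hence equal jumps,
   and b (k + 2) = b k. The nonzero jump at k + 2 then makes b (k + 1) differ from b k. *)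
have p1 : ~~ (p %| 1)%N by rewrite small_coprime // (leq_trans _ p7).
have pk2 : ~~ (p %| k.+2)%N by rewrite -addn1 dvdn_addr.
have pk0 : ~~ (p %| k)%N by apply: contra p1 => h; rewrite -(dvdn_addr 1 h) addn1.
have k0 : (0 < k)%N by rewrite lt0n; apply: contraNneq pk0 => ->; rewrite dvdn0.
have kq2 : (k.+2 < q)%N.
  rewrite ltn_neqAle kq andbT; apply: contraNneq pk2 => ->; exact: p_dvd_q.
have r2 : (0 < k.+2 < q)%N by [].
have r0 : (0 < k < q)%N by rewrite k0 ltnW.
have f2 := fl _ r2 pk2; have f0 := fl _ r0 pk0.
have : e k.+2 = e k by rewrite (ea k.+2) // (ea k) //= negbK.
rewrite (signE r2 f2) (signE r0 f0) => sE.
have bE : b k.+2 = b k.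
  move: sE; rewrite /sg; case: (b k.+2); case: (b k) => // h; lra.
move: f2 => /=; rewrite bE IH.
by case: (b k.+1); case: (b 0); case: (odd k).
Qed.

(* The signs of e at 1, 3, ..., p-2 alternate, so t(3) = -1; but t(p-2) = t(p-6)
   while 3(p-2) = p-6 mod 2p. *)
Lemma no_even_jump_absurd : e 1 != 0 -> e 2 = 0 -> False.
Proof.
move=> e1 e2.
have fl k : (0 < k)%N -> (k < p)%N -> (b k != b k.-1) = odd k.
  move=> k0 kp; rewrite -flipE ?small_range //.
  have pk : ~~ (p %| k)%N by apply: small_coprime; rewrite k0.
  case: (boolP (odd k)) => ok; first by rewrite e_odd_neq0.
  by rewrite e_even_neq0 // e2 eqxx.
have bs i : (i.*2.+1 < p)%N -> b i.*2.+1 = ~~ (b 0 (+) odd i).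
  elim: i => [|i IH] ip.
    by have := fl 1%N isT ip; case: (b 1); case: (b 0).
  have ip' : (i.*2.+2 < p)%N by rewrite ltnW.
  have := fl i.*2.+3 isT ip; have := fl i.*2.+2 isT ip'.
  rewrite /= odd_double (IH (ltnW ip')) doubleS.
  by case: (b i.*2.+2); case: (b i.*2.+3); case: (b 0); case: (odd i).
have es i : (i.*2.+1 < p)%N -> e i.*2.+1 = sg (~~ (b 0 (+) odd i)).
  move=> ip; have := fl _ (ltn0Sn i.*2) ip; rewrite [odd _]/= odd_double /= => f.
  by rewrite (signE (small_range (ltn0Sn i.*2) ip) f) bs.
have p3 : (3 < p)%N by exact: leq_trans p7.
have p6 : (6 < p)%N by exact: p7.
have [t t1 H] := e_odd (k := 3) isT (small_coprime (k := 3) p3).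
have e3 : e 3 = sg (b 0) by rewrite (es 1%N p3) /= addbT negbK.
have e1' : e 1 = sg (~~ b 0) by rewrite (es 0%N) /= ?addbF // ltnW // ltnW.
have tN : t = -1.
  have := H 1%N; rewrite muln1 e3 e1' /sg; case: (b 0) => /= h; lra.
pose m := ((p - 7)./2)%N.
have pE : p = (m.*2 + 7)%N.
  have := odd_double_half (p - 7); rewrite oddB // odd_p /= add0n -/m => mE.
  by rewrite mE subnK.
have k2 : (p - 2 = (m.+2).*2.+1)%N by clear -pE; rewrite pE; clearbody m; lia.
have k6 : (p - 6 = m.*2.+1)%N by clear -pE; rewrite pE; clearbody m; lia.
have l2 : ((m.+2).*2.+1 < p)%N by rewrite -k2 ltn_subrL (prime_gt0 pp).
have l6 : (m.*2.+1 < p)%N by rewrite -k6 ltn_subrL (prime_gt0 pp).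
have := H (p - 2)%N.
have p9 : ~~ (p %| (3 * (p - 2))%N)%N.
  by rewrite Euclid_dvdM // negb_or (small_coprime (k := 3) p3) k2 small_coprime.
have -> : e (3 * (p - 2)) = e (p - 6).
  rewrite -(muln1 (3 * _)%N) -(muln1 (p - 6)%N); apply: e_congr => //.
    by rewrite oddM k2 /= odd_double.
  have -> : (3 * (p - 2) = 1 * (2 * p) + (p - 6))%N by rewrite mulnBr; lia.
  by rewrite modnMDl.
rewrite k6 k2 !es // tN /= negbK /sg; case: (_ (+) _) => /= h; lra.
Qed.

(* Now e alternates at 2, 4, ..., p-1.  For p >= 11, e(8)/e(2) = -1 is not the
   square of e(4)/e(2); for p = 7, 2 * 3 = -1 mod 7 although e is even. *)
Lemma no_odd_jump_absurd : e 1 = 0 -> e 2 != 0 -> False.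
Proof.
move=> e1 e2.
have fl k : (0 < k)%N -> (k < p)%N -> (b k != b k.-1) = ~~ odd k.
  move=> k0 kp; rewrite -flipE ?small_range //.
  have pk : ~~ (p %| k)%N by apply: small_coprime; rewrite k0.
  case: (boolP (odd k)) => ok; first by rewrite e_odd_neq0 // e1 eqxx.
  by rewrite e_even_neq0.
have bs i : (i.*2 < p)%N -> b i.*2 = b 0 (+) odd i.
  elim: i => [|i IH] ip; first by rewrite addbF.
  have ip' : (i.*2.+1 < p)%N by rewrite ltnW.
  have := fl i.*2.+2 isT ip; have := fl i.*2.+1 isT ip'.
  rewrite /= odd_double (IH (ltnW ip')) doubleS.
  by case: (b i.*2.+1); case: (b i.*2.+2); case: (b 0); case: (odd i).
have es i : (i.*2.+2 < p)%N -> e i.*2.+2 = sg (~~ (b 0 (+) odd i)).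
  move=> ip; have := fl _ (ltn0Sn i.*2.+1) ip; rewrite [odd _]/= odd_double /= => f.
  by rewrite (signE (small_range (ltn0Sn i.*2.+1) ip) f) (bs i.+1) //= addbN.
have p2 : ~~ (p %| 2)%N by rewrite small_coprime // (leq_trans _ p7).
have [a [oa pa am Ha]] := e_even p2; have [t t1 H] := e_odd oa pa.
have E2 : e 2 = sg (~~ b 0) by rewrite (es 0%N) /= ?addbF // (leq_trans _ p7).
have E4 : e 4 = sg (b 0) by rewrite (es 1%N) /= ?addbT ?negbK // (leq_trans _ p7).
have E6 : e 6 = sg (~~ b 0) by rewrite (es 2%N) /= ?addbF // (leq_trans _ p7).
have tN : t = -1.
  have := Ha 1%N; rewrite H !muln1 E2 E4 /sg; case: (b 0) => /= h; lra.
have [p8|p8] := ltnP 8 p.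
  have E8 : e 8 = sg (b 0) by rewrite (es 3%N) /= ?addbT ?negbK.
  have := Ha 2%N; rewrite H -[(2 * 2)%N]/4%N -[(4 * 2)%N]/8%N E4 E8 tN /sg; case: (b 0) => /= h; lra.
have {}p8 : p = 7%N.
  move: pp; have [->|pn7] := eqVneq p 7%N; first by [].
  have -> // : p = 8%N by apply/eqP; rewrite eqn_leq p8 ltn_neqAle eq_sym pn7.
have p3 : (0 < 3 < p)%N by rewrite p8.
have [u u1 Hu] := e_odd (k := 3) isT (small_coprime p3).
have uE : u = 1.
  have := Hu 2%N; rewrite -[(3 * 2)%N]/6%N E6 E2 /sg; case: (b 0) => /= h; lra.
have pa3 : ~~ (p %| (a * 3)%N)%N by rewrite Euclid_dvdM // negb_or pa small_coprime.
have oa3 : odd (a * 3) by rewrite oddM oa.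
have C : (a * 3 = 2 * q - 1 %[mod 2 * p])%N.
  have /dvdnP[q' qE] := p_dvd_q; have := am; rewrite qE p8 => a7.
  have q'0 : (0 < q')%N.
    by rewrite lt0n; apply: contraTneq leq_p_q => q0; rewrite qE q0 mul0n -ltnNge prime_gt0.
  by clear - a7 oa q'0; lia.
have := e_congr 2 oa3 pa3 C; rewrite e_neg -mulnA H Hu tN uE => h.
by case/eqP: e2; lra.
Qed.

(** [e 1] and [e 2] decide whether the jumps of each parity, off the multiples of [p], vanish; the
    given jump shows that not both are 0. *)
Lemma jump_dichotomy s : (s.+1 < q)%N -> ~~ (p %| s.+1)%N -> b s != b s.+1 ->
  forall k, (k < q)%N -> b k = b 0 (+) odd k.
Proof.
move=> sq ps bs; have es : e s.+1 != 0 by rewrite flipE //= eq_sym.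
have [e2|e2] := eqVneq (e 2) 0; have [e1|e1] := eqVneq (e 1) 0.
- case: (boolP (odd s.+1)) => os; first by rewrite e_odd_neq0 // e1 eqxx in es.
  by rewrite e_even_neq0 // e2 eqxx in es.
- by case: (no_even_jump_absurd e1 e2).
- by case: (no_odd_jump_absurd e1 e2).
- exact: alternating_case.
Qed.

End Alternation.

(** * Cyclicity of the two alternating sets *)

Section InverseSquares.
Context {R : realType}.

Lemma sum_inv_sqr M : \sum_(1 <= m < M.+1) (m%:R : R)^-1 ^+ 2 <= 2.
Proof.
case: M => [|M]; first by rewrite big_geq.
apply: (@le_trans _ _ (2 - (M.+1)%:R^-1)); last first.
  by rewrite lerBlDr lerDl invr_ge0 ler0n.
elim: M => [|M IH]; first by rewrite big_nat1 invr1 expr1n; lra.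
rewrite big_nat_recr //=; apply: le_trans (lerD IH (lexx _)) _.
have x0 : (0 : R) < M.+1%:R by rewrite ltr0n.
rewrite -(natr1 M.+1); move: (M.+1%:R) x0 => x x0.
rewrite -subr_ge0 (_ : _ - _ = (x * (x + 1) ^+ 2)^-1); last by field; lra.
by rewrite invr_ge0 mulr_ge0 ?sqr_ge0 // ltW.
Qed.

(** Telescoping, from 1 / (x + 1)^2 <= 1 / x - 1 / (x + 1). *)
Lemma tail_inv_sqr P M : (0 < P)%N ->
  \sum_(1 <= m < M.+1) (if (P < m)%N then (m%:R : R)^-1 ^+ 2 else 0) <= P%:R^-1.
Proof.
move=> P0; apply: (@le_trans _ _ (P%:R^-1 - (if (P <= M)%N then M%:R^-1 else P%:R^-1))); last first.
  by rewrite gerBl; case: ifP => _; rewrite invr_ge0 ler0n.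
elim: M => [|M IH]; first by rewrite big_geq // leqNgt P0 subrr.
rewrite big_nat_recr //=; apply: le_trans (lerD IH (lexx _)) _.
rewrite ltnS; case: (ltngtP P M.+1) => PM.
- rewrite ltnS in PM; rewrite PM.
  have x0 : (0 : R) < M%:R by rewrite ltr0n (leq_trans P0).
  rewrite -(natr1 M); move: (M%:R) x0 => x x0.
  rewrite -subr_ge0 (_ : _ - _ = (x * (x + 1) ^+ 2)^-1); last by field; rewrite pnatr_eq0 -lt0n P0 !gt_eqF //; lra.
  by rewrite invr_ge0 mulr_ge0 ?sqr_ge0 // ltW.
- by rewrite leqNgt (ltn_trans (ltnSn M) PM) /= addr0.
- by rewrite PM ltnn addr0.
Qed.

End InverseSquares.

(** * Sieving and Fejer means *)

Section Sieve.
Context {R : realType}.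
Implicit Types (b : nat -> R) (s : seq nat).

Lemma dshift_comp j k b m : (0 < j)%N -> dshift j (dshift k b) m = dshift (j * k) b m.
Proof.
move=> j0; rewrite /dshift; case: ifP => [/dvdnP[m' ->]|jm].
  by rewrite mulnK // [(m' * j)%N]mulnC dvdn_pmul2l // divnMl.
by case: ifP => // h; rewrite (dvdn_trans _ h) ?dvdn_mulr in jm.
Qed.

Definition prime_to s n := all (fun r => ~~ (r %| n)%N) s.
Definition sieved s n : R := (prime_to s n)%:R / n%:R.

(** Multiplying the series by the inverse Euler factor 1 - r^(-1-s) removes the multiples of [r]. *)
Lemma sieved_cons r s n : (0 < n)%N -> prime r -> all prime s -> r \notin s ->
  sieved (r :: s) n = sieved s n - r%:R^-1 * dshift r (sieved s) n.
Proof.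
move=> n0 pr ps rs; rewrite /sieved /dshift /=; case: (boolP (r %| n)%N) => rn /=; last first.
  by rewrite mulr0 subr0.
have /dvdnP[m mE] := rn; have m0 : (0 < m)%N by move: n0; rewrite mE muln_gt0 => /andP[].
rewrite mE mulnK ?prime_gt0 //.
have -> : prime_to s (m * r) = prime_to s m.
  apply: eq_in_all => x xs; congr (~~ _); have px := allP ps _ xs.
  rewrite Euclid_dvdM // [(x %| r)%N](_ : _ = false) ?orbF // dvdn_prime2 //.
  by apply: contraNF rs => /eqP <-.
have mR : (m%:R : R) != 0 by rewrite pnatr_eq0 -lt0n.
have rR : (r%:R : R) != 0 by rewrite pnatr_eq0 -lt0n prime_gt0.
by rewrite mul0r natrM; field; rewrite mR rR.
Qed.

Lemma sieved_sqr_le s n : sieved s n ^+ 2 <= (n%:R : R)^-1 ^+ 2.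
Proof.
rewrite /sieved; case: (prime_to s n); first by rewrite mul1r.
by rewrite mul0r expr0n /= sqr_ge0.
Qed.

End Sieve.

Section Inversion.
Context {R : realType}.
Variables (p q : nat) (eps : R) (a : nat -> R).
Hypotheses (pp : prime p) (p2 : (2 < p)%N) (q0 : (0 < q)%N) (pq : (p %| q)%N).
Hypothesis eps1 : eps ^+ 2 = 1.
Let X (b : nat -> R) m := b m + eps * dshift q b m.
Hypothesis aX : dspan a (X (sieved [:: 2])).

(** The inverse Euler factors commute with 1 + eps T_q, so the sieve can be carried out inside the
    span of [a]. *)
Lemma dspan_sieved s : all prime s -> uniq s -> 2 \notin s -> dspan a (X (sieved (s ++ [:: 2]))).
Proof.
elim: s => [|r s IH] //= /andP[pr ps] /andP[rs us].
rewrite inE negb_or => /andP[r2 s2]; have {IH} H := IH ps us s2.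
have r0 := prime_gt0 pr.
apply: eq_dspan (dspanD H (dspanZ (- r%:R^-1) (dspan_shift r0 H))) => m m0.
have C n : (0 < n)%N ->
    sieved (r :: (s ++ [:: 2])) n = sieved (s ++ [:: 2]) n - r%:R^-1 * dshift r (sieved (s ++ [:: 2])) n :> R.
  move=> n0; apply: sieved_cons => //; first by rewrite all_cat ps.
  by rewrite mem_cat negb_or rs inE eq_sym.
rewrite /X C //.
have -> : dshift r (fun m => sieved (s ++ [:: 2]) m + eps * dshift q (sieved (s ++ [:: 2])) m) m =
  dshift r (sieved (s ++ [:: 2])) m + eps * dshift r (dshift q (sieved (s ++ [:: 2]))) m :> R.
  by rewrite /dshift; case: ifP => // _; rewrite mulr0 addr0.
have -> : dshift q (sieved (r :: s ++ [:: 2])) m =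
  dshift q (sieved (s ++ [:: 2])) m - r%:R^-1 * dshift q (dshift r (sieved (s ++ [:: 2]))) m :> R.
  rewrite {1 2 3}/dshift; case: ifP => qm; last by rewrite mulr0 subr0.
  by rewrite C // divn_gt0 // dvdn_leq.
by rewrite !dshift_comp // [(q * r)%N]mulnC; ring.
Qed.

(** For G j = (- eps T_q)^j u, the differences G j - G (j + 1) are the images of (1 + eps T_q) u,
    and the linear weights leave [u] minus the mean of its next N images. *)
Lemma fejer_telescope (G : nat -> R) N : (0 < N)%N ->
  \sum_(0 <= j < N) (1 - j%:R / N%:R) * (G j - G j.+1) = G 0%N - N%:R^-1 * \sum_(1 <= j < N.+1) G j.
Proof.
move=> N0; have NR : (N%:R : R) != 0 by rewrite pnatr_eq0 -lt0n.
have main M : \sum_(0 <= j < M) (1 - j%:R / N%:R) * (G j - G j.+1) =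
   G 0%N - N%:R^-1 * \sum_(1 <= j < M.+1) G j - (1 - M%:R / N%:R) * G M.
  elim: M => [|M IH]; first by rewrite !big_geq // mul0r; ring.
  rewrite big_nat_recr //= IH [in RHS]big_nat_recr //= -natr1.
  by field.
by rewrite main divff // subrr mul0r subr0.
Qed.

Lemma sqr_sum_disjoint (G : nat -> R) (s : seq nat) : uniq s ->
  (forall i j, (i < j)%N -> G i * G j = 0) ->
  (\sum_(i <- s) G i) ^+ 2 = \sum_(i <- s) G i ^+ 2.
Proof.
move=> us H; elim: s us => [|i s IH] /=; first by rewrite !big_nil expr0n.
move=> /andP[nis us]; rewrite !big_cons sqrrD IH // mulr_sumr big1_seq ?mul0rn ?addr0 //.
move=> j /andP[_ js]; case: (ltngtP i j) => ij; [exact: H|by rewrite mulrC H|].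
by rewrite ij js in nis.
Qed.

(** The sieved [u] agrees with the unit up to [N], and the mean of [N] orthogonal images of [u], all
    of squared norm at most 2, has squared norm at most 2 / N. *)
Lemma sieve_fejer_cyclic : dclosure a (fun m => (m == 1%N)%:R).
Proof.
move=> e e0.
have [P Pe] : exists P, 16 / e < P%:R :> R.
  exists (Num.truncn (16 / e)).+1; have := @truncnS_gt R (16 / e); exact.
(* The primes from 3 to N + 2 will be sieved out; adding [p] puts [p] among them. Then [u] vanishes
   on the multiples of [p], and as [p] divides [q], the functions [G m j] for different j have
   disjoint supports in m. *)
pose N := (P + p)%N.
have N0 : (0 < N)%N by rewrite /N addn_gt0 (prime_gt0 pp) orbT.
have NR : (0 : R) < N%:R by rewrite ltr0n.
have Ne : N%:R^-1 <= e / 16.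
  rewrite -[e / 16]invrK lef_pV2 ?posrE ?invr_gt0 //; last by lra.
  rewrite invf_div; apply: le_trans (ltW Pe) _; rewrite ler_nat leq_addr //.
pose s := [seq r <- iota 3 N | prime r].
have ps : all prime s by rewrite filter_all.
have us : uniq s by rewrite filter_uniq // iota_uniq.
have s2 : 2 \notin s by rewrite mem_filter mem_iota.
have H := dspan_sieved ps us s2; set u := sieved (s ++ [:: 2]) in H.
have ps2 : p \in s.
  by rewrite mem_filter pp mem_iota p2 /= /N; lia.
pose G m j := (- eps) ^+ j * dshift (q ^ j) u m.
have qj j : (0 < q ^ j)%N by rewrite expn_gt0 q0.
have XG m j : (- eps) ^+ j * dshift (q ^ j) (X u) m = G m j - G m j.+1.
  rewrite /G exprS expnSr -dshift_comp //.
  have -> : dshift (q ^ j) (X u) m = dshift (q ^ j) u m + eps * dshift (q ^ j) (dshift q u) m.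
    by rewrite {1 2 3}/dshift; case: ifP => // _; rewrite mulr0 addr0.
  by ring.
exists (fun m => \sum_(0 <= j < N) (1 - j%:R / N%:R) * ((- eps) ^+ j * dshift (q ^ j) (X u) m)).
  by apply: dspan_sum => j; apply: dspanZ; apply: dspanZ; apply: dspan_shift.
have G0 m : G m 0%N = u m by rewrite /G expr0 mul1r /dshift expn0 dvd1n divn1.
have Gd m : forall i j, (i < j)%N -> G m i * G m j = 0.
  move=> i j ij; rewrite /G /dshift.
  case: (boolP (q ^ i %| m)%N) => qi; last by rewrite mulr0 mul0r.
  case: (boolP (q ^ j %| m)%N) => qj'; last by rewrite !mulr0.
  have -> : u (m %/ q ^ i)%N = 0; last by rewrite mulr0 mul0r.
  rewrite /u /sieved (_ : prime_to _ _ = false) ?mul0r //.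
  apply/negbTE/allPn; exists p; first by rewrite mem_cat ps2.
  rewrite negbK dvdn_divRL //; apply: dvdn_trans qj'.
  by rewrite -(subnK ij) expnD expnS dvdn_mull // dvdn_mul.
move=> M.
apply: (@le_trans _ _ (\sum_(1 <= m < M.+1) (2 * ((m == 1%N)%:R - u m) ^+ 2 +
   2 * N%:R^-1 ^+ 2 * \sum_(1 <= j < N.+1) G m j ^+ 2))).
  apply: ler_sum => m _.
  under eq_bigr do rewrite XG.
  rewrite fejer_telescope // G0 -sqr_sum_disjoint ?iota_uniq //; last exact: Gd.
  set S := \sum_(_ <= _ < _) _; set x := N%:R^-1; set y := (m == 1%N)%:R - u m.
  have := sqr_ge0 (y - x * S).
  rewrite (_ : _ - (u m - x * S) = y + x * S); last by rewrite /y; ring.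
  by nra.
rewrite big_split /= -!mulr_sumr exchange_big /=.
have E1 : \sum_(1 <= m < M.+1) ((m == 1%N)%:R - u m) ^+ 2 <= N%:R^-1.
  apply: le_trans (tail_inv_sqr M N0).
  apply: ler_sum_nat => m /andP[m0 _]; case: ltnP => mN.
    rewrite gtn_eqF; last by rewrite (leq_ltn_trans N0).
    by rewrite sub0r sqrrN sieved_sqr_le.
  have [->|m1] := eqVneq m 1%N.
    rewrite /u /sieved (_ : prime_to _ _ = true) ?divr1 ?subrr ?expr0n //.
    by apply/allP => r; rewrite mem_cat mem_filter inE => /orP[/andP[pr _]|/eqP->] //; rewrite dvdn1; case: r pr => [|[]].
  rewrite /u /sieved (_ : prime_to _ _ = false) ?mul0r ?subrr ?expr0n //.
  have m2 : (1 < m)%N by rewrite ltn_neqAle eq_sym m1.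
  apply/negbTE/allPn; exists (pdiv m); last by rewrite negbK pdiv_dvd.
  rewrite mem_cat mem_filter pdiv_prime // mem_iota inE.
  have := pdiv_leq m0; have := prime_gt1 (pdiv_prime m2).
  by move: (pdiv m) mN => d; lia.
have E2 : \sum_(1 <= j < N.+1) \sum_(1 <= m < M.+1) G m j ^+ 2 <= N%:R * 2.
  apply: (@le_trans _ _ (\sum_(1 <= j < N.+1) 2)); last by rewrite sumr_const_nat subn1 mulr_natl.
  apply: ler_sum => j _.
  apply: le_trans (sum_inv_sqr (M %/ q ^ j)).
  rewrite (_ : \sum_(1 <= m < M.+1) G m j ^+ 2 = \sum_(1 <= m < M.+1 | (q ^ j %| m)%N) u (m %/ q ^ j)%N ^+ 2).
    rewrite sum_multiples //; apply: ler_sum => m _; rewrite mulKn //; exact: sieved_sqr_le.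
  rewrite [RHS]big_mkcond; apply: eq_bigr => m _; rewrite /G /dshift; case: ifP => _.
    by rewrite exprMn -exprM mulnC exprM sqrrN eps1 expr1n mul1r.
  by rewrite mulr0 expr0n.
apply: (@le_trans _ _ (2 * N%:R^-1 + 2 * N%:R^-1 ^+ 2 * (N%:R * 2))).
  by apply: lerD; apply: ler_wpM2l => //; rewrite mulr_ge0 ?sqr_ge0.
rewrite (_ : 2 * N%:R^-1 + _ = 6 * N%:R^-1); last by field; rewrite gt_eqF.
by lra.
Qed.

End Inversion.

Section Alternating.
Context {R : realType}.
Variables (q : nat) (c : bool).
Hypotheses (q_gt0 : (0 < q)%N) (oq : odd q).
Let w i : R := (odd i == c)%:R.
Let eps : R := if c then -1 else 1.

Lemma cos_addr_natpi i (x : R) : cos (x + i%:R * pi) = (-1) ^+ i * cos x.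
Proof.
elim: i => [|i IH]; first by rewrite mul0r addr0 mul1r.
by rewrite -natr1 mulrDl mul1r addrA cosDpi IH exprS mulN1r mulNr.
Qed.

(** Away from 0 and [q] the jumps are the alternating signs; the odd reflection at 0 and at [q]
    changes a jump of modulus 1 into one of modulus 2 or 0, whence the two corrections. *)
Lemma jump_alternating i : (i < 2 * q)%N ->
  jump q w i = eps * (-1) ^+ i + (i == 0%N)%:R - (i == q)%:R.
Proof.
move=> iq.
have WE k : (k < 2 * q)%N -> oddext_steps q w k = if (k < q)%N then w k else - w (2 * q - k.+1)%N.
  by move=> h; rewrite /oddext_steps modn_small.
have ow j : w j = if c then (odd j)%:R else (~~ odd j)%:R.
  by rewrite /w; case: c; case: (odd j).
rewrite /jump -signr_odd WE //.
case: i iq => [|i] iq.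
  have -> : (0 + 2 * q - 1 = 2 * q - 1)%N by [].
  rewrite WE; last by lia.
  have -> : (2 * q - 1 < q)%N = false by apply/negbTE; lia.
  have -> : (2 * q - (2 * q - 1).+1 = 0)%N by lia.
  rewrite q_gt0 eq_sym (gtn_eqF q_gt0) !ow /eps; case: c => /=; lra.
have -> : (i.+1 + 2 * q - 1 = i + 2 * q * 1)%N by lia.
rewrite oddext_stepsD WE; last by lia.
case: (ltngtP i.+1 q) => h.
- rewrite !ow /eps /=; case: c; case: (odd i) => /=; lra.
- have -> : (2 * q - i.+1 = (2 * q - i.+2).+1)%N by lia.
  have -> : odd (i.+1) = odd ((2 * q - i.+2).+1).
    by have := odd_double q; lia.
  rewrite !ow /eps [odd _.+1]/=; case: c; case: (odd (2 * q - i.+2)) => /=; lra.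
- rewrite -h.
  have -> : (2 * i.+1 - i.+2 = i)%N by lia.
  have oi : odd i = false by apply/negbTE; rewrite -[odd i]negbK -[~~ odd i]/(odd i.+1) h oq.
  rewrite /= !ow oi /eps; case: c => /=; lra.
Qed.

(** The sign (-1)^i is absorbed into the cosine by raising the frequency from n to n + q. The full
    cosine sum then vanishes unless 2 q divides n + q, that is unless n is an odd multiple of [q];
    the corrections at 0 and [q] contribute 1 - (-1)^n. *)
Lemma fcoef_alternating n :
  fcoef q w n = 2 / pi * ((odd n)%:R * (1 + eps * q%:R * (q %| n)%N%:R)).
Proof.
have qR : (q%:R : R) != 0 by rewrite pnatr_eq0 -lt0n.
have q2 : (0 < 2 * q)%N by rewrite muln_gt0.
rewrite /fcoef.
have -> : \sum_(i < 2 * q) jump q w i * cos (n%:R * pi * (i%:R / q%:R)) =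
  eps * \sum_(i < 2 * q) cos (i%:R * pi * ((n + q)%:R / q%:R)) + 1 - (-1) ^+ n.
  transitivity (\sum_(i < 2 * q) (eps * cos (i%:R * pi * ((n + q)%:R / q%:R)) +
     (if i == Ordinal q2 then 1 else 0) - (if (i : nat) == q then (-1) ^+ n else 0))).
    apply: eq_bigr => i _; rewrite jump_alternating //.
    have -> : i%:R * pi * ((n + q)%:R / q%:R) = n%:R * pi * (i%:R / q%:R) + i%:R * pi :> R.
      by rewrite natrD; field.
    rewrite cos_addr_natpi -val_eqE /=; set x := _ / q%:R.
    case: (eqVneq (i : nat) 0%N) => [i0|_].
      rewrite /x i0 mul0r mulr0 cos0 eq_sym (gtn_eqF q_gt0) /=; ring.
    case: (eqVneq (i : nat) q) => [iE|_] /=; last by ring.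
    by rewrite /x iE divff // -[_ * pi * 1]add0r mulr1 cos_addr_natpi cos0 /=; ring.
  rewrite sumrB big_split /= -mulr_sumr -!big_mkcond big_pred1_eq; congr (_ - _).
  have ql : (q < 2 * q)%N by lia.
  by rewrite (big_pred1 (Ordinal ql)) // => i; rewrite -val_eqE.
rewrite sum_cos_grid // -[(-1) ^+ n]signr_odd.
have -> : (2 * q %| n + q)%N = odd n && (q %| n)%N.
  rewrite Gauss_dvd ?coprime2n // dvdn2 oddD oq addbT negbK dvdn_addl //.
have P0 : (pi : R) != 0 by exact: pi_neq0.
move: P0; move: (pi : R) => P P0; rewrite natrM.
by case: (odd n); case: (q %| n)%N => /=; rewrite ?mulr1n ?mulr0n; field.
Qed.

Lemma dspan_alternating : dspan (fun n => fcoef q w n / n%:R)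
  (fun m => sieved [:: 2] m + eps * dshift q (sieved [:: 2]) m).
Proof.
apply: eq_dspan (dspanZ (pi / 2) (dspan_self _)) => m m0.
have mR : (m%:R : R) != 0 by rewrite pnatr_eq0 -lt0n.
have qR : (q%:R : R) != 0 by rewrite pnatr_eq0 -lt0n.
have sE n : sieved [:: 2] n = (odd n)%:R / n%:R :> R.
  by rewrite /sieved /prime_to /= dvdn2 negbK andbT.
rewrite fcoef_alternating sE.
have P0 : (pi : R) != 0 by exact: pi_neq0.
move: P0; move: (pi : R) => P P0.
rewrite /dshift; case: ifP => [/dvdnP[k kE]|qm]; last first.
  by rewrite mulr0n; field; rewrite mR P0.
have k0 : (k%:R : R) != 0 by rewrite pnatr_eq0; apply: contraTneq m0 => k0; rewrite kE k0.
rewrite sE kE mulnK // oddM oq andbT natrM.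
by rewrite mulr1n; field; rewrite k0 P0 qR.
Qed.

Lemma alternating_inC p (phi : R -> R) : prime p -> (2 < p)%N -> (p %| q)%N ->
  step_on q w phi -> (forall x, `|phi x| <= 1) -> inC phi.
Proof.
move=> pp p2 pq sp phiB; apply: (dclosure_inC q_gt0 sp phiB).
  apply: (L2_bounded (B := 1)) => [|x _]; last exact: phiB.
  exact: measurable_step sp.
apply: (sieve_fejer_cyclic (p := p) (q := q) (eps := eps)) => //.
  by rewrite /eps; case: c; rewrite ?sqrrN expr1n.
exact: dspan_alternating.
Qed.

End Alternating.

Section GridUnions.
Context {R : realType}.
Variable q : nat.
Hypotheses (q_gt0 : (0 < q)%N) (oq : odd q).

Lemma grid_ltE (i j : nat) : (i%:R / q%:R < j%:R / q%:R :> R) = (i < j)%N.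
Proof. by rewrite ltr_pM2r ?invr_gt0 ?ltr0n // ltr_nat. Qed.

Lemma step_Vodd : step_on q (fun i => (odd i == true)%:R) (indic (Vodd q) : R -> R).
Proof.
move=> i iq x /andP[x1 x2]; rewrite indicE; congr ((nat_of_bool _)%:R); rewrite eqb_id.
apply/idP/idP.
  move=> /set_mem [j _ [y1 y2]].
  have := lt_trans x1 y2; have := lt_trans y1 x2; rewrite !grid_ltE; lia.
move=> oi; apply/mem_set; exists i./2; first by lia.
have -> : (2 * i./2 + 1 = i)%N by lia.
by have -> : (2 * i./2 + 2 = i.+1)%N by lia.
Qed.

Lemma step_Veven : step_on q (fun i => (odd i == false)%:R) (indic (Veven q) : R -> R).
Proof.
move=> i iq x /andP[x1 x2]; rewrite indicE; congr ((nat_of_bool _)%:R); rewrite eqbF_neg.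
apply/idP/idP.
  move=> /set_mem [j _ [y1 y2]].
  have := lt_trans x1 y2; have := lt_trans y1 x2; rewrite !grid_ltE; lia.
move=> oi; apply/mem_set; exists i./2; first by lia.
have -> : (2 * i./2 = i)%N by lia.
by rewrite addn1.
Qed.

End GridUnions.

Lemma jump_interior (R : realType) q (w : nat -> R) k : (0 < k < q)%N -> jump q w k = w k - w k.-1.
Proof.
case: k => // k /= kq; rewrite /jump.
have -> : (k.+1 + 2 * q - 1 = k + 2 * q * 1)%N by lia.
rewrite oddext_stepsD /oddext_steps !modn_small; try by lia.
by rewrite kq (ltn_trans (ltnSn k) kq).
Qed.

Theorem theorem1p9 (R : realType) (p l : nat) (V : set R) :
  prime p -> (7 <= p)%N -> (1 <= l)%N ->
  open V -> V `<=` I01 -> V <> I01 -> nondegenerateV V ->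
  (forall x, boundary V x -> exists s : int, x = s%:~R / (p ^ l)%:R) ->
  ~~ (p %| \big[gcdn/0%N]_(s < (p ^ l).+1 |
            `[< boundary V (s%:R / (p ^ l)%:R) >]) (s : nat))%N ->
  (inC (indic V : R -> R) <-> V = Vodd (p ^ l) \/ V = Veven (p ^ l)).
Proof.
move=> pp p7 l0 oV V01 _ nV bV gV.
have q_gt0 : (0 < p ^ l)%N by rewrite expn_gt0 prime_gt0.
have oq : odd (p ^ l) := odd_q l pp p7.
have pq : (p %| p ^ l)%N := p_dvd_q p l0.
have indic1 (A : set R) x : `|indic A x| <= 1 :> R.
  by rewrite indicE; case: (x \in A); rewrite ?normr1 ?normr0.
split; last first.
  have p2 : (2 < p)%N by exact: leq_trans p7.
  case=> ->.
    exact: (alternating_inC q_gt0 oq pp p2 pq (step_Vodd q_gt0 oq) (indic1 _)).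
  exact: (alternating_inC q_gt0 oq pp p2 pq (step_Veven q_gt0 oq) (indic1 _)).
move=> cV; have sp := step_indic q_gt0 oV bV.
have dc := inC_dcyclic q_gt0 sp (indic1 V) cV.
have q2 : (0 < 2 * p ^ l)%N by rewrite muln_gt0.
have q21 : (1 < 2 * p ^ l)%N by rewrite mul2n -addnn -addn1 leq_add.
have [s [sq ps bs]] := jump_witness q_gt0 oV nV bV pq gV.
have H := jump_dichotomy pp p7 l0 (jump_mod _ q_gt0) (jump_even _ q_gt0) (jump_interior _) _ sq ps bs.
have {}H k : (k < p ^ l)%N -> cell_in (p ^ l) V k = cell_in (p ^ l) V 0 (+) odd k.
  apply: H => a ca.
  have [t t1 ft] := dcyclic_quasi_invariant q2 dc (fcoef_periodic _ q_gt0) ca q21.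
  by exists t => //; exact: jump_quasi_invariant.
case c0 : (cell_in (p ^ l) V 0).
  by right; apply: alternating_Veven => // k kq; rewrite H // c0.
by left; apply: alternating_Vodd => // k kq; rewrite H // c0.
Qed.
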